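(* For every integer $d\geq 2$, $e_{\mathrm{HK}}(S_{3,d})>e_{\mathrm{HK}}(R_{3,d})$.
   Context: For a Noetherian local ring $(R,\mathfrak{m})$ of prime characteristic $p$ and dimension $d$, let $\mathfrak{m}^{[p^e]}=(a^{p^e}:a\in\mathfrak{m})$, $\mathrm{HK}_e(R)=\operatorname{length}_R(R/\mathfrak{m}^{[p^e]})$, and $e_{\mathrm{HK}}(R)=\lim_{e\to\infty}\mathrm{HK}_e(R)/p^{ed}$ (the Hilbert–Kunz multiplicity; the limit exists). $R_{3,d}=\mathbb{F}_3[[x_0,\dots,x_d]]/(Q_d)$, where $Q_d=x_0x_1+x_2x_3+\dots+x_{d-1}x_d$ if $d$ is odd and $Q_d=x_0x_1+\dots+x_{d-2}x_{d-1}+x_d^2$ if $d$ is even. $S_{3,d}=\mathbb{F}_3[[x_0,\dots,x_d]]/(P_d)$, where $P_d=x_0x_1+\dots+x_{d-3}x_{d-2}+x_{d-1}^2+x_d^3$ if $d$ is odd and $P_d=x_0x_1+\dots+x_{d-2}x_{d-1}+x_d^3$ if $d$ is even. *)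

(* Defs.v *)
From HB Require Import structures.
From mathcomp Require Import all_boot all_order all_algebra.
(* [mpoly] must be imported before [topology]: in the other order their
   grammars clash. *)
From mathcomp Require Import mpoly.
From mathcomp Require Import boolp classical_sets functions reals.
From mathcomp Require Import topology normedtype sequences.
Import GRing.Theory numFieldNormedType.Exports.

Set Implicit Arguments.
Unset Strict Implicit.
Unset Printing Implicit Defensive.

Local Open Scope classical_set_scope.
Local Open Scope ring_scope.
Local Open Scope quotient_scope.

(* The largest [n] such that there is a strict chain
   [C 0 `<` C 1 `<` ... `<` C n] of members of [P]. The value is [0] if such
   chains are unboundedly long (or if [P] is empty). *)
Definition has_chain (T : Type) (P : set (set T)) (n : nat) : Prop :=
  exists C : nat -> set T,
    (forall i, (i <= n)%N -> P (C i)) /\ (forall i, (i < n)%N -> C i `<` C i.+1).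

Definition chain_length (T : Type) (P : set (set T)) : nat :=
  xget 0%N [set n | has_chain P n /\ forall k, has_chain P k -> (k <= n)%N].

Definition submodule (A : nzRingType) (V : lmodType A) : set (set V) :=
  [set N | GRing.submod_closed (mem N)].

Definition module_length (A : nzRingType) (V : lmodType A) : nat :=
  chain_length (@submodule A V).

Section QuotientModule.
Variables (A : nzRingType) (V : lmodType A) (N : submodClosed V).

(* [submodClosed] does not inherit from [zmodClosed], on which the quotients of
   the library are built. *)
Definition submod_zmod : {pred V} := N.

HB.instance Definition _ := GRing.isZmodClosed.Build V submod_zmod
  (GRing.submod_closedB (GRing.submodClosedP N)).

Definition quotmod : Type := Quotient.quot submod_zmod.

HB.instance Definition _ := GRing.Zmodule.on quotmod.

Definition quotmod_scale (a : A) (x : quotmod) : quotmod :=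
  \pi_(Quotient.quot submod_zmod) (a *: repr (x : (Quotient.quot submod_zmod))).

Lemma quotmod_scale_pi (a : A) (v : V) :
  quotmod_scale a (\pi_(Quotient.quot submod_zmod) v) = \pi_(Quotient.quot submod_zmod) (a *: v).
Proof.
apply/eqP; rewrite -Quotient.idealrBE -scalerBr.
rewrite -[submod_zmod]/(N : {pred V}) rpredZ //.
rewrite -[N : {pred V}]/submod_zmod.
by rewrite Quotient.idealrBE reprK.
Qed.

Lemma quotmod_scalerA (a b : A) (x : quotmod) :
  quotmod_scale a (quotmod_scale b x) = quotmod_scale (a * b) x.
Proof.
by rewrite -[x](@reprK _ (Quotient.quot submod_zmod)) !quotmod_scale_pi scalerA.
Qed.

Lemma quotmod_scale1r : left_id 1 quotmod_scale.
Proof.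
by move=> x; rewrite -[x](@reprK _ (Quotient.quot submod_zmod)) quotmod_scale_pi scale1r.
Qed.

Lemma quotmod_scalerDr : right_distributive quotmod_scale +%R.
Proof.
move=> a x y; rewrite -[x](@reprK _ (Quotient.quot submod_zmod)) -[y](@reprK _ (Quotient.quot submod_zmod)).
by rewrite -[LHS]/(quotmod_scale a (_ + _ : (Quotient.quot submod_zmod))) -raddfD
   !quotmod_scale_pi scalerDr raddfD.
Qed.

Lemma quotmod_scalerDl (x : quotmod) :
  {morph quotmod_scale^~ x : a b / a + b}.
Proof.
move=> a b; rewrite -[x](@reprK _ (Quotient.quot submod_zmod)) !quotmod_scale_pi.
by rewrite scalerDl raddfD.
Qed.

HB.instance Definition _ := GRing.Zmodule_isLmodule.Build A quotmod
  quotmod_scalerA quotmod_scale1r quotmod_scalerDr quotmod_scalerDl.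

End QuotientModule.

Section Ideals.
Variable A : comNzRingType.

(* Ideals of [A] are the [A]-submodules of the regular module [A^o]. *)
Definition ideal_gen (X : set A) : {pred A^o} :=
  fun a => a \in smallest (@submodule A A^o) X.

Lemma ideal_gen_submod_closed (X : set A) :
  GRing.submod_closed (ideal_gen X).
Proof.
split=> [|a u v]; first by apply/mem_set => I [[I0 _] _]; exact: set_mem.
move=> /set_mem hu /set_mem hv; apply/mem_set => I hI.
apply/set_mem/(hI.1.2 a); apply/mem_set; [exact: hu | exact: hv].
Qed.

HB.instance Definition _ (X : set A) :=
  GRing.isSubmodClosed.Build A A^o (ideal_gen X) (ideal_gen_submod_closed X).

Definition prime_ideal : set (set A) :=
  [set P | idealr_closed (mem P) /\ prime_idealr_closed (mem P)].

Definition krull_dim : nat := chain_length prime_ideal.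

Definition maximal_ideal : set (set A) :=
  [set M | idealr_closed (mem M) /\
           forall J : set A, idealr_closed (mem J) -> M `<=` J -> J = M].

Definition local_ring (m : set A) : Prop :=
  maximal_ideal m /\ forall M, maximal_ideal M -> M = m.

(* Meaningful only if [A] is a local ring; the value is [set0] otherwise. *)
Definition the_maximal_ideal : set A := xget set0 local_ring.

Definition frobenius_power (I : set A) (q : nat) : submodClosed A^o :=
  ideal_gen [set a ^+ q | a in I].

End Ideals.

Arguments prime_ideal : clear implicits.
Arguments maximal_ideal : clear implicits.
Arguments the_maximal_ideal : clear implicits.

Definition HK (p e : nat) (A : comNzRingType) : nat :=
  module_length (quotmod (frobenius_power (the_maximal_ideal A) (p ^ e))).

Definition eHK (R : realType) (p : nat) (A : comNzRingType) : R :=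
  limn (fun e => (HK p e A)%:R / (p ^ (e * krull_dim A))%:R : R).

(* Formal power series in [n] commuting variables, as families of coefficients
   indexed by the exponents of monomials. *)
Section PowerSeries.
Variables (n : nat) (K : comNzRingType).

Definition mfps : Type := 'X_{1..n} -> K.

HB.instance Definition _ := GRing.Zmodule.copy mfps ('X_{1..n} -> K).

Implicit Types f g h : mfps.

Lemma mfpsP f g : f =1 g -> f = g.
Proof. exact: funext. Qed.

Definition mfps_one : mfps := fun m => (m == 0%MM)%:R.

Definition mfps_mul f g : mfps := fun m =>
  \sum_(k : 'X_{1..n < (mdeg m).+1, (mdeg m).+1} | m == (k.1 + k.2)%MM)
     f k.1 * g k.2.

Let tr (b : nat) f : {mpoly K[n]} :=
  \sum_(k : 'X_{1..n < b}) f k *: 'X_[k].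

Let mcoeff_tr b f m : (mdeg m < b)%N -> (tr b f)@_m = f m.
Proof.
move=> lt_mb; rewrite raddf_sum /= (bigD1 (BMultinom lt_mb)) //=.
rewrite mcoeffZ mcoeffX eqxx mulr1 big1 ?addr0 // => k ne_k.
rewrite mcoeffZ mcoeffX; case: eqP => [km|_]; last by rewrite mulr0.
by case/eqP: ne_k; apply/val_inj.
Qed.

Let le_deg m (k1 k2 : 'X_{1..n}) : m = (k1 + k2)%MM ->
  (mdeg k1 <= mdeg m)%N /\ (mdeg k2 <= mdeg m)%N.
Proof. by move=> ->; rewrite mdegD leq_addr leq_addl. Qed.

Let mulE b f g m : (mdeg m < b)%N ->
  mfps_mul f g m = (tr b f * tr b g)@_m.
Proof.
move=> lt_mb; rewrite mcoeffM; apply: eq_bigr => -[k1 k2] /= /eqP /le_deg [d1 d2].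
by rewrite !mcoeff_tr // (leq_ltn_trans _ lt_mb).
Qed.

Let eq_mcoeffM b (p q p' q' : {mpoly K[n]}) m : (mdeg m < b)%N ->
  (forall k, (mdeg k < b)%N -> p@_k = p'@_k) ->
  (forall k, (mdeg k < b)%N -> q@_k = q'@_k) ->
  (p * q)@_m = (p' * q')@_m.
Proof.
move=> lt_mb hp hq; rewrite !mcoeffM.
apply: eq_bigr => -[k1 k2] /= /eqP /le_deg [d1 d2].
by rewrite hp ?hq // (leq_ltn_trans _ lt_mb).
Qed.

Let tr_mul b f g k : (mdeg k < b)%N ->
  (tr b (mfps_mul f g))@_k = (tr b f * tr b g)@_k.
Proof. by move=> lt_kb; rewrite mcoeff_tr // (mulE _ _ lt_kb). Qed.

Lemma mfps_mulA : associative mfps_mul.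
Proof.
move=> f g h; apply: mfpsP => m; have lt_mb := ltnSn (mdeg m).
rewrite !(mulE _ _ lt_mb).
rewrite (@eq_mcoeffM _ _ _ (tr (mdeg m).+1 f) _ m lt_mb _ (@tr_mul _ g h)) //.
rewrite [RHS](@eq_mcoeffM _ _ _ _ (tr (mdeg m).+1 h) m lt_mb (@tr_mul _ f g)) //.
by rewrite mulrA.
Qed.

Lemma mfps_mulC : commutative mfps_mul.
Proof.
move=> f g; apply: mfpsP => m.
by rewrite !(mulE _ _ (ltnSn (mdeg m))) mulrC.
Qed.

Lemma mfps_mul1 : left_id mfps_one mfps_mul.
Proof.
move=> f; apply: mfpsP => m; have lt_mb := ltnSn (mdeg m).
rewrite (mulE _ _ lt_mb).
rewrite (@eq_mcoeffM _ _ _ 1 (tr (mdeg m).+1 f) m lt_mb) //.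
  by rewrite mul1r mcoeff_tr.
by move=> k lt_k; rewrite mcoeff_tr // mcoeff1.
Qed.

Lemma mfps_mulDl : left_distributive mfps_mul +%R.
Proof.
move=> f g h; apply: mfpsP => m.
rewrite -[RHS]/(mfps_mul f h m + mfps_mul g h m) /mfps_mul -big_split /=.
by apply: eq_bigr => k _; rewrite -mulrDl.
Qed.

Lemma mfps_one_neq0 : mfps_one != 0.
Proof.
apply/eqP => /(congr1 (fun f : mfps => f 0%MM)) /eqP.
by rewrite /mfps_one eqxx; apply/negP/oner_neq0.
Qed.

HB.instance Definition _ := GRing.Zmodule_isComNzRing.Build mfps
  mfps_mulA mfps_mulC mfps_mul1 mfps_mulDl mfps_one_neq0.

Definition mfpsX (i : 'I_n) : mfps := fun m => (m == U_(i)%MM)%:R.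

Definition mfps_const f : K := f 0%MM.

Lemma mfps_constD f g : mfps_const (f + g) = mfps_const f + mfps_const g.
Proof. by []. Qed.

Lemma mfps_constM f g : mfps_const (f * g) = mfps_const f * mfps_const g.
Proof.
rewrite /mfps_const -[LHS]/(mfps_mul f g 0%MM).
have lt0 : (mdeg (0%MM : 'X_{1..n}) < 1)%N by rewrite mdeg0.
by rewrite (mulE _ _ lt0) rmorphM /= !mcoeff_tr.
Qed.

Lemma mfps_const_sum (I : finType) (P : pred I) (F : I -> mfps) :
  mfps_const (\sum_(i | P i) F i) = \sum_(i | P i) mfps_const (F i).
Proof. exact: (big_morph mfps_const mfps_constD). Qed.

Lemma mfps_constX i : mfps_const (mfpsX i) = 0.
Proof. by rewrite /mfps_const /mfpsX eq_sym mnm1_eq0. Qed.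

Lemma mfps_constXn i k : mfps_const (mfpsX i ^+ k.+1) = 0.
Proof. by rewrite exprS mfps_constM mfps_constX mul0r. Qed.

(* The ideal [(F)] of a power series [F] without constant term: the hypothesis
   makes it proper, as the library requires of the ideal of a quotient ring. *)
Section Hypersurface.
Variables (F : mfps) (F0 : mfps_const F = 0).

Definition hypersurface_ideal of mfps_const F = 0 : {pred mfps} :=
  ideal_gen [set F].

Lemma hypersurface_ideal_closed : idealr_closed (hypersurface_ideal F0).
Proof.
have [I0 Icl] := ideal_gen_submod_closed [set F].
split=> //; apply/negP => /set_mem gen1.
have /gen1 : submodule [set f : mfps^o | mfps_const f = 0] /\
    [set F] `<=` [set f : mfps^o | mfps_const f = 0].
  split; last by move=> _ ->.
  split=> [|a u v]; rewrite ?inE //= => u0 v0.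
  by rewrite mfps_constD mfps_constM u0 v0 mulr0 addr0.
move/eqP; apply/negP; rewrite -[mfps_const 1]/(mfps_one 0%MM) /mfps_one eqxx.
exact: oner_neq0.
Qed.

HB.instance Definition _ := isIdealr.Build mfps (hypersurface_ideal F0)
  hypersurface_ideal_closed.

Definition hypersurface : comNzRingType := {ideal_quot hypersurface_ideal F0}.

End Hypersurface.

End PowerSeries.

Section Equations.
Variable d : nat.

Let x (k : nat) : mfps d.+1 'F_3 := mfpsX 'F_3 (inord k).

(* [\sum_(i < r) x (2 i) * x (2 i + 1)] is [x_0 x_1 + ... + x_(2r-2) x_(2r-1)];
   the last index is [d] for [r = (d+1)/2], [d - 1] for [r = d/2] ([d] even) and
   [d - 2] for [r = (d-1)/2] ([d] odd). *)
Definition Q_ : mfps d.+1 'F_3 :=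
  if odd d then \sum_(i < d.+1./2) x i.*2 * x i.*2.+1
  else \sum_(i < d./2) x i.*2 * x i.*2.+1 + x d ^+ 2.

Definition P_ : mfps d.+1 'F_3 :=
  if odd d then
    \sum_(i < d.-1./2) x i.*2 * x i.*2.+1 + x d.-1 ^+ 2 + x d ^+ 3
  else \sum_(i < d./2) x i.*2 * x i.*2.+1 + x d ^+ 3.

Let hyperbolic_const0 r :
  mfps_const (\sum_(i < r) x i.*2 * x i.*2.+1) = 0.
Proof.
rewrite mfps_const_sum big1 // => i _.
by rewrite mfps_constM mfps_constX mul0r.
Qed.

Lemma Q_const0 : mfps_const Q_ = 0.
Proof.
rewrite /Q_; case: odd; first exact: hyperbolic_const0.
by rewrite mfps_constD hyperbolic_const0 mfps_constXn addr0.
Qed.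

Lemma P_const0 : mfps_const P_ = 0.
Proof.
by rewrite /P_; case: odd; rewrite !mfps_constD hyperbolic_const0 !mfps_constXn
  !addr0.
Qed.

End Equations.

Definition R3 (d : nat) : comNzRingType := hypersurface (Q_const0 d).

Definition S3 (d : nat) : comNzRingType := hypersurface (P_const0 d).

(* Main.v *)
Require Import Defs.
From HB Require Import structures.
From mathcomp Require Import all_boot all_order all_algebra reals.
From mathcomp Require Import zify ssrAC.
From mathcomp Require Import mpoly.
From mathcomp Require Import boolp classical_sets functions.
From mathcomp Require Import topology normedtype sequences.
Import Order.TTheory GRing.Theory Num.Theory numFieldNormedType.Exports.

Set Implicit Arguments.
Unset Strict Implicit.
Unset Printing Implicit Defensive.

Local Open Scope classical_set_scope.
Local Open Scope ring_scope.

(** Write [q = 3^e], [r = q / 3], and [H] for the hyperbolic form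
    [x_0 x_1 + ... + x_(2a-2) x_(2a-1)] common to the two equations, acting on the
    truncated algebra [N = K[x_0, ..., x_(2a-1)] / (x_i^q)]. Let [k t] be the
    dimension of the kernel of [H^t] on [N], which is also the length of
    [N / H^t N]. Since [k t] is the sum over [s < t] of the dimensions of
    [ker H] intersected with the image of [H^s], it is a concave function of [t].

    The length of a hypersurface ring modulo the [q]-th Frobenius power of its
    maximal ideal is the nullity of the equation on the truncated algebra
    ([module_length_frobenius]). Multiplication by a monomial in new variables
    permutes the monomials along chains, and adding it to [H] gives an operator
    whose kernel splits along the chains into kernels of powers of [H]
    ([nullity_shift]). With [q = 6 h + 3] this yields, for the even dimension
    [d = 2 a],
      - [k (3 h + 1) + k (3 h + 2)] for [H + z^2] and [3 k r] for [H + w^3],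
    and for the odd dimension [d = 2 a + 1], where one also uses
    [(H + z^2)^r = H^r + z^(2r)] in characteristic 3,
      - the trapezoidal sum of [k] over [0, q] for [H + x y],
        and [q (k r + k (2 r))] for [H + z^2 + w^3].
    In both cases concavity of [k] gives the weak inequality, by comparison with a
    tangent at [r] in the even case ([concave_thirds_even]), and with the tangents
    at [r] and [2 r] in the odd case ([concave_thirds_odd]). The inequality is
    strict in the limit because [N] has a direct summand of dimension at least a
    constant times [q^(2a)] that [H^r] kills ([ex_short_projection]): on it [k] is
    constant from [r] on, which makes the gap at least a constant times [q^d]
    ([nullity_gap]).

    To pass to multiplicities one needs the limits to exist and the Krull
    dimension to be [d]. The ratios do not decrease with [e], because the nullity of the
    cube of the equation is at most three times that of the equation, and cubing
    the variables turns the truncation at [q] into the truncation at [3 q]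
    ([nullity_frobenius]); they are bounded by the formulas above.
    Chains of primes are bounded as for polynomials, by dropping the first prime
    and contracting the others to power series in one variable less, over which
    the quotient is finite ([mfps_prime_chain]). In the other direction, as the
    equation has the form [x_0 x_1 + G (x_2, ..., x_d)], the blow-up chart
    [x_i = x_1 z_i] parametrizes the hypersurface by power series in [d] variables,
    and the coordinate sections of the chart pull back to a chain of [d + 1] primes
    ([hypersurface_has_chain]). *)

(** * Nullities of powers of an operator *)

Section Nullity.
Variables (K : fieldType) (V : vectType K).
Implicit Types (T : 'End(V)) (U : {vspace V}).

Definition nullity T : nat := \dim (lker T).

Definition lpow T (t : nat) : 'End(V) := iter t (comp_lfun T) \1%VF.

Lemma lpowE T t v : lpow T t v = iter t T v.
Proof. by elim: t => [|t IH]; rewrite ?id_lfunE //= comp_lfunE /= -IH. Qed.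

Lemma lpowD T s t v : lpow T (s + t) v = lpow T s (lpow T t v).
Proof. by rewrite !lpowE iterD. Qed.

Lemma lpow1 T : lpow T 1 = T.
Proof. exact: comp_lfun1r. Qed.

Lemma lpowSr T t v : lpow T t.+1 v = lpow T t (T v).
Proof. by rewrite !lpowE iterSr. Qed.

Lemma lpowM T s t : lpow (lpow T s) t = lpow T (s * t).
Proof.
apply/lfunP => v; elim: t => [|t IH]; first by rewrite muln0 !lpowE.
by rewrite mulnS lpowD -IH -add1n lpowD lpow1.
Qed.

(** Freshman's dream for commuting operators; composition makes ['End(V)] a ring
    only when [V] is not trivial, hence the elementwise computation. *)
Lemma lpow_frobenius (T1 T2 : 'End(V)) e : (3%:R = 0 :> K) ->
  (forall v, T1 (T2 v) = T2 (T1 v)) ->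
  forall v, lpow (T1 + T2) (3 ^ e)%N v = lpow T1 (3 ^ e)%N v + lpow T2 (3 ^ e)%N v.
Proof.
move=> K3; elim: e T1 T2 => [|e IH] T1 T2 TC v; first by rewrite !expn0 !lpow1 lfunE.
have comm n m u : lpow T1 n (lpow T2 m u) = lpow T2 m (lpow T1 n u).
  have C1 w : T1 (lpow T2 m w) = lpow T2 m (T1 w).
    by rewrite !lpowE; elim: m => //= m <-; rewrite TC.
  by rewrite ![lpow T1 _ _]lpowE; elim: n => //= n ->; rewrite C1.
rewrite expnSr -!lpowM.
have -> : lpow (T1 + T2) (3 ^ e)%N = lpow T1 (3 ^ e)%N + lpow T2 (3 ^ e)%N.
  by apply/lfunP => u; rewrite IH // lfunE.
move: (comm (3 ^ e)%N (3 ^ e)%N); set A := lpow T1 _; set B := lpow T2 _ => AB.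
have V3 (u : V) : u + u + u = 0.
  by rewrite -mulr2n -mulrSr -scaler_nat K3 scale0r.
rewrite !lpowE /= !add_lfunE !linearD /= !AB.
by rewrite [LHS](AC (2*2*(2*2)) (1*(2*3*5)*(4*6*7)*8)) /= !V3 !addr0.
Qed.

Lemma nullity_le_dim T : (nullity T <= dim V)%N.
Proof. by rewrite -dimvf dimvS ?subvf. Qed.

Definition nullity_in U T t : nat := \dim (U :&: lker (lpow T t)).
Definition kernel_step U T s : nat := \dim ((lpow T s @: U) :&: lker T).

Lemma nullity_in0 U T : nullity_in U T 0 = 0%N.
Proof.
apply/eqP; rewrite dimv_eq0 -subv0; apply/subvP => v /memv_capP[_].
by rewrite memv_ker lpowE /= memv0.
Qed.

(** [T^s] maps the vectors of [U] killed by [T^(s+1)] onto the vectors of the image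
    of [U] killed by [T]. *)
Lemma nullity_inS U T s : nullity_in U T s.+1 = (nullity_in U T s + kernel_step U T s)%N.
Proof.
rewrite /nullity_in /kernel_step -(limg_ker_dim (lpow T s) (U :&: lker (lpow T s.+1))).
congr (_ + _)%N; congr dimv; apply/vspaceP => v.
  rewrite !memv_cap !memv_ker !lpowE /=; case: (v \in U) => //=.
  by case: (iter s T v =P 0) => [->|]; rewrite ?linear0 ?eqxx ?andbF.
apply/memv_imgP/memv_capP => [[u]|[/memv_imgP[u uU ->]]].
  rewrite memv_cap memv_ker !lpowE /= => /andP[uU /eqP u0] ->.
  by split; [rewrite -lpowE; apply: memv_img | rewrite memv_ker u0].
by rewrite memv_ker lpowE => u0; exists u; rewrite ?lpowE // memv_cap uU memv_ker lpowE.
Qed.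

Lemma nullity_inE U T t : nullity_in U T t = (\sum_(s < t) kernel_step U T s)%N.
Proof. by elim: t => [|t IH]; rewrite ?big_ord0 ?nullity_in0 // big_ord_recr /= nullity_inS IH. Qed.

Lemma kernel_step_noninc U T s : (T @: U <= U)%VS -> (kernel_step U T s.+1 <= kernel_step U T s)%N.
Proof.
move=> TU; apply/dimvS/capvS => //.
have -> : lpow T s.+1 = (lpow T s \o T)%VF.
  by apply/lfunP => v; rewrite comp_lfunE lpowSr.
by rewrite limg_comp limgS.
Qed.

Lemma nullity_fullv T t : nullity (lpow T t) = nullity_in fullv T t.
Proof. by rewrite /nullity_in capfv. Qed.

(** An idempotent that commutes with [T] splits the space into two stable summands,
    and the nullities add up. *)
Lemma nullity_split (T e : 'End(V)) t :
  (forall v, e (e v) = e v) -> (forall v, e (T v) = T (e v)) ->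
  nullity (lpow T t) = (nullity_in (limg e) T t + nullity_in (lker e) T t)%N.
Proof.
move=> ee eT; rewrite /nullity -(limg_ker_dim e) addnC capvC; congr (_ + _)%N; congr dimv.
have eTt v : e (lpow T t v) = lpow T t (e v).
  by rewrite !lpowE; elim: t => //= t <-; rewrite eT.
apply/vspaceP => v; apply/memv_imgP/memv_capP => [[u] | [/memv_imgP[u _ ->]]].
  rewrite memv_ker => /eqP Tu ->.
  by split; [exact/memv_img/memvf | rewrite memv_ker -eTt Tu linear0].
by move=> ku; exists (e u).
Qed.
End Nullity.

Section Coordinates.
Variables (K : fieldType) (V N : vectType K) (I : finType) (p : I -> 'Hom(V, N)).

(** [V] is the product of copies of [N], one for each index. Working with coordinate
    maps instead of [{ffun I -> N}] lets the same space be seen as a product in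
    several ways. *)
Definition coordinates :=
  (forall v, (forall i, p i v = 0) -> v = 0) /\
  (forall g : {ffun I -> N}, exists v, forall i, p i v = g i).

Hypothesis pC : coordinates.

Lemma coordinates_inj u v : (forall i, p i u = p i v) -> u = v.
Proof.
move=> uv; apply/eqP; rewrite -subr_eq0; apply/eqP; apply: pC.1 => i.
by rewrite raddfB /= uv subrr.
Qed.

Lemma coordinates_lift (W : vectType K) (G : I -> 'Hom(W, N)) :
  exists g : 'Hom(W, V), forall i v, p i (g v) = G i v.
Proof.
have [s sP] := boolp.choice (fun v : W => pC.2 [ffun i => G i v]).
have {}sP v i : p i (s v) = G i v by rewrite sP ffunE.
have s_lin : linear s.
  by move=> a u v; apply: coordinates_inj => i; rewrite linearP /= !sP linearP.
pose sL := GRing.isLinear.Build K W V _ s s_lin.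
pose s' : {linear W -> V} := HB.pack s sL.
by exists (linfun s') => i v; rewrite lfunE.
Qed.

Lemma coordinates_dim (W : {vspace V}) (U : I -> {vspace N}) :
  (forall v, (v \in W) = [forall i, p i v \in U i]) ->
  \dim W = (\sum_i \dim (U i))%N.
Proof.
move=> WE.
have [g gP] : exists g : I -> 'Hom(N, V),
    forall i j v, p j (g i v) = if i == j then v else 0.
  have /boolp.choice[g gP] : forall i, exists g : 'Hom(N, V),
      forall j v, p j (g v) = if i == j then v else 0.
    move=> i; have [g gP] := coordinates_lift (fun j => if i == j then \1%VF else 0 : 'End(N)).
    by exists g => j v; rewrite gP; case: ifP => _; rewrite lfunE.
  by exists g.
have -> : W = (\sum_i (g i @: U i))%VS.
  apply/vspaceP => v; apply/idP/memv_sumP => [|[u uU ->]].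
    rewrite WE => /forallP vU; exists (fun i => g i (p i v)) => [i _|].
      exact: memv_img.
    apply: coordinates_inj => j; rewrite linear_sum (bigD1 j) //= gP eqxx.
    by rewrite big1 ?addr0 // => i /negPf; rewrite gP => ->.
  rewrite WE; apply/forallP => j; rewrite linear_sum; apply: rpred_sum => i _.
  have /memv_imgP[w wU ->] := uU i isT; rewrite /= gP; case: eqP => [<- //|_].
  exact: mem0v.
have /directvP /= -> : directv (\sum_i (g i @: U i)).
  apply/directv_sum_independent => u uU u0 i _.
  have /memv_imgP[w wU uE] := uU i isT; rewrite uE.
  move/(congr1 (p i)): u0; rewrite linear_sum linear0 (bigD1 i) //= uE gP eqxx.
  rewrite big1 ?addr0 => [->|j ji]; first by rewrite linear0.
  by have /memv_imgP[w' _ ->] := uU j isT; rewrite gP (negPf ji).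
apply: eq_bigr => i _; apply: limg_dim_eq; apply/eqP; rewrite -subv0.
apply/subvP => v /memv_capP[_]; rewrite memv_ker memv0 => /eqP gv0.
by move/(congr1 (p i)): gv0; rewrite gP eqxx linear0 => ->.
Qed.

Lemma nullity_diag (T' : 'End(V)) (T : I -> 'End(N)) :
  (forall i v, p i (T' v) = T i (p i v)) -> nullity T' = (\sum_i nullity (T i))%N.
Proof.
move=> T'E; apply: coordinates_dim => v; rewrite memv_ker.
apply/eqP/forallP => [v0 i|v0]; first by rewrite memv_ker -T'E v0 linear0.
by apply: pC.1 => i; rewrite T'E; apply/eqP; rewrite -memv_ker.
Qed.

Variables (pr : I -> option I) (ht : I -> nat).
Hypothesis pr_inj : forall i j k, pr i = Some k -> pr j = Some k -> i = j.
Hypothesis htE : forall i, ht i = if pr i is Some j then (ht j).+1 else 1%N.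

Definition top (i : I) : bool := [forall j, pr j != Some i].

(** [T'] adds to [T] a shift that moves the coordinate of [pr i] to [i]. The indices
    form chains, and a vector of the kernel is determined on each chain by its last
    coordinate, which only has to be killed by the power of [T] given by the length
    of the chain. *)
Lemma nullity_shift (T' : 'End(V)) (T : 'End(N)) :
  (forall i v, p i (T' v) = T (p i v) + (if pr i is Some j then p j v else 0)) ->
  nullity T' = (\sum_(i | top i) nullity (lpow T (ht i)))%N.
Proof.
move=> T'E.
have [R RP] := coordinates_lift (fun i => if top i then p i else 0).
have {}RP i v : p i (R v) = if top i then p i v else 0.
  by rewrite RP; case: ifP; rewrite ?lfunE.
pose U i := if top i then lker (lpow T (ht i)) else 0%VS.
have kE v : v \in lker T' ->
    forall i, T (p i v) = - (if pr i is Some j then p j v else 0).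
  rewrite memv_ker => /eqP Tv i; apply/eqP; rewrite -addr_eq0 -T'E Tv.
  by rewrite linear0.
have ktop v : v \in lker T' -> forall n i, ht i = n -> lpow T n (p i v) = 0.
  move=> /kE vE n; elim: n => [|n IH] i.
    by rewrite htE; case: (pr i).
  rewrite htE lpowSr vE; case: (pr i) => [j|_]; last by rewrite oppr0 linear0.
  by rewrite raddfN => -[/IH /= ->]; rewrite oppr0.
rewrite /nullity -(@limg_dim_eq _ _ _ R); last first.
  apply/eqP; rewrite -subv0; apply/subvP => v /memv_capP[/kE vE].
  rewrite memv_ker memv0 => /eqP Rv; apply/eqP/pC.1.
  have topn i : top i -> p i v = 0.
    by move=> ti; have := RP i v; rewrite ti Rv linear0.
  (* descend from the tops: a non-top coordinate is determined by a higher one *)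
  pose M := \max_i ht i.
  have : forall n i, (M - ht i <= n)%N -> p i v = 0.
    elim=> [|n IH] i hi; have [/topn //|/forallPn[j]] := boolP (top i);
      rewrite negbK => /eqP ji; have := htE j; rewrite ji;
      have := leq_bigmax j (F := ht); rewrite -/M => hM hj.
      by lia.
    have := vE j; rewrite ji IH; last by lia.
    by rewrite linear0 => /esym/eqP; rewrite oppr_eq0 => /eqP.
  by move=> h i; apply: (h M); lia.
rewrite (@coordinates_dim _ U) => [|v].
  rewrite [RHS]big_mkcond /=; apply: eq_bigr => i _; rewrite /U.
  by case: ifP => //; rewrite dimv0.
apply/memv_imgP/forallP => [[u uk ->] i|vU].
  rewrite RP /U; case: ifP => _; rewrite ?memv0 // memv_ker.
  by apply/eqP/ktop.
pose fix w (n : nat) (i : I) {struct n} := if n is n'.+1 then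
  if top i then p i v else
  if [pick j | pr j == Some i] is Some j then - T (w n' j) else 0 else 0.
pose M := \max_i ht i.
pose z i := w (M - ht i).+1 i.
have htM i : (ht i <= M)%N by apply: leq_bigmax.
have z_top i : top i -> z i = p i v by rewrite /z /= => ->.
have z_pr j i : pr j = Some i -> z i = - T (z j).
  move=> ji; have ntop : top i = false.
    by apply/negbTE/forallPn; exists j; rewrite negbK ji.
  rewrite /z /= ntop; case: pickP => [j' /eqP j'i|/(_ j)]; last by rewrite ji eqxx.
  rewrite -(pr_inj ji j'i); suff -> : (M - ht i = (M - ht j).+1)%N by [].
  by have := htE j; rewrite ji; have := htM j; lia.
have Tz n : forall i, (M - ht i <= n)%N -> lpow T (ht i) (z i) = 0.
  elim: n => [|n IH] i hi; have [ti|/forallPn[j]] := boolP (top i);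
    try (by have := vU i; rewrite /U ti memv_ker z_top // => /eqP);
    rewrite negbK => /eqP ji; have := htE j; rewrite ji; have := htM j => hM hj.
    by lia.
  rewrite (z_pr _ _ ji) raddfN /= -lpowSr -hj IH ?oppr0 //.
  by lia.
have [u uE] := pC.2 [ffun i => z i].
have {}uE i : p i u = z i by rewrite uE ffunE.
exists u.
  rewrite memv_ker; apply/eqP/pC.1 => j; rewrite T'E uE.
  case ji: (pr j) => [i|]; first by rewrite uE (z_pr _ _ ji) subrr.
  by have := @Tz M j; rewrite htE ji lpow1 addr0; apply; exact: leq_subr.
apply: coordinates_inj => i; rewrite RP uE; case: ifP => ti; first by rewrite z_top.
by have := vU i; rewrite /U ti memv0 => /eqP.
Qed.
End Coordinates.

(** * Two inequalities for concave sequences *)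

Section Concave.
Local Open Scope nat_scope.
Variable c : nat -> nat.
Hypothesis c_noninc : forall s, (c s.+1 <= c s)%N.
Let k t := \sum_(s < t) c s.

Let kS t : k t.+1 = k t + c t.
Proof. by rewrite /k big_ord_recr. Qed.

Let cle s t : s <= t -> c t <= c s.
Proof.
move=> /subnK<-; elim: (t - s) => //= n IH.
by apply: leq_trans IH; rewrite addSn.
Qed.

(** The line of slope [c r] through [(r, k r)] lies above the graph of [k]; the
    inequality is arranged so as to avoid subtraction. *)
Lemma concave_tangent r t : k t + c r * r <= k r + c r * t.
Proof.
have [tr|/ltnW rt] := leqP t r.
  rewrite -(subnK tr); elim: (r - t) {tr} => [|n IH] /=.
    by rewrite add0n.
  have h1 : c (n + t).+1 <= c (n + t) by [].
  rewrite addSn kS; set x := c _ in IH *; set y := c _ in h1 *.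
  have : y * (n + t) <= x * (n + t) by rewrite leq_mul2r h1 orbT.
  have : k t <= k (n + t).
    by elim: n {IH h1 x y} => // n IH; rewrite addSn kS; lia.
  have h0 : y * n <= x * n by rewrite leq_mul2r h1 orbT.
  lia.
rewrite -(subnK rt); elim: (t - r) => [|n IH] //=; rewrite addSn kS.
have : c (n + r) <= c r by apply: cle; rewrite leq_addl.
lia.
Qed.

(** [(3 h + 1) + (3 h + 2) = 3 (2 h + 1)], so the excesses of the two arguments over
    [2 h + 1] add up to [2 h + 1] and the tangent there compares the three values. *)
Lemma concave_thirds_even h :
  k (3 * h).+1 + k (3 * h).+2 <= 3 * k (2 * h).+1.
Proof.
have h0 := concave_tangent (2 * h).+1 0.
have h1 := concave_tangent (2 * h).+1 (3 * h).+1.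
have h2 := concave_tangent (2 * h).+1 (3 * h).+2.
have k0 : k 0 = 0 by rewrite /k big_ord0.
lia.
Qed.

Definition trapezoid (f : nat -> nat) q := \sum_(i < q) (f i + f i.+1).

(** When [k] is constant from some point on, this measures by how much the
    trapezoidal sum falls short of the constant value. *)
Lemma trapezoidE q : trapezoid k q + \sum_(s < q) (2 * s + 1) * c s = 2 * q * k q.
Proof.
elim: q => [|q IH]; first by rewrite /trapezoid !big_ord0 /= muln0.
have -> : trapezoid k q.+1 = trapezoid k q + (k q + k q.+1).
  by rewrite /trapezoid [LHS]big_ord_recr.
by rewrite big_ord_recr kS /=; move: IH; set S := \sum_(_ < _) _; lia.
Qed.

Let tangent_sum r a n :
  \sum_(a <= i < a + n) (k i + k i.+1) + 2 * n * (c r * r)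
    <= 2 * n * k r + c r * (n * (2 * a + n)).
Proof.
elim: n => [|n IH]; first by rewrite addn0 big_geq.
rewrite addnS big_nat_recr ?leq_addr //=.
have h1 := concave_tangent r (a + n); have h2 := concave_tangent r (a + n).+1.
lia.
Qed.

(** The graph lies below the tangent at [r] on the first half of [0, q], and below the
    tangent at [2 r] on the second half. The slopes enter with opposite coefficients,
    and the total has the right sign because the slope decreases. *)
Lemma concave_thirds_odd h (q := (6 * h).+3) :
  trapezoid k q <= q * (k (2 * h).+1 + k (4 * h).+2).
Proof.
rewrite /trapezoid -(big_mkord xpredT (fun i => k i + k i.+1)).
rewrite (@big_cat_nat _ _ _ (3 * h).+1) //=; last by rewrite /q; lia.
rewrite (@big_cat_nat _ _ _ (3 * h).+2 (3 * h).+1) //=; last by rewrite /q; lia.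
rewrite big_nat1 /=.
have := tangent_sum (2 * h).+1 0 (3 * h).+1; rewrite add0n.
have := tangent_sum (4 * h).+2 (3 * h).+2 (3 * h).+1.
have -> : (3 * h).+2 + (3 * h).+1 = q by rewrite /q; lia.
have h1 := concave_tangent (2 * h).+1 (3 * h).+1.
have h2 := concave_tangent (4 * h).+2 (3 * h).+2.
have h3 : c (4 * h).+2 <= c (2 * h).+1 by apply: cle; lia.
have h4 : c (4 * h).+2 * h <= c (2 * h).+1 * h by rewrite leq_mul2r h3 orbT.
have h5 : c (4 * h).+2 * (h * h) <= c (2 * h).+1 * (h * h) by rewrite leq_mul2r h3 orbT.
rewrite /q; set S1 := \sum_(_ <= _ < _) _; set S2 := \sum_(_ <= _ < _) _.
lia.
Qed.
End Concave.

Section Moment.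
Local Open Scope nat_scope.

(** Under the bound [c s <= B] the moment is least when the mass is pushed as far left
    as possible. *)
Lemma sqr_sum_le_moment (c : nat -> nat) B n : (forall s, c s <= B) ->
  (\sum_(s < n) c s) ^ 2 <= B * \sum_(s < n) (2 * s + 1) * c s.
Proof.
move=> cB; suff: \sum_(s < n) c s <= n * B /\
  (\sum_(s < n) c s) ^ 2 <= B * \sum_(s < n) (2 * s + 1) * c s by case.
elim: n => [|n [IH1 IH2]]; first by rewrite !big_ord0.
rewrite !big_ord_recr /=; set S := \sum_(_ < _) _ in IH1 IH2 *.
have cnB := cB n; split; first by lia.
set M := \sum_(_ < _) _ in IH2 *.
have h1 : S * c n <= n * B * c n by rewrite leq_mul2r IH1 orbT.
have h2 : c n * c n <= B * c n by rewrite leq_mul2r cnB orbT.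
by rewrite -!mulnn in IH2 *; lia.
Qed.

End Moment.

Section Nilpotent.
Local Open Scope nat_scope.
Variables (K : fieldType) (V : vectType K) (T e : 'End(V)).
Hypotheses (ee : forall v, e (e v) = e v) (eT : forall v, e (T v) = T (e v)).
Variable h : nat.
Let r := (2 * h).+1.
Hypothesis eTr : forall v, e (lpow T r v) = 0%R.

Let U1 := limg e.
Let U2 := lker e.
Let c1 := kernel_step U1 T.
Let c2 := kernel_step U2 T.

Let TU2 : (T @: U2 <= U2)%VS.
Proof.
apply/subvP => _ /memv_imgP[u uk ->].
by move: uk; rewrite !memv_ker eT => /eqP ->; rewrite linear0.
Qed.

Let eTt t v : e (lpow T t v) = lpow T t (e v).
Proof. by rewrite !lpowE; elim: t => //= t <-; rewrite eT. Qed.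

Let k1 t : r <= t -> nullity_in U1 T t = \dim U1.
Proof.
move=> rt; congr dimv; apply/capv_idPl/subvP => _ /memv_imgP[u _ ->].
by rewrite memv_ker -(subnK rt) lpowD -eTt eTr linear0.
Qed.

Let nulE t : nullity (lpow T t) = nullity_in U1 T t + nullity_in U2 T t.
Proof. exact: nullity_split. Qed.

(** The summand [limg e] contributes its dimension to each of the three terms, and the
    other summand obeys the weak inequality. *)
Lemma even_gap :
  nullity (lpow T (3 * h).+1) + nullity (lpow T (3 * h).+2) + \dim (limg e)
    <= 3 * nullity (lpow T (2 * h).+1).
Proof.
rewrite !nulE !k1 /r; try lia; rewrite !(nullity_inE U2).
have := @concave_thirds_even c2 (fun s => kernel_step_noninc s TU2) h.
rewrite /c2 -/U1; lia.
Qed.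

(** As in the even case, but the contribution of [limg e] is now a first moment of its
    kernel steps, which [sqr_sum_le_moment] bounds below since each step is at most
    [nullity T]. *)
Lemma odd_gap (q := (6 * h).+3) :
  nullity T * trapezoid (fun t => nullity (lpow T t)) q + (\dim (limg e)) ^ 2
    <= nullity T * (q * (nullity (lpow T (2 * h).+1) + nullity (lpow T (4 * h).+2))).
Proof.
have trE : trapezoid (fun t => nullity (lpow T t)) q =
    trapezoid (fun t => \sum_(s < t) c1 s) q +
    trapezoid (fun t => \sum_(s < t) c2 s) q.
  by rewrite -big_split /=; apply: eq_bigr => i _; rewrite !nulE !nullity_inE addnACA.
rewrite trE !nulE !k1 /r; try lia; rewrite !(nullity_inE U2) -/c2 -/U1.
have h2 := @concave_thirds_odd c2 (fun s => kernel_step_noninc s TU2) h.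
have h1 := trapezoidE c1 q; rewrite -(nullity_inE U1) k1 in h1; last by rewrite /r /q; lia.
have := @sqr_sum_le_moment c1 (nullity T) q.
rewrite -(nullity_inE U1) k1; last by rewrite /r /q; lia.
have cB s : c1 s <= nullity T by rewrite dimvS ?capvSr.
move=> /(_ cB); rewrite -/q in h2; move: h1 h2.
set t1 := trapezoid _ _; set t2 := trapezoid _ _; set mm := \sum_(_ < _) _.
set s1 := \sum_(_ < _) _; set s2 := \sum_(_ < _) _; set D := \dim U1; set B := nullity T.
move=> h1 h2 h4.
apply: (@leq_trans (B * (t1 + mm) + B * t2)); first by lia.
rewrite -mulnDr leq_mul2l h1; apply/orP; right.
lia.
Qed.
End Nilpotent.

(** * Adjoining truncated variables to a module with an operator *)

Section Linfun.
Variables (K : fieldType) (U V : vectType K).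
Lemma linfunP (f : U -> V) : linear f -> forall v, linfun f v = f v.
Proof.
move=> f_lin v; pose fL := GRing.isLinear.Build K U V _ f f_lin.
pose f' : {linear U -> V} := HB.pack f fL.
exact: (lfunE f').
Qed.
End Linfun.

Section OneVariable.
Variables (K : fieldType) (q : nat).

(** [layer N] is [N[z]/(z^q)], an element being the family of its coefficients. *)
Definition layer (N : vectType K) : vectType K := {ffun 'I_q -> N}.

Variable N : vectType K.
Implicit Types (v : layer N).

Definition coef (m : nat) v : N := if insub m is Some i then v i else 0.

Lemma coef_ord (i : 'I_q) v : coef i v = v i.
Proof. by rewrite /coef valK. Qed.

Lemma coef_out m v : (q <= m)%N -> coef m v = 0.
Proof. by rewrite leqNgt => mq; rewrite /coef insubN. Qed.

Lemma coefP u v : (forall m, (m < q)%N -> coef m u = coef m v) -> u = v.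
Proof. by move=> uv; apply/ffunP => i; rewrite -!coef_ord uv. Qed.

Lemma coef_lin m : linear (coef m).
Proof.
rewrite /coef => a u v; case: insubP => [i _ _|_]; first by rewrite !ffunE.
by rewrite scaler0 addr0.
Qed.

Lemma coef0 m : coef m 0 = 0.
Proof. by rewrite /coef; case: insubP => // i _ _; rewrite ffunE. Qed.

Lemma coefD m u v : coef m (u + v) = coef m u + coef m v.
Proof. by rewrite -[u]scale1r coef_lin !scale1r. Qed.

Definition of_coef (g : nat -> N) : layer N := [ffun i : 'I_q => g i].

Lemma coef_of_coef (g : nat -> N) m :
  coef m (of_coef g) = if (m < q)%N then g m else 0.
Proof.
by rewrite /coef /of_coef; case: insubP => [i mq im|/negPf ->] //; rewrite mq ffunE im.
Qed.

Definition coefl m : 'Hom(layer N, N) := linfun (coef m).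

Lemma coeflE m v : coefl m v = coef m v.
Proof. exact/linfunP/coef_lin. Qed.

Lemma coefl_coordinates : coordinates (fun i : 'I_q => coefl i).
Proof.
split=> [v v0|g]; first by apply/ffunP => i; rewrite -coef_ord -coeflE v0 ffunE.
by exists g => i; rewrite coeflE coef_ord.
Qed.

Lemma ex_layer (W : vectType K) (G : nat -> 'Hom(W, N)) :
  exists g : 'Hom(W, layer N),
    forall m w, coef m (g w) = if (m < q)%N then G m w else 0.
Proof.
have [g gP] := coordinates_lift coefl_coordinates (fun i : 'I_q => G i).
exists g => m w; case: ifP => mq; last by rewrite coef_out // leqNgt mq.
by have := gP (Ordinal mq) w; rewrite coeflE.
Qed.

Definition lift_op (T : 'End(N)) : 'End(layer N) :=
  linfun (fun v => of_coef (fun i => T (coef i v))).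

Lemma lift_opE T m v : coef m (lift_op T v) = T (coef m v).
Proof.
rewrite linfunP => [|a u w].
  by rewrite coef_of_coef; case: ltnP => // /coef_out ->; rewrite linear0.
by apply/ffunP => i; rewrite !ffunE coef_lin linearP.
Qed.

Definition shift_op : 'End(layer N) :=
  linfun (fun v => of_coef (fun i => if i is i'.+1 then coef i' v else 0)).

Lemma shift_opE m v :
  coef m (shift_op v) = if (0 < m < q)%N then coef m.-1 v else 0.
Proof.
rewrite linfunP => [|a u w]; last first.
  apply/ffunP => i; rewrite !ffunE; case: (i : nat) => [|n].
    by rewrite scaler0 addr0.
  exact: coef_lin.
by rewrite coef_of_coef; case: m => [|m]; rewrite //= if_same.
Qed.

Lemma shift_powE s m v :
  coef m (lpow shift_op s v) = if (s <= m < q)%N then coef (m - s) v else 0.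
Proof.
rewrite lpowE; elim: s m => [|s IH] m /=.
  by rewrite subn0; case: ltnP => // /coef_out ->.
rewrite shift_opE IH; case: m => [|m] //=; rewrite subSS ltnS.
by case: (ltnP m.+1 q) => mq; rewrite ?andbF // (ltnW mq) andbT.
Qed.

Lemma lift_shift_comm T v : lift_op T (shift_op v) = shift_op (lift_op T v).
Proof.
apply: coefP => m mq; rewrite lift_opE !shift_opE lift_opE.
by case: ifP; rewrite ?linear0.
Qed.

Lemma lift_powE T t m v : coef m (lpow (lift_op T) t v) = lpow T t (coef m v).
Proof. by rewrite !lpowE; elim: t => //= t <-; rewrite lift_opE. Qed.

(** For [T + z^s] on [N[z]/(z^q)], the exponents of [z] form one chain for each class
    modulo [s], ending in one of the [s] largest exponents. *)
Lemma nullity_add_power (T : 'End(N)) (T' : 'End(layer N)) s : (0 < s <= q)%N ->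
  (forall m v, (m < q)%N ->
    coef m (T' v) = T (coef m v) + (if (s <= m)%N then coef (m - s) v else 0)) ->
  nullity T' = (\sum_(j < s) nullity (lpow T ((q - s + j) %/ s).+1))%N.
Proof.
move=> /andP[s0 sq] T'E.
pose pr (i : 'I_q) := if (s <= i)%N then insub (i - s)%N else None : option 'I_q.
have prE (i j : 'I_q) : (pr i == Some j) = (i == j + s :> nat)%N.
  rewrite /pr; case: leqP => si.
    case: insubP => [k _ kE|]; last by have := ltn_ord i; lia.
    by rewrite -[_ == Some j]/(k == j) -val_eqE /= kE; apply/eqP/eqP; lia.
  by apply/esym/negbTE; rewrite /=; lia.
rewrite (@nullity_shift _ _ _ _ _ coefl_coordinates pr (fun i => (i %/ s).+1) _ _ T' T).
- rewrite (eq_bigl (fun i : 'I_q => q - s <= i)%N) => [|i]; last first.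
    apply/forallP/idP => [h|h j]; last by rewrite prE; have := ltn_ord j; lia.
    rewrite leqNgt; apply/negP => iqs.
    have isq : (i + s < q)%N by lia.
    by have := h (Ordinal isq); rewrite prE eqxx.
  rewrite -(big_mkord (fun i => q - s <= i)%N (fun i => nullity (lpow T (i %/ s).+1))).
  rewrite (@big_cat_nat _ _ _ (q - s)) ?leq_subr //=.
  rewrite [X in (X + _)%N]big_nat_cond big1 ?add0n => [|i]; last by lia.
  rewrite -{1}[(q - s)%N]add0n big_addn.
  rewrite (_ : (q - (q - s))%N = s); last by lia.
  rewrite big_mkord; apply: eq_big => i; first by lia.
  by rewrite addnC.
- move=> i j k /eqP; rewrite prE => /eqP ik /eqP; rewrite prE => /eqP jk.
  by apply: val_inj; rewrite /= ik jk.
- move=> i; rewrite /pr; case: leqP => si; last by rewrite divn_small.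
  case: insubP => [k _ kE|]; last by have := ltn_ord i; lia.
  by rewrite kE -{1}(subnK si) divnDr // divnn s0 addn1.
move=> i v; rewrite !coeflE T'E // /pr; congr (_ + _); case: leqP => si //.
by rewrite /coef; case: insubP => // k _ _; rewrite coeflE coef_ord.
Qed.
End OneVariable.

Section TwoVariables.
Variables (K : fieldType) (q : nat) (N : vectType K).
Let L := layer q (layer q N).

Definition coef2l (ij : 'I_q * 'I_q) : 'Hom(L, N) :=
  (coefl q N ij.2 \o coefl q _ ij.1)%VF.

Lemma coef2lE ij v : coef2l ij v = coef ij.2 (coef ij.1 v).
Proof. by rewrite comp_lfunE !coeflE. Qed.

Lemma coef2l_coordinates : coordinates coef2l.
Proof.
split=> [v v0|g].
  apply: coefP => i iq; apply: coefP => j jq.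
  have := v0 (Ordinal iq, Ordinal jq); rewrite coef2lE /= => ->.
  by rewrite !coef0.
exists [ffun i => [ffun j => g (i, j)] : layer q N] => -[i j].
by rewrite coef2lE /= !coef_ord !ffunE.
Qed.

(** For [T + x y] on [N[x, y]/(x^q, y^q)], the chains are the diagonals of the square
    of exponents: one of length [q] and two of each smaller length. *)
Lemma nullity_add_product (T : 'End(N)) (T' : 'End(L)) :
  (forall i j v, (i < q)%N -> (j < q)%N ->
    coef j (coef i (T' v)) = T (coef j (coef i v)) +
      (if (0 < i)%N && (0 < j)%N then coef j.-1 (coef i.-1 v) else 0)) ->
  nullity T' = trapezoid (fun t => nullity (lpow T t)) q.
Proof.
move=> T'E; case: (posnP q) => [q0|q_gt0].
  rewrite /trapezoid q0 big_ord0; apply/eqP; rewrite dimv_eq0 -subv0.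
  by apply/subvP => v _; rewrite memv0; apply/eqP/coefP => m mq; exfalso; lia.
pose pr (ij : 'I_q * 'I_q) : option ('I_q * 'I_q) :=
  if (0 < ij.1)%N && (0 < ij.2)%N then
    if (insub ij.1.-1, insub ij.2.-1) is (Some i, Some j) then Some (i, j)
    else None
  else None.
have prE a b : (pr a == Some b) = (a.1 == b.1.+1 :> nat)%N && (a.2 == b.2.+1 :> nat)%N.
  rewrite /pr; case: a => a1 a2; case: b => b1 b2 /=.
  case: ifP => [/andP[a10 a20]|h]; last by apply/esym/negbTE; lia.
  case: insubP => [i _ iE|]; last by have := ltn_ord a1; lia.
  case: insubP => [j _ jE|]; last by have := ltn_ord a2; lia.
  rewrite -[_ == Some _]/((i, j) == (b1, b2)) xpair_eqE -!val_eqE /= iE jE; lia.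
rewrite (@nullity_shift _ _ _ _ _ coef2l_coordinates pr (fun a => (minn a.1 a.2).+1) _ _ T' T).
- rewrite (eq_bigl (fun a : 'I_q * 'I_q => (q.-1 == a.1) || (q.-1 == a.2))); last first.
    move=> [a1 a2] /=; have := ltn_ord a1; have := ltn_ord a2 => h2 h1.
    apply/forallP/idP => [h|h [b1 b2]]; last first.
      by rewrite prE /=; have := ltn_ord b1; have := ltn_ord b2; lia.
    apply/negPn/negP => na.
    have i1 : (a1.+1 < q)%N by lia.
    have i2 : (a2.+1 < q)%N by lia.
    by have := h (Ordinal i1, Ordinal i2); rewrite prE !eqxx.
  rewrite -(pair_big_dep xpredT (fun i j : 'I_q => (q.-1 == i) || (q.-1 == j))
     (fun i j => nullity (lpow T (minn i j).+1))) /=.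
  set f := fun t => nullity (lpow T t).
  have f0 : f 0%N = 0%N.
    apply/eqP; rewrite dimv_eq0 -subv0; apply/subvP => v.
    by rewrite memv_ker lpowE /= memv0.
  case: (q) q_gt0 => // q' _ /=; rewrite big_ord_recr /= /trapezoid big_split /=.
  congr (_ + _)%N.
    rewrite big_ord_recl f0 add0n; apply: eq_bigr => i _.
    rewrite (bigD1 ord_max) ?eqxx ?orbT //= (minn_idPl (ltnW (ltn_ord i))).
    rewrite big1 ?addn0 // => j /andP[/orP[] /eqP h /eqP[]].
      by have := ltn_ord i; lia.
    by apply: val_inj; apply/esym.
  apply: eq_big => [j|j _]; first by rewrite eqxx.
  by rewrite (minn_idPr _) // -ltnS.
- move=> i j k /eqP; rewrite prE => /andP[/eqP h1 /eqP h2] /eqP.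
  rewrite prE => /andP[/eqP h3 /eqP h4].
  rewrite (surjective_pairing i) (surjective_pairing j).
  by congr (_, _); apply: val_inj; rewrite /= ?h1 ?h2 ?h3 ?h4.
- move=> [i1 i2]; have h1 := ltn_ord i1; have h2 := ltn_ord i2; case E: (pr _) => [j|].
    by move/eqP: E; rewrite prE => /andP[/eqP-> /eqP->]; rewrite minnSS.
  move: E; rewrite /pr; rewrite /=; case: ifP => [/andP[h3 h4]|h _]; last by lia.
  case: insubP => [k _ _|]; last by rewrite /=; lia.
  by case: insubP => [k' _ _|]; last by rewrite /=; lia.
move=> [i1 i2] v; have h1 := ltn_ord i1; have h2 := ltn_ord i2.
rewrite !coef2lE T'E //; congr (_ + _); case E: (pr _) => [j|].
  by move/eqP: E; rewrite prE coef2lE => /andP[/eqP-> /eqP->].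
move: E; rewrite /pr; rewrite /=; case: ifP => // /andP[h3 h4].
case: insubP => [k _ _|]; last by rewrite /=; lia.
by case: insubP => [k' _ _|]; last by rewrite /=; lia.
Qed.
End TwoVariables.

(** * Truncated polynomial algebras *)

Section BoxAlgebra.
Variables (K : fieldType) (q : nat).

(** [box n] is the algebra [K[x_0, ..., x_(n-1)] / (x_i^q)]. The recursion on [n] exposes
    the last variable. *)
Fixpoint box n : vectType K := if n is n'.+1 then layer q (box n') else K^o.

Fixpoint var_op n (k : nat) : 'End(box n) :=
  if n is n'.+1 return 'End(box n) then
    if k == n' then shift_op q (box n') else lift_op q (var_op n' k)
  else 0.

Definition word_op n (w : seq nat) : 'End(box n) :=
  foldr (fun k A => (var_op n k \o A)%VF) \1%VF w.

(** A word stands for the product of its letters, and a list of words for the sum of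
    these monomials; all the equations considered here have coefficients one. *)
Definition poly_op n (s : seq (seq nat)) : 'End(box n) :=
  \sum_(w <- s) word_op n w.

Definition words_below n (s : seq (seq nat)) := all (all (fun k => k < n)%N) s.

(** This is [coef], with types that do not mention [layer], so that rewriting does not
    have to see through the recursion that defines [box]. *)
Definition bcoef n (m : nat) (v : box n.+1) : box n := @coef K q (box n) m v.

Lemma bcoefP n (u v : box n.+1) :
  (forall m, (m < q)%N -> bcoef m u = bcoef m v) -> u = v.
Proof. exact: coefP. Qed.

Lemma bcoef_out n m (v : box n.+1) : (q <= m)%N -> bcoef m v = 0.
Proof. exact: coef_out. Qed.

Lemma bcoef0 n m : bcoef m (0 : box n.+1) = 0.
Proof. exact: coef0. Qed.

Lemma bcoefD n m (u v : box n.+1) : bcoef m (u + v) = bcoef m u + bcoef m v.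
Proof. exact: coefD. Qed.

Lemma bcoef_lin n m : linear (@bcoef n m).
Proof. exact: coef_lin. Qed.

Lemma bcoef_top n t m (v : box n.+1) :
  bcoef m (lpow (var_op n.+1 n) t v) =
    if (t <= m < q)%N then bcoef (m - t) v else 0.
Proof. by rewrite /var_op eqxx; apply: shift_powE. Qed.

Lemma bcoef_var_op_top n m (v : box n.+1) :
  bcoef m (var_op n.+1 n v) = if (0 < m < q)%N then bcoef m.-1 v else 0.
Proof. by rewrite /var_op eqxx; apply: shift_opE. Qed.

Lemma bcoef_var_op_lift n k m (v : box n.+1) : (k < n)%N ->
  bcoef m (var_op n.+1 k v) = var_op n k (bcoef m v).
Proof. by move=> kn; rewrite /bcoef /= ltn_eqF //; apply: lift_opE. Qed.

Lemma var_op_comm n k l v : var_op n k (var_op n l v) = var_op n l (var_op n k v).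
Proof.
elim: n v => [|n IH] v; first by rewrite /= !lfunE.
rewrite /=; case: (k =P n) => _; case: (l =P n) => _ //.
- by rewrite lift_shift_comm.
- by rewrite lift_shift_comm.
by apply: coefP => m _; rewrite !lift_opE IH.
Qed.

Lemma bcoef_word_op n w m (v : box n.+1) : all (fun k => k < n)%N w ->
  bcoef m (word_op n.+1 w v) = word_op n w (bcoef m v).
Proof.
elim: w => [|k w IH]; first by rewrite /word_op /= !id_lfunE.
move=> /= /andP[kn wn]; rewrite comp_lfunE [in RHS]comp_lfunE.
by rewrite (bcoef_var_op_lift m _ kn) IH.
Qed.

Lemma bcoef_poly_op n s m (v : box n.+1) : words_below n s ->
  bcoef m (poly_op n.+1 s v) = poly_op n s (bcoef m v).
Proof.
elim: s => [|w s IH]; first by rewrite /poly_op !big_nil !zero_lfunE bcoef0.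
move=> /= /andP[wn sn]; rewrite /poly_op !big_cons !add_lfunE bcoefD.
by rewrite bcoef_word_op // -!/(poly_op _ _) IH.
Qed.

Lemma poly_op_cat n s1 s2 v : poly_op n (s1 ++ s2) v = poly_op n s1 v + poly_op n s2 v.
Proof. by rewrite /poly_op big_cat add_lfunE. Qed.

Lemma poly_op1 n w : poly_op n [:: w] = word_op n w.
Proof. by rewrite /poly_op big_seq1. Qed.

Lemma word_op_nseq n k t : word_op n (nseq t k) = lpow (var_op n k) t.
Proof. by elim: t => //= t ->. Qed.

Lemma dim_box n : dim (box n) = (q ^ n)%N.
Proof.
elim: n => [|n IH] /=; first by rewrite expn0 /dim.
rewrite -dimvf (@coordinates_dim _ _ _ _ _ (coefl_coordinates q (box n)) _
  (fun=> fullv)) => [|v]; last by rewrite memvf; apply/esym/forallP => i; exact: memvf.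
by rewrite sum_nat_const card_ord dimvf IH expnS.
Qed.

Lemma bcoef_add_power n s t m (v : box n.+1) : words_below n s -> (m < q)%N ->
  bcoef m (poly_op n.+1 (s ++ [:: nseq t n]) v) =
    poly_op n s (bcoef m v) + (if (t <= m)%N then bcoef (m - t) v else 0).
Proof.
move=> sn mq; rewrite poly_op_cat poly_op1 word_op_nseq bcoefD bcoef_poly_op //.
by rewrite bcoef_top mq andbT.
Qed.

Section NewVariables.
Variables (n : nat) (s : seq (seq nat)) (sn : words_below n s).
Let T := poly_op n s.
Let k t := nullity (lpow T t).

Lemma nullity_poly_op_add_power t : (0 < t <= q)%N ->
  nullity (poly_op n.+1 (s ++ [:: nseq t n])) =
    (\sum_(j < t) k ((q - t + j) %/ t).+1)%N.
Proof. by move=> tq; apply: nullity_add_power => // m v; apply: bcoef_add_power. Qed.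

Lemma bcoef2_add_product i j (v : box n.+2) : (i < q)%N -> (j < q)%N ->
  bcoef j (bcoef i (poly_op n.+2 (s ++ [:: [:: n; n.+1]]) v)) =
    T (bcoef j (bcoef i v)) +
    (if (0 < i)%N && (0 < j)%N then bcoef j.-1 (bcoef i.-1 v) else 0).
Proof.
move=> iq jq; have sn1 : words_below n.+1 s.
  by apply: sub_all sn => w; apply: sub_all => l /ltnW.
rewrite poly_op_cat poly_op1 !bcoefD !bcoef_poly_op //; congr (_ + _).
rewrite /word_op /= comp_lfunE comp_lfunE id_lfunE.
rewrite -/(var_op n.+2 n) -/(var_op n.+2 n.+1) bcoef_var_op_lift //.
rewrite bcoef_var_op_top jq bcoef_var_op_top iq !andbT.
by case: (0 < i)%N; case: (0 < j)%N => //=; rewrite bcoef0.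
Qed.

Lemma nullity_poly_op_add_product :
  nullity (poly_op n.+2 (s ++ [:: [:: n; n.+1]])) = trapezoid k q.
Proof. by apply: nullity_add_product => i j v; apply: bcoef2_add_product. Qed.

Lemma nullity_poly_op_add_square h : q = (6 * h).+3 ->
  nullity (poly_op n.+1 (s ++ [:: [:: n; n]])) = (k (3 * h).+1 + k (3 * h).+2)%N.
Proof.
move=> qE; rewrite (@nullity_poly_op_add_power 2) ?qE // big_ord_recl big_ord1 /=.
by congr (k _ + k _)%N; rewrite /= /bump /=; lia.
Qed.

Lemma nullity_poly_op_add_cube r : (0 < r)%N -> q = (3 * r)%N ->
  nullity (poly_op n.+1 (s ++ [:: [:: n; n; n]])) = (3 * k r)%N.
Proof.
move=> r0 qE; rewrite (@nullity_poly_op_add_power 3) ?qE; last by lia.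
rewrite (eq_bigr (fun=> k r)) => [|j _]; first by rewrite sum_nat_const card_ord.
by congr (k _); have := ltn_ord j; lia.
Qed.

(** The cube gives three times the nullity of [(T + z^2)^r], which in characteristic 3
    is [T^r + z^(2r)], where the powers [z^(2r)] only link exponents in the first and
    the last third. *)
Lemma nullity_poly_op_add_square_cube e (r := (3 ^ e)%N) : 3%:R = 0 :> K ->
  q = (3 * r)%N ->
  nullity (poly_op n.+2 (s ++ [:: [:: n; n]; [:: n.+1; n.+1; n.+1]])) =
    (q * (k r + k (2 * r)))%N.
Proof.
move=> K3 qE; have r0 : (0 < r)%N by rewrite expn_gt0.
have -> : s ++ [:: [:: n; n]; [:: n.+1; n.+1; n.+1]] =
    (s ++ [:: [:: n; n]]) ++ [:: nseq 3 n.+1] by rewrite -catA.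
have sn' : words_below n.+1 (s ++ [:: [:: n; n]]).
  rewrite /words_below all_cat /= !ltnSn !andbT.
  by apply: sub_all sn => w; apply: sub_all => l /ltnW.
pose T2 := poly_op n.+1 (s ++ [:: [:: n; n]]).
have -> : nullity (poly_op n.+2 ((s ++ [:: [:: n; n]]) ++ [:: nseq 3 n.+1])) =
    (3 * nullity (lpow T2 r))%N.
  rewrite (@nullity_add_power _ _ _ T2 _ 3); first last.
  - by move=> m v mq; apply: (@bcoef_add_power n.+1 _ 3).
  - by rewrite qE; lia.
  rewrite (eq_bigr (fun=> nullity (lpow T2 r))) => [|j _].
    by rewrite sum_nat_const card_ord.
  by congr (nullity (lpow _ _)); have := ltn_ord j; lia.
have T2E : T2 = lift_op q T + lpow (shift_op q (box n)) 2.
  apply/lfunP => u; apply: bcoefP => l lq.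
  rewrite (@bcoef_add_power n s 2) // add_lfunE bcoefD; congr (_ + _).
    by apply/esym; apply: lift_opE.
  by have /esym := @shift_powE K q (box n) 2 l u; rewrite lq andbT.
rewrite (@nullity_add_power _ _ _ (lpow T r) (lpow T2 r) (2 * r)); first last.
- move=> m v mq; rewrite T2E lpow_frobenius // => [|u]; last first.
    by rewrite !lpowE /= -!lift_shift_comm.
  by rewrite lpowM coefD lift_powE shift_powE mq andbT.
- by rewrite qE; lia.
rewrite qE -mulnA; congr (3 * _)%N.
rewrite (_ : 3 * r - 2 * r = r)%N; last by lia.
rewrite mul2n -addnn big_split_ord mulnDr; congr (_ + _)%N.
  rewrite (eq_bigr (fun=> k r)) => [|j _]; first by rewrite sum_nat_const card_ord.
  by rewrite divn_small ?lpow1 //; have := ltn_ord j; rewrite /=; lia.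
rewrite (eq_bigr (fun=> k (2 * r)%N)) => [|j _]; first by rewrite sum_nat_const card_ord addnn mul2n.
rewrite (_ : (r + rshift r j) %/ (r + r) = 1)%N; last first.
  by rewrite /= addnA divnDl ?dvdnn // divnn addn_gt0 r0 /= divn_small // ltn_addl.
by rewrite lpowM muln2 mul2n.
Qed.
End NewVariables.
End BoxAlgebra.

(** * The hyperbolic form *)

Lemma lpow_comp (K : fieldType) (V : vectType K) (A B : 'End(V)) t v :
  (forall u, A (B u) = B (A u)) -> lpow (A \o B)%VF t v = lpow A t (lpow B t v).
Proof.
move=> AB; have BAt n u : lpow B n (A u) = A (lpow B n u).
  by rewrite !lpowE; elim: n => //= n ->.
elim: t v => [|t IH] v; first by rewrite /lpow /= !id_lfunE.
by rewrite lpowSr IH comp_lfunE BAt -!lpowSr.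
Qed.

Section Commutation.
Variables (K : fieldType) (q n : nat).

Lemma poly_op_cons w s (v : box K q n) :
  poly_op K q n (w :: s) v = word_op K q n w v + poly_op K q n s v.
Proof. by rewrite /poly_op big_cons add_lfunE. Qed.

Lemma word_op_comm w1 w2 (v : box K q n) :
  word_op K q n w1 (word_op K q n w2 v) = word_op K q n w2 (word_op K q n w1 v).
Proof.
have C k u : var_op K q n k (word_op K q n w2 u) = word_op K q n w2 (var_op K q n k u).
  elim: w2 u => [|l w2 IH] u; first by rewrite /word_op /= !id_lfunE.
  by rewrite /word_op /= !comp_lfunE -!/(word_op _ _ _ _) var_op_comm IH.
elim: w1 v => [|l w1 IH] v; first by rewrite /word_op /= !id_lfunE.
by rewrite /word_op /= !comp_lfunE -!/(word_op _ _ _ _) IH C.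
Qed.

Lemma poly_op_comm s1 s2 (v : box K q n) :
  poly_op K q n s1 (poly_op K q n s2 v) = poly_op K q n s2 (poly_op K q n s1 v).
Proof.
have C w u : word_op K q n w (poly_op K q n s2 u) = poly_op K q n s2 (word_op K q n w u).
  elim: s2 => [|w2 s2 IH]; first by rewrite /poly_op !big_nil !zero_lfunE linear0.
  by rewrite !poly_op_cons linearD /= word_op_comm IH.
elim: s1 => [|w s1 IH]; first by rewrite /poly_op !big_nil !zero_lfunE linear0.
by rewrite !poly_op_cons linearD /= C IH.
Qed.
End Commutation.

Definition hyperbolic a : seq (seq nat) :=
  [seq [:: i.*2; i.*2.+1] | i <- iota 0 a].

Lemma hyperbolicS a : hyperbolic a.+1 = hyperbolic a ++ [:: [:: a.*2; a.*2.+1]].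
Proof. by rewrite /hyperbolic -addn1 iotaD map_cat. Qed.

Lemma hyperbolic_vars a : words_below a.*2 (hyperbolic a).
Proof.
rewrite /words_below all_map; apply/allP => i; rewrite mem_iota add0n => /= ia.
by rewrite andbT; lia.
Qed.

Section Projection.
Variables (K : fieldType) (q e h : nat).
Let r := (3 ^ e)%N.
Hypotheses (K3 : 3%:R = 0 :> K) (rE : r = (2 * h).+1) (qE : q = (3 * r)%N).

Notation hyp_op a := (poly_op K q a.*2 (hyperbolic a)).

Lemma bcoef_poly_op_pow n s t m (v : box K q n.+1) : words_below n s ->
  bcoef m (lpow (poly_op K q n.+1 s) t v) = lpow (poly_op K q n s) t (bcoef m v).
Proof. by move=> sn; rewrite !lpowE; elim: t => //= t <-; rewrite bcoef_poly_op. Qed.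

(** In characteristic 3 the [r]-th power of [T + x y] is [T^r + x^r y^r]. *)
Lemma bcoef2_add_product_pow n s i j (v : box K q n.+2) :
  words_below n s -> (i < q)%N -> (j < q)%N ->
  bcoef j (bcoef i (lpow (poly_op K q n.+2 (s ++ [:: [:: n; n.+1]])) r v)) =
    lpow (poly_op K q n s) r (bcoef j (bcoef i v)) +
    (if (r <= i)%N && (r <= j)%N then bcoef (j - r) (bcoef (i - r) v) else 0).
Proof.
move=> sn iq jq; have sn1 : words_below n.+1 s.
  by apply: sub_all sn => w; apply: sub_all => l /ltnW.
have -> : poly_op K q n.+2 (s ++ [:: [:: n; n.+1]]) =
    poly_op K q n.+2 s + poly_op K q n.+2 [:: [:: n; n.+1]].
  by apply/lfunP => u; rewrite poly_op_cat add_lfunE.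
rewrite lpow_frobenius //; last exact: poly_op_comm.
rewrite !bcoefD !(bcoef_poly_op_pow (s := s)) // -/r.
suff -> : bcoef j (bcoef i (lpow (poly_op K q n.+2 [:: [:: n; n.+1]]) r v)) =
  if (r <= i)%N && (r <= j)%N then bcoef (j - r) (bcoef (i - r) v) else 0 by [].
rewrite poly_op1 /word_op /= -/(var_op K q n.+2 n) -/(var_op K q n.+2 n.+1) comp_lfun1r.
rewrite lpow_comp => [|u]; last exact: (@var_op_comm K q n.+2).
have C m u : bcoef m (lpow (var_op K q n.+2 n) r u) =
    lpow (var_op K q n.+1 n) r (bcoef m u).
  by rewrite !lpowE; elim: (r) => //= t <-; rewrite bcoef_var_op_lift.
rewrite C bcoef_top jq bcoef_top iq !andbT.
by case: (r <= i)%N; case: (r <= j)%N => //=; rewrite bcoef0.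
Qed.

(** The span of the monomials in which, for each pair [x, y] of variables, the
    exponent of [y] exceeds that of [x] by [2 r] at least: it is stable under [x y],
    which keeps the difference, and killed by [(x y)^r]. *)
Lemma ex_short_projection a : exists E : 'End(box K q a.*2),
  [/\ forall v, E (E v) = E v, forall v, E (hyp_op a v) = hyp_op a (E v),
      forall v, E (lpow (hyp_op a) r v) = 0
    & (h.+1 ^ a.*2 <= \dim (limg E))%N].
Proof.
have r0 : (0 < r)%N by rewrite expn_gt0.
elim: a => [|a [E [EE ET ETr dE]]].
  exists \1%VF; split=> [v|v|v|]; rewrite ?id_lfunE //.
    by rewrite -(prednK r0) lpowSr /poly_op /hyperbolic big_nil zero_lfunE linear0.
  by rewrite lim1g dimvf dim_box.
have [F FP] : exists F : 'End(box K q a.+1.*2), forall ij v,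
    coef2l (box K q a.*2) ij (F v) =
    (if (ij.2 + 2 * r <= ij.1)%N then (E \o coef2l _ ij)%VF else 0) v.
  exact: (coordinates_lift (@coef2l_coordinates K q (box K q a.*2))).
have {}FP i j (v : box K q a.+1.*2) : (i < q)%N -> (j < q)%N ->
    bcoef j (bcoef i (F v)) =
    if (j + 2 * r <= i)%N then E (bcoef j (bcoef i v)) else 0.
  move=> iq jq; have := FP (Ordinal iq, Ordinal jq) v.
  rewrite coef2lE /= => FE; apply: (eq_trans FE).
  by case: ifP => _; rewrite ?zero_lfunE // comp_lfunE coef2lE.
have b2P (u v : box K q a.+1.*2) :
    (forall i j, (i < q)%N -> (j < q)%N -> bcoef j (bcoef i u) = bcoef j (bcoef i v)) -> u = v.
  by move=> uv; apply: bcoefP => i iq; apply: bcoefP => j jq; apply: uv.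
have T2 i j (v : box K q a.+1.*2) : (i < q)%N -> (j < q)%N ->
    bcoef j (bcoef i (hyp_op a.+1 v)) = hyp_op a (bcoef j (bcoef i v)) +
    (if (0 < i)%N && (0 < j)%N then bcoef j.-1 (bcoef i.-1 v) else 0).
  move=> iq jq; rewrite hyperbolicS.
  exact: (bcoef2_add_product (hyperbolic_vars a)).
exists F; split=> [v|v|v|].
- by apply: b2P => i j iq jq; rewrite !FP //; case: ifP => // far; rewrite far EE.
- apply: b2P => i j iq jq; rewrite FP // !T2 // (FP i j) //.
  case: (posnP i) => [->|i0] /=.
    by case: ifP => far; rewrite ?far !addr0 ?ET ?linear0.
  case: (posnP j) => [->|j0] /=.
    by case: ifP => far; rewrite ?far !addr0 ?ET ?linear0.
  rewrite FP; try lia; rewrite (_ : (j.-1 + _ <= i.-1)%N = (j + 2 * r <= i)%N); last by lia.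
  by case: ifP => far; rewrite ?far ?linear0 ?addr0 // linearD /= ET.
- apply: b2P => i j iq jq; rewrite FP // hyperbolicS bcoef2_add_product_pow ?hyperbolic_vars // !bcoef0.
  case: ifP => // ji; rewrite (_ : (r <= j)%N = false) ?andbF ?addr0 //; lia.
pose U (ij : 'I_q * 'I_q) := if (ij.2 + 2 * r <= ij.1)%N then limg E else 0%VS.
rewrite (@coordinates_dim _ _ _ _ _ (@coef2l_coordinates K q (box K q a.*2)) _ U);
  last first.
  move=> v; apply/memv_imgP/forallP => [[u _ ->] [i j]|vU].
    rewrite coef2lE -[X in X \in _]/(bcoef j (bcoef i (F u))) FP // /U /=.
    by case: ifP => _; rewrite ?mem0v ?memv_img ?memvf.
  exists v; first exact: memvf.
  apply: b2P => i j iq jq; rewrite FP //; have := vU (Ordinal iq, Ordinal jq).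
  rewrite coef2lE /U /=; case: ifP => _; last by rewrite memv0 => /eqP.
  by case/memv_imgP => u _ uE; rewrite /bcoef uE EE.
have hi (x : 'I_h.+1) : (2 * r + h + x < q)%N by have := ltn_ord x; lia.
have hj (y : 'I_h.+1) : (y < q)%N by have := ltn_ord y; lia.
pose f (xy : 'I_h.+1 * 'I_h.+1) := (Ordinal (hi xy.1), Ordinal (hj xy.2)).
have f_inj : injective f.
  move=> [x y] [x' y'] /(congr1 (fun z => (val z.1, val z.2))) /= [/addnI xx yy].
  by congr (_, _); apply: val_inj.
pose S := [pred ij : 'I_q * 'I_q | (ij.2 + 2 * r <= ij.1)%N].
rewrite (eq_bigr (fun ij => if S ij then \dim (limg E) else 0%N)) => [|ij _]; last first.
  by rewrite /U /=; case: ifP => // _; rewrite dimv0.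
rewrite -big_mkcond sum_nat_const (@leq_trans (h.+1 * h.+1 * \dim (limg E)))%N //.
  by rewrite doubleS !expnS mulnA leq_mul2l dE orbT.
rewrite leq_mul2r; apply/orP; right.
rewrite -[h.+1]card_ord -card_prod -(card_image f_inj).
apply/subset_leq_card/fintype.subsetP => _ /fintype.imageP[[x y] _ ->]; rewrite -topredE /= /S /=.
by have := ltn_ord y; lia.
Qed.
End Projection.

(** * Comparison of the two hypersurfaces, and the Frobenius *)

Definition R_words d : seq (seq nat) :=
  if odd d then hyperbolic d.+1./2 else hyperbolic d./2 ++ [:: [:: d; d]].

Definition S_words d : seq (seq nat) :=
  if odd d then hyperbolic d.-1./2 ++ [:: [:: d.-1; d.-1]; [:: d; d; d]]
  else hyperbolic d./2 ++ [:: [:: d; d; d]].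

Section Comparison.
Variables (K : fieldType) (K3 : 3%:R = 0 :> K).

Lemma sub_vars n m s : (n <= m)%N -> words_below n s -> words_below m s.
Proof.
by move=> nm; apply: sub_all => w; apply: sub_all => l ln; apply: leq_trans nm.
Qed.

Lemma Rwords_below d : words_below d.+1 (R_words d).
Proof.
rewrite /R_words; case: ifP => od.
  by apply: sub_vars (hyperbolic_vars _); rewrite even_halfK //= od.
rewrite /words_below all_cat /= !ltnSn !andbT.
by apply: sub_vars (hyperbolic_vars _); rewrite even_halfK ?od.
Qed.

Lemma Swords_below d : words_below d.+1 (S_words d).
Proof.
rewrite /S_words; case: ifP => od; rewrite /words_below all_cat /= !ltnSn !andbT.
  rewrite ltnS leq_pred !andbT; apply: sub_vars (hyperbolic_vars _).
  by case: d od => // d /= od; rewrite even_halfK //; exact: leq_trans (leqnSn _).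
by apply: sub_vars (hyperbolic_vars _); rewrite even_halfK ?od.
Qed.

(** The constant [36] comes from [q <= 6 (h + 1)], squared in the odd case, where the gap
    is the square of a dimension divided by a nullity. *)
Lemma nullity_gap d e (q := (3 ^ e.+1)%N) : (2 <= d)%N ->
  (q ^ d + 2 * 36 ^ d * nullity (poly_op K q d.+1 (R_words d))
     <= 2 * 36 ^ d * nullity (poly_op K q d.+1 (S_words d)))%N.
Proof.
move=> d2; pose r := (3 ^ e)%N; have qE : q = (3 * r)%N by rewrite /q expnS.
have ro : odd r by rewrite oddX orbT.
pose h := r./2; have rE : r = (2 * h).+1 by rewrite -[LHS]odd_double_half ro -mul2n.
have hq : (q <= 6 * h.+1)%N by lia.
case od: (odd d).
  pose a := d./2; have dE : d = a.*2.+1 by rewrite -[LHS]odd_double_half od.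
  have a0 : (0 < a)%N by lia.
  rewrite /R_words /S_words od.
  have [E [EE ET ETr dE1]] := ex_short_projection K3 rE qE a.
  have q6 : q = (6 * h).+3 by lia.
  have -> : d.+1./2 = a.+1 by rewrite dE /= doubleK.
  have -> : d.-1./2 = a by rewrite dE /= doubleK.
  have -> : d.-1 = a.*2 by rewrite dE.
  rewrite dE hyperbolicS (nullity_poly_op_add_product K q (hyperbolic_vars a)).
  rewrite (nullity_poly_op_add_square_cube (hyperbolic_vars a) K3 (e := e)) -/r //.
  have := odd_gap EE ET (h := h); rewrite -rE => /(_ ETr).
  rewrite -q6 (_ : (4 * h).+2 = 2 * r)%N; last by rewrite rE; lia.
  set T := poly_op _ _ _ _; set B := nullity T; set t := trapezoid _ _; set S := (_ * (_ + _))%N.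
  move=> gap.
  have BE : (B <= 2 * q ^ a.*2.-1)%N.
    rewrite /B /T; case: (a) a0 => // b _; rewrite hyperbolicS.
    rewrite (nullity_poly_op_add_product K q (hyperbolic_vars b)) /trapezoid.
    apply: (@leq_trans (\sum_(i < q) 2 * q ^ b.*2)).
      by apply: leq_sum => i _; rewrite mulSn mul1n -(dim_box K) leq_add ?nullity_le_dim.
    rewrite sum_nat_const card_ord doubleS /= expnS; lia.
  have h1 : (q ^ a.*2 <= 6 ^ a.*2 * \dim (limg E))%N.
    by apply: leq_trans (_ : (6 * h.+1) ^ a.*2 <= _)%N; rewrite ?leq_exp2r ?expnMn ?leq_mul2l ?dE1 ?orbT //; lia.
  (* [B] does not vanish, since the summand [limg E] is not trivial. *)
  have RS : (t <= S)%N.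
    case: (posnP B) => [B0|B0]; last by rewrite -(leq_pmul2l B0); lia.
    have : (\dim (limg E) ^ 2 <= 0)%N by move: gap; rewrite B0; lia.
    rewrite leqn0 expn_eq0 andbT => /eqP D0.
    by move: h1; rewrite D0 muln0 leqn0 expn_eq0 qE rE.
  have gap2 : (\dim (limg E) ^ 2 <= B * (S - t))%N by rewrite mulnBr; lia.
  have gap3 : (\dim (limg E) ^ 2 <= 2 * q ^ a.*2.-1 * (S - t))%N.
    by apply: leq_trans gap2 _; rewrite leq_mul2r BE orbT.
  have h2 : (q ^ a.*2 * q ^ a.*2 <= 36 ^ a.*2 * (2 * q ^ a.*2.-1 * (S - t)))%N.
    apply: (@leq_trans ((6 ^ a.*2 * \dim (limg E)) * (6 ^ a.*2 * \dim (limg E))))%N.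
      exact: leq_mul.
    rewrite mulnACA -expnMn leq_mul2l mulnn gap3 orbT //.
  have q0 : (0 < q ^ a.*2.-1)%N by rewrite expn_gt0 qE rE.
  have h3 : (q ^ a.*2.+1 <= 36 ^ a.*2 * (2 * (S - t)))%N.
    rewrite -(leq_pmul2l q0).
    rewrite [X in (_ <= X)%N](_ : _ = 36 ^ a.*2 * (2 * q ^ a.*2.-1 * (S - t)))%N; last by rewrite mulnCA; congr (_ * _)%N; rewrite mulnA [(_ * 2)%N]mulnC.
    apply: leq_trans h2; rewrite -!expnD leq_exp2l; first by case: (a) a0 => // b _; rewrite doubleS /=; lia.
    by rewrite qE rE; lia.
  have h4 : (36 ^ a.*2 <= 36 ^ a.*2.+1)%N by rewrite leq_exp2l.
  have h5 : (q ^ a.*2.+1 <= 36 ^ a.*2.+1 * (2 * (S - t)))%N.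
    by apply: leq_trans h3 _; rewrite leq_mul2r h4 orbT.
  by move: h5; rewrite -[in (2 * 36 ^ _ * S)%N](subnKC RS); lia.
pose a := d./2; have dE : d = a.*2 by rewrite -[LHS]odd_double_half od.
rewrite /R_words /S_words od -/a.
have [E [EE ET ETr dE1]] := ex_short_projection K3 rE qE a.
have q6 : q = (6 * h).+3 by lia.
rewrite dE (nullity_poly_op_add_square K (hyperbolic_vars a) q6).
rewrite (nullity_poly_op_add_cube K (hyperbolic_vars a) (r := r)) //; last by rewrite rE.
have := even_gap EE ET (h := h); rewrite -rE => /(_ ETr).
have h1 : (q ^ a.*2 <= 6 ^ a.*2 * \dim (limg E))%N.
  by apply: leq_trans (_ : (6 * h.+1) ^ a.*2 <= _)%N; rewrite ?leq_exp2r ?expnMn ?leq_mul2l ?dE1 ?orbT //; lia.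
have h2 : (6 ^ a.*2 <= 36 ^ a.*2)%N by rewrite leq_exp2r //; lia.
have h3 : (q ^ a.*2 <= 36 ^ a.*2 * \dim (limg E))%N.
  by apply: leq_trans h1 _; rewrite leq_mul2r h2 orbT.
set x := (36 ^ _)%N in h3 *; set D := \dim _ in h3 *.
set y := nullity _; set z := nullity _; set w := nullity _ => gap.
have : (x * (y + z + D) <= x * (3 * w))%N by rewrite leq_mul2l gap orbT.
lia.
Qed.

Lemma nullity_S_words_le d e : (0 < d)%N ->
  (nullity (poly_op K (3 ^ e.+1) d.+1 (S_words d)) <= 3 * (3 ^ e.+1) ^ d)%N.
Proof.
move=> d0; set q := (3 ^ e.+1)%N; pose r := (3 ^ e)%N.
have qE : q = (3 * r)%N by rewrite /q expnS.
have r0 : (0 < r)%N by rewrite expn_gt0.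
rewrite /S_words; case od: (odd d).
  case: d od d0 => // d /= od _; have : d = d./2.*2 by rewrite even_halfK.
  move: d./2 => a ->.
  rewrite (nullity_poly_op_add_square_cube (hyperbolic_vars a) K3 (e := e)) //.
  rewrite expnS [X in (_ <= X)%N]mulnCA leq_mul2l; apply/orP; right.
  apply: (@leq_trans (q ^ a.*2 + q ^ a.*2)); last by lia.
  by rewrite -(dim_box K q) leq_add ?nullity_le_dim.
have : d = d./2.*2 by rewrite even_halfK ?od.
move: d./2 => a ->.
rewrite (nullity_poly_op_add_cube K (hyperbolic_vars a) (r := r)) //.
by rewrite leq_mul2l -(dim_box K q) nullity_le_dim.
Qed.
End Comparison.

Section Frobenius.
Variables (K : fieldType) (K3 : 3%:R = 0 :> K) (q : nat).

(** [K[x]/(x^(3q))] is free over the cubes of the variables, which generate a copy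
    of [K[x]/(x^q)]. *)
Lemma ex_cube_coordinates n :
  exists (I : finType) (p : I -> 'Hom(box K (3 * q) n, box K q n)),
  [/\ coordinates p, #|I| = (3 ^ n)%N &
    forall i k v, (k < n)%N ->
      p i (lpow (var_op K (3 * q) n k) 3 v) = var_op K q n k (p i v)].
Proof.
elim: n => [|n [I [p [pC cardI pX]]]].
  exists unit, (fun=> \1%VF); split=> //; last by rewrite card_unit.
  split=> [v /(_ tt)|g]; first by rewrite id_lfunE.
  by exists (g tt) => -[]; rewrite id_lfunE.
have /boolp.choice[P PE] : forall ic : I * 'I_3,
    exists P : 'Hom(box K (3 * q) n.+1, box K q n.+1), forall m v, (m < q)%N ->
    bcoef m (P v) = p ic.1 (bcoef (3 * m + ic.2) v).
  move=> [i c]; have [P PE] := @ex_layer K q (box K q n) (box K (3 * q) n.+1)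
    (fun m => (p i \o coefl (3 * q) (box K (3 * q) n) (3 * m + c))%VF).
  exists P => m v mq; have := PE m v; rewrite mq comp_lfunE => PEm.
  apply: (eq_trans PEm); congr (p i _); exact: coeflE.
exists (I * 'I_3)%type, P; split.
- split=> [v v0|g].
    apply: bcoefP => m mq; rewrite bcoef0; apply: pC.1 => i.
    have m3 : (m %% 3 < 3)%N by rewrite ltn_mod.
    have mq3 : (m %/ 3 < q)%N by rewrite ltn_divLR // mulnC.
    have := PE (i, Ordinal m3) (m %/ 3)%N v mq3; rewrite v0 bcoef0 /=.
    rewrite (_ : 3 * (m %/ 3) + m %% 3 = m)%N; last by rewrite mulnC -divn_eq.
    by move=> <-.
  have /boolp.choice[u uE] : forall m, exists u, forall i,
      p i u = bcoef (m %/ 3)%N (g (i, Ordinal (ltn_pmod m (isT : 0 < 3)%N))).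
    by move=> m; have [u uE] := pC.2 [ffun i => bcoef (m %/ 3)%N (g (i, Ordinal (ltn_pmod m (isT : 0 < 3)%N)))];
       exists u => i; rewrite uE ffunE.
  exists (of_coef (3 * q) u) => -[i c]; apply: bcoefP => m mq; rewrite PE //=.
  rewrite /bcoef coef_of_coef; have := ltn_ord c => c3.
  rewrite ifT; last by lia.
  rewrite uE; congr (bcoef _ (g (i, _))); first by lia.
  by apply: val_inj => /=; lia.
- by rewrite card_prod cardI card_ord expnSr.
move=> [i c] k v kn; apply: bcoefP => m mq.
have {}PE l u : (l < q)%N -> bcoef l (P (i, c) u) = p i (bcoef (3 * l + c) u).
  by move=> lq; rewrite PE.
rewrite PE //; have := ltn_ord c => c3.
move: kn; rewrite ltnS leq_eqVlt => /predU1P[->|kn].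
  rewrite bcoef_top bcoef_var_op_top mq andbT.
  case: (posnP m) => [->|m0] /=; first by rewrite ifF ?linear0 //; lia.
  rewrite ifT; last by lia.
  rewrite PE; last by lia.
  by rewrite (_ : 3 * m + c - 3 = 3 * m.-1 + c)%N //; lia.
rewrite bcoef_var_op_lift // PE // -pX //; congr (p i _).
have C l t : bcoef l (lpow (var_op K (3 * q) n.+1 k) t v) =
    lpow (var_op K (3 * q) n k) t (bcoef l v).
  by rewrite !lpowE; elim: t => // t IH; rewrite !iterS bcoef_var_op_lift // IH.
exact: C.
Qed.

(** Combines the decrease of the kernel steps of an operator, applied to its cube, with
    the fact that the cube acts as [3^n] copies of the operator for [q]. *)
Lemma nullity_frobenius n s : words_below n s ->
  (3 ^ n * nullity (poly_op K q n s) <= 3 * nullity (poly_op K (3 * q) n s))%N.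
Proof.
move=> sn; have [I [p [pC cardI pX]]] := ex_cube_coordinates n.
have pM i w v : all (fun k => k < n)%N w ->
    p i (lpow (word_op K (3 * q) n w) 3 v) = word_op K q n w (p i v).
  elim: w v => [|k w IH] v; first by rewrite /word_op lpowE /= !id_lfunE.
  move=> /andP[kn wn].
  rewrite -[word_op K (3 * q) n (k :: w)]/(var_op K (3 * q) n k \o word_op K (3 * q) n w)%VF.
  rewrite -[word_op K q n (k :: w)]/(var_op K q n k \o word_op K q n w)%VF.
  rewrite lpow_comp => [|u]; last first.
    by have := word_op_comm [:: k] w u; rewrite /word_op /= !comp_lfun1r.
  by rewrite pX // IH // comp_lfunE.
have pP i v : p i (lpow (poly_op K (3 * q) n s) 3 v) = poly_op K q n s (p i v).
  elim: s v sn => [|w s IH] v; first by rewrite /poly_op !big_nil lpowE /= !zero_lfunE linear0.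
  move=> /andP[wn sn]; rewrite poly_op_cons -pM // -IH // -linearD /=.
  have -> : poly_op K (3 * q) n (w :: s) = word_op K (3 * q) n w + poly_op K (3 * q) n s.
    by apply/lfunP => u; rewrite poly_op_cons add_lfunE.
  rewrite (@lpow_frobenius _ _ _ _ 1) // => u.
  by have := poly_op_comm [:: w] s u; rewrite poly_op1.
rewrite -cardI -sum_nat_const -(nullity_diag pC pP) nullity_fullv nullity_inE.
have step t : (kernel_step fullv (poly_op K (3 * q) n s) t <= nullity (poly_op K (3 * q) n s))%N.
  by rewrite dimvS ?capvSr.
apply: (@leq_trans (\sum_(t < 3) nullity (poly_op K (3 * q) n s))).
  by apply: leq_sum => t _; apply: step.
by rewrite sum_nat_const card_ord.
Qed.
End Frobenius.

(** * Power series *)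

Section PowerSeriesBasics.
Variables (n : nat) (K : comNzRingType).
Local Notation P := (mfps n K).
Implicit Types (f g h : P) (m k : 'X_{1..n}) (p : {mpoly K[n]}).

Lemma mfps_mulE f g m : (f * g) m =
  \sum_(k : 'X_{1..n < (mdeg m).+1, (mdeg m).+1} | m == (k.1 + k.2)%MM)
    f k.1 * g k.2.
Proof. by []. Qed.

Lemma mfpsDE f g m : (f + g) m = f m + g m. Proof. by []. Qed.
Lemma mfpsNE f m : (- f) m = - f m. Proof. by []. Qed.
Lemma mfps_sumE (I : Type) (r : seq I) (Q : pred I) (F : I -> P) m :
  (\sum_(i <- r | Q i) F i) m = \sum_(i <- r | Q i) F i m.
Proof. by elim/big_rec2: _ => // i x y _ <-. Qed.

(** [f] and [g] agree in degrees less than [b]. *)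
Definition agree b f g := forall m, (mdeg m < b)%N -> f m = g m.

Lemma agreeM b f f' g g' : agree b f f' -> agree b g g' -> agree b (f * g) (f' * g').
Proof.
move=> ff gg m mb; rewrite !mfps_mulE; apply: eq_bigr => -[k1 k2] /= /eqP.
move/(congr1 mdeg); rewrite mdegD => mE.
by rewrite ff ?gg //; apply: leq_ltn_trans mb; lia.
Qed.

Definition poly_fps p : P := fun m => p@_m.

Lemma poly_fps_is_additive : additive poly_fps.
Proof. by move=> p q; apply: mfpsP => m; rewrite /poly_fps mcoeffB. Qed.

Lemma poly_fps_is_multiplicative : multiplicative poly_fps.
Proof.
split=> [p q|]; apply: mfpsP => m; first by rewrite mfps_mulE /poly_fps mcoeffM.
by rewrite /poly_fps mcoeff1.
Qed.

HB.instance Definition _ := GRing.isAdditive.Build {mpoly K[n]} P poly_fps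
  poly_fps_is_additive.
HB.instance Definition _ := GRing.isMultiplicative.Build {mpoly K[n]} P poly_fps
  poly_fps_is_multiplicative.

Definition trunc b f : {mpoly K[n]} := \sum_(k : 'X_{1..n < b}) f k *: 'X_[k].

Lemma mcoeff_trunc b f m : (trunc b f)@_m = if (mdeg m < b)%N then f m else 0.
Proof.
case: ltnP => mb; first exact: mcoeff_mpoly.
rewrite raddf_sum /= big1 // => k _; rewrite mcoeffZ mcoeffX; case: eqP => [km|_].
  by have := bmdeg k; rewrite km ltnNge mb.
by rewrite mulr0.
Qed.

Lemma agree_trunc b f : agree b (poly_fps (trunc b f)) f.
Proof. by move=> m mb; rewrite /poly_fps mcoeff_trunc mb. Qed.

Lemma agree_sym b f g : agree b f g -> agree b g f.
Proof. by move=> fg m mb; rewrite fg. Qed.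

Lemma mcoeff_trunc_mul b f g m : (mdeg m < b)%N ->
  (f * g) m = (trunc b f * trunc b g)@_m.
Proof.
move=> mb; rewrite -[RHS]/(poly_fps _ m) rmorphM.
by apply: agreeM mb; apply/agree_sym/agree_trunc.
Qed.

Definition mono m : P := poly_fps 'X_[m].
(** Power series over [K] carry no module structure over [K]; [cst] embeds the scalars. *)
Definition cst (c : K) : P := poly_fps c%:MP.

HB.instance Definition _ := GRing.RMorphism.copy cst (poly_fps \o @mpolyC n K).

Lemma monoE m k : mono m k = (m == k)%:R.
Proof. by rewrite /mono /poly_fps mcoeffX. Qed.

Lemma mono0 : mono 0%MM = 1.
Proof. by rewrite /mono mpolyX0 rmorph1. Qed.

Lemma monoD m k : mono (m + k)%MM = mono m * mono k.
Proof. by rewrite /mono mpolyXD rmorphM. Qed.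

Lemma monoU i : mono U_(i)%MM = mfpsX K i.
Proof. by apply: mfpsP => m; rewrite monoE eq_sym. Qed.

Lemma mono_mulE k f m : (mono k * f) m = if (k <= m)%MM then f (m - k)%MM else 0.
Proof.
rewrite (mcoeff_trunc_mul _ _ (ltnSn (mdeg m))).
have -> : (trunc (mdeg m).+1 (mono k) * trunc (mdeg m).+1 f)@_m =
    ('X_[k] * trunc (mdeg m).+1 f)@_m.
  rewrite -[LHS]/(poly_fps _ m) -[RHS]/(poly_fps _ m) !rmorphM.
  by apply: agreeM (ltnSn _) => //; apply: agree_trunc.
case: ifP => km.
  rewrite -{1}(submK km) addmC mulrC mcoeffMX mcoeff_trunc ifT //.
  by rewrite ltnS mdegB.
rewrite mcoeffM big1 // => -[k1 k2] /= /eqP mE; rewrite mcoeffX.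
case: eqP => [kk|_]; last by rewrite mul0r.
by have := lem_addr k1 k2; rewrite -mE -kk km.
Qed.

Lemma cst_mulE c f m : (cst c * f) m = c * f m.
Proof.
rewrite (mcoeff_trunc_mul _ _ (ltnSn (mdeg m))) -[LHS]/(poly_fps _ m) rmorphM.
transitivity ((cst c * poly_fps (trunc (mdeg m).+1 f)) m).
  by apply: agreeM (ltnSn _) => //; apply: agree_trunc.
by rewrite /cst -rmorphM /= /poly_fps mcoeffCM mcoeff_trunc ltnSn.
Qed.

Lemma mfpsX_mulE i f m :
  (mfpsX K i * f) m = if (0 < m i)%N then f (m - U_(i))%MM else 0.
Proof.
rewrite -monoU mono_mulE; congr (if _ then _ else _); apply/mnm_lepP/idP => [/(_ i)|mi j].
  by rewrite mnm1E eqxx.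
by rewrite mnm1E; case: eqP => [<-|].
Qed.

Lemma mono_prod k : mono k = \prod_i mfpsX K i ^+ k i.
Proof.
rewrite /mono mpolyXE_id rmorph_prod; apply: eq_bigr => i _.
by rewrite rmorphXn -monoU.
Qed.

Lemma trunc_fpsE b f : poly_fps (trunc b f) = \sum_(k : 'X_{1..n < b}) cst (f k) * mono k.
Proof.
rewrite /trunc rmorph_sum; apply: eq_bigr => k _.
by rewrite -mul_mpolyC rmorphM.
Qed.

(** The [b]-th power of the ideal generated by the variables. *)
Definition low b f := agree b f 0.

Lemma lowW a b f : (a <= b)%N -> low b f -> low a f.
Proof. by move=> ab fb m ma; apply/fb/(leq_trans ma). Qed.

Lemma low_add b f g : low b f -> low b g -> low b (f + g).
Proof. by move=> fb gb m mb; rewrite mfpsDE fb ?gb ?addr0. Qed.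

Lemma low_sum b (I : Type) (r : seq I) (Q : pred I) (F : I -> P) :
  (forall i, Q i -> low b (F i)) -> low b (\sum_(i <- r | Q i) F i).
Proof. by move=> FF; elim/big_rec: _ => // i x Qi xl; apply: low_add => //; apply: FF. Qed.

Lemma low_mul a b f g : low a f -> low b g -> low (a + b) (f * g).
Proof.
move=> fa gb m mab; rewrite mfps_mulE big1 // => -[k1 k2] /= /eqP /(congr1 mdeg).
rewrite mdegD => mE; have [k1a|k1a] := ltnP (mdeg k1) a; first by rewrite fa ?mul0r.
by rewrite gb ?mulr0 //; lia.
Qed.

Lemma low0 f : low 0 f. Proof. by []. Qed.

Lemma low_mull b f g : low b f -> low b (g * f).
Proof. by move=> fb; have := low_mul (low0 g) fb. Qed.

Lemma low1P f : low 1 f <-> mfps_const f = 0.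
Proof.
split=> [|f0 m]; first by apply; rewrite mdeg0.
by rewrite ltnS leqn0 mdeg_eq0 => /eqP ->.
Qed.

Lemma low_exp b f j : low b f -> low (j * b) (f ^+ j).
Proof. by move=> fb; elim: j => [//|j IH]; rewrite exprS mulSn; apply: low_mul. Qed.

Lemma low_sub_trunc b f : low b (f - poly_fps (trunc b f)).
Proof. by move=> m mb; rewrite mfpsDE mfpsNE agree_trunc // subrr. Qed.

(** Unlike [idealr_closed], this does not exclude the unit ideal. *)
Definition is_ideal (I : P -> Prop) := I 0 /\ forall a u v, I u -> I v -> I (a * u + v).

Lemma ideal_add I u v : is_ideal I -> I u -> I v -> I (u + v).
Proof. by move=> [_ Icl] Iu Iv; rewrite -[u]mul1r; apply: Icl. Qed.

Lemma ideal_mul I a u : is_ideal I -> I u -> I (a * u).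
Proof. by move=> [I0 Icl] Iu; rewrite -[a * u]addr0; apply: Icl. Qed.

Lemma ideal_sum I (J : Type) (r : seq J) (Q : pred J) (F : J -> P) :
  is_ideal I -> (forall i, Q i -> I (F i)) -> I (\sum_(i <- r | Q i) F i).
Proof.
move=> Iid FF; elim/big_rec: _ => [|i x Qi Ix]; first exact: Iid.1.
by apply: ideal_add => //; apply: FF.
Qed.

(** Each monomial of [f] is assigned to the first variable that divides it. *)
Lemma low1_decomp b f : low b.+1 f ->
  exists g : 'I_n -> P, (forall i, low b (g i)) /\ f = \sum_i mfpsX K i * g i.
Proof.
move=> fb; pose fst m := [pick i | (0 < m i)%N].
exists (fun i => (fun m => if fst (m + U_(i))%MM == Some i then f (m + U_(i))%MM else 0)).
split=> [i m mb|].
  by case: ifP => // _; apply: fb; rewrite mdegD mdeg1 addn1 ltnS.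
apply: mfpsP => m; rewrite mfps_sumE.
rewrite (eq_bigr (fun i => if fst m == Some i then f m else 0)) => [|i _].
  rewrite /fst; case: pickP => [i mi|m0].
    by rewrite (bigD1 i) //= eqxx big1 ?addr0 // => j /negPf ji;
       rewrite -[_ == Some j]/(i == j) eq_sym ji.
  rewrite big1 //; have -> : m = 0%MM; last by apply: fb; rewrite mdeg0.
  by apply/mnmP => i; rewrite mnm0E; have := m0 i; case: (m i).
rewrite mfpsX_mulE; case: ifP => mi.
  rewrite submK //; apply/mnm_lepP => j.
  by rewrite mnm1E; case: eqP => [<-|].
by rewrite /fst; case: pickP => // j mj; case: eqP => // -[ji]; rewrite ji mi in mj.
Qed.

(** Such an [f] is an infinite sum of monomials of the ideal, but a finite combination
    of the monomials of degree [b]: one variable is split off at a time, and the ideal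
    is replaced by its quotient by that variable. *)
Lemma ideal_low (I : P -> Prop) b f : is_ideal I ->
  (forall k, mdeg k = b -> I (mono k)) -> low b f -> I f.
Proof.
elim: b I f => [|b IH] I f Iid Ib fb.
  by rewrite -[f]mulr1 -mono0; apply: ideal_mul => //; apply: Ib; rewrite mdeg0.
have [g [gb ->]] := low1_decomp fb; apply: ideal_sum => // i _.
apply: (IH (fun h => I (mfpsX K i * h))) (gb i).
  split=> [|a u v Iu Iv]; first by rewrite mulr0; exact: Iid.1.
  by rewrite mulrDr mulrCA; apply: Iid.2.
by move=> k kb; rewrite -monoU -monoD; apply: Ib; rewrite mdegD mdeg1 kb.
Qed.

(** The truncation of [f] is a finite sum of monomials with exponents in [S], and the rest
    begins in degree [b]. *)
Lemma ideal_supp (I : P -> Prop) b (S : pred 'X_{1..n}) f : is_ideal I ->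
  (forall k, S k -> I (mono k)) -> (forall k, mdeg k = b -> I (mono k)) ->
  (forall k, ~~ S k -> f k = 0) -> I f.
Proof.
move=> Iid IS Ib fS; rewrite -(subrK (poly_fps (trunc b f)) f).
apply: ideal_add => //; first exact: ideal_low Ib (@low_sub_trunc b f).
rewrite trunc_fpsE; apply: ideal_sum => // k _; have [kS|kS] := boolP (S k).
  by apply: ideal_mul => //; apply: IS.
by rewrite fS // rmorph0 mul0r; exact: Iid.1.
Qed.

Lemma geometric_inverse h : low 1 h -> exists g, (1 - h) * g = 1.
Proof.
move=> h1; pose s b := \sum_(j < b) h ^+ j.
exists (fun m => s (mdeg m).+1 m); apply: mfpsP => m.
have hj j b : (b <= j)%N -> low b (h ^+ j).
  by move=> bj; apply: lowW bj _; have := low_exp (j := j) h1; rewrite muln1.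
have sa : agree (mdeg m).+1 (fun m => s (mdeg m).+1 m) (s (mdeg m).+1).
  move=> k; rewrite ltnS => km; rewrite /s -(subnKC km) -addSn big_split_ord /= mfpsDE.
  rewrite [X in _ + X](_ : _ = 0) ?addr0 // mfps_sumE big1 // => j _.
  by apply: (hj _ (mdeg k).+1); rewrite // addSn ltnS leq_addr.
rewrite (agreeM (fun _ _ => erefl) sa (ltnSn _)).
have -> : (1 - h) * s (mdeg m).+1 = 1 - h ^+ (mdeg m).+1.
  by rewrite /s -[RHS]opprB subrX1 -mulNr opprB.
by rewrite mfpsDE mfpsNE (hj _ (mdeg m).+1) ?subr0.
Qed.
End PowerSeriesBasics.

(** * Substitution, units and zero divisors *)

Section Substitution.
Variables (n n' : nat) (K : comNzRingType) (y : 'I_n -> mfps n' K).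
Hypothesis y0 : forall i, mfps_const (y i) = 0.
Local Notation P := (mfps n K).
Local Notation P' := (mfps n' K).

Definition eval_poly (p : {mpoly K[n]}) : P' := mmap (@cst n' K) y p.
HB.instance Definition _ := GRing.RMorphism.copy eval_poly (mmap (@cst n' K) y).

Definition ymono (k : 'X_{1..n}) : P' := mmap1 y k.

Lemma ymono0 : ymono 0%MM = 1. Proof. exact: mmap11. Qed.
Lemma ymonoU i : ymono U_(i)%MM = y i. Proof. exact: mmap1U. Qed.
Lemma ymonoD k l : ymono (k + l)%MM = ymono k * ymono l.
Proof. by apply: commr_mmap1_M => i x; apply: mulrC. Qed.

Lemma low_ymono k : low (mdeg k) (ymono k).
Proof.
rewrite /ymono /mmap1 mdegE; elim/big_rec2: _ => [|i x b _ lb]; first exact: low0.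
rewrite mulrC addnC mulrC addnC; apply: low_mul => //.
by have := @low_exp _ _ 1 (y i) (k i); rewrite muln1; apply; apply/low1P.
Qed.

Lemma eval_polyE b p : (forall k, (b <= mdeg k)%N -> p@_k = 0) ->
  eval_poly p = \sum_(k : 'X_{1..n < b}) cst p@_k * ymono k.
Proof.
move=> pb; apply: mmapE; rewrite msizeE; apply/bigmax_leqP_seq => k.
by rewrite mcoeff_msupp => pk _; rewrite ltnNge; apply: contra pk => /pb ->.
Qed.

Lemma low_eval_poly b p : (forall k, (mdeg k < b)%N -> p@_k = 0) -> low b (eval_poly p).
Proof.
move=> pb; rewrite /eval_poly /mmap; apply: low_sum => k _.
have [kb|kb] := ltnP (mdeg k) b; first by rewrite pb // rmorph0 mul0r.
by apply: low_mull; apply: lowW kb (@low_ymono k).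
Qed.

(** Only the monomials of degree at most [mdeg m] contribute to the coefficient of [m],
    since the [y i] have no constant term. *)
Definition subst (f : P) : P' := fun m => eval_poly (trunc (mdeg m).+1 f) m.

Lemma agree_subst b f : agree b (subst f) (eval_poly (trunc b f)).
Proof.
move=> m mb; apply/eqP; rewrite /subst -subr_eq0 -mfpsNE -mfpsDE -rmorphB /=.
apply/eqP; apply: (low_eval_poly (b := (mdeg m).+1) _ (ltnSn _)) => k km.
by rewrite mcoeffB !mcoeff_trunc km (leq_trans km mb) subrr.
Qed.

Lemma subst_is_additive : additive subst.
Proof.
move=> f g; apply: mfpsP => m; rewrite mfpsDE mfpsNE /subst -mfpsNE -mfpsDE -rmorphB.
congr (eval_poly _ m); apply/mpolyP => k; rewrite mcoeffB !mcoeff_trunc.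
by case: ifP; rewrite ?subrr.
Qed.

Lemma subst_is_multiplicative : multiplicative subst.
Proof.
split=> [f g|]; apply: mfpsP => m; have mm := ltnSn (mdeg m).
  rewrite (agreeM (@agree_subst _ f) (@agree_subst _ g) mm) -rmorphM.
  rewrite /subst; apply/eqP; rewrite -subr_eq0 -mfpsNE -mfpsDE -rmorphB /=; apply/eqP.
  apply: (low_eval_poly (b := (mdeg m).+1) _ mm) => k km.
  by rewrite mcoeffB mcoeff_trunc km -mcoeff_trunc_mul // subrr.
rewrite /subst (_ : trunc _ 1 = 1) ?rmorph1 //; apply/mpolyP => k.
rewrite mcoeff_trunc mcoeff1 -[(1 : P) k]/((k == 0%MM)%:R).
by case: ltnP => //; case: eqP => // ->; rewrite mdeg0.
Qed.

Lemma substE b f m : (mdeg m < b)%N ->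
  subst f m = (\sum_(k : 'X_{1..n < b}) cst (f k) * ymono k) m.
Proof.
move=> mb; rewrite (@agree_subst b f m mb) (@eval_polyE b) => [|k kb]; last first.
  by rewrite mcoeff_trunc ltnNge kb.
rewrite !mfps_sumE; apply: eq_bigr => k _.
by rewrite mcoeff_trunc bmdeg.
Qed.

Lemma substX i : subst (mfpsX K i) = y i.
Proof.
rewrite -monoU; apply: mfpsP => m.
have mb : (mdeg m < (mdeg m).+2)%N by [].
have ib : (mdeg (U_(i)%MM : 'X_{1..n}) < (mdeg m).+2)%N by rewrite mdeg1.
rewrite (substE _ mb) (bigD1 (BMultinom ib)) //= monoE eqxx rmorph1 mul1r ymonoU.
rewrite big1 ?addr0 // => k /eqP ki; rewrite monoE; case: eqP => [ik|_].
  by case: ki; apply: val_inj.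
by rewrite rmorph0 mul0r.
Qed.
End Substitution.

Section OverField.
Variables (n : nat) (K : fieldType).
Local Notation P := (mfps n K).
Implicit Types f g : P.

Lemma mfps_unit f : mfps_const f != 0 -> exists g, f * g = 1.
Proof.
set c := mfps_const f => c0; pose h := 1 - cst c^-1 * f.
have [g hg] : exists g, (1 - h) * g = 1.
  apply: geometric_inverse; apply/low1P.
  rewrite /h mfps_constD /mfps_const mfpsNE cst_mulE -/(mfps_const f) -/c mulVf //.
  by rewrite -[(1 : P) _]/((_ == _)%:R) eqxx subrr.
exists (cst c^-1 * g); rewrite mulrCA mulrA -hg; congr (_ * _).
by rewrite /h opprB addrC subrK.
Qed.

Lemma ideal_unit (I : P -> Prop) f : is_ideal I -> I f -> mfps_const f != 0 -> I 1.
Proof. by move=> Iid If /mfps_unit[g <-]; rewrite mulrC; apply: ideal_mul. Qed.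

(** The truncation just above the order of [f] is its initial form. *)
Lemma ex_initial_form f : f != 0 -> exists a, low a f /\ trunc a.+1 f != 0.
Proof.
move=> f0; have [m fm] : exists m, f m != 0.
  apply/not_existsP => h; move/eqP: f0; apply; apply: mfpsP => m.
  by have /negP := h m; rewrite negbK => /eqP.
have ex : exists a, [exists k : 'X_{1..n < a.+1}, f k != 0].
  by exists (mdeg m); apply/fintype.existsP; exists (BMultinom (ltnSn _)).
case: (ex_minnP ex) => a /fintype.existsP[k fk] amin; exists a; split=> [l la|].
  apply/eqP/negPn/negP => fl.
  have /amin : [exists k : 'X_{1..n < (mdeg l).+1}, f k != 0].
    by apply/fintype.existsP; exists (BMultinom (ltnSn _)).
  by rewrite leqNgt la.
by apply: contra fk => /eqP/(congr1 (mcoeff k)); rewrite mcoeff_trunc bmdeg mcoeff0 => ->.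
Qed.

(** The product of the initial forms is the initial form of the product, and polynomials
    have no zero divisors. *)
Lemma mfps_mulf_eq0 f g : f * g = 0 -> f = 0 \/ g = 0.
Proof.
have [->|f0] := pselect (f = 0); first by left.
have [->|g0] := pselect (g = 0); first by right.
move=> fg0; exfalso.
have [a [fa ta]] := ex_initial_form (introN eqP f0).
have [b [gb tb]] := ex_initial_form (introN eqP g0).
have := mulf_neq0 ta tb; apply/negP; rewrite negbK; apply/eqP/mpolyP => m.
rewrite mcoeff0; have [mab|mab] := ltnP (mdeg m) (a + b).+1; last first.
  rewrite mcoeffM big1 // => -[k1 k2] /= /eqP /(congr1 mdeg); rewrite mdegD => mE.
  rewrite !mcoeff_trunc; case: ltnP => k1a; last by rewrite mul0r.
  by case: ltnP => k2b; rewrite ?mulr0 //; lia.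
transitivity ((f * g) m); last by rewrite fg0.
rewrite mcoeffM mfps_mulE; apply: eq_bigr => -[k1 k2] /= /eqP /(congr1 mdeg).
rewrite mdegD => mE; rewrite !mcoeff_trunc !ltnS.
case: (leqP (mdeg k1) a) => k1a; last by rewrite mul0r gb ?mulr0 //; lia.
by case: (leqP (mdeg k2) b) => k2b //; rewrite mulr0 fa ?mul0r //; lia.
Qed.
End OverField.

(** * The local ring of a hypersurface, and quotient modules *)

Lemma submoduleP (A : nzRingType) (V : lmodType A) (N : set V) :
  submodule N <-> N 0 /\ forall a u v, N u -> N v -> N (a *: u + v).
Proof.
split=> [[N0 Ncl]|[N0 Ncl]].
  split=> [|a u v Nu Nv]; first exact/set_mem.
  by apply/set_mem/Ncl; apply/mem_set.
by split=> [|a u v /set_mem Nu /set_mem Nv]; apply/mem_set => //; apply: Ncl.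
Qed.

Lemma ideal_genP (A : comNzRingType) (X : set A) (a : A) :
  a \in ideal_gen X <->
  forall I : set A^o, submodule I -> X `<=` I -> I a.
Proof.
split=> [/set_mem aX I Isub XI|h]; first exact: aX.
by apply/mem_set => I [Isub XI]; apply: h.
Qed.

Lemma ideal_gen_sub (A : comNzRingType) (X : set A) a : X a -> a \in ideal_gen X.
Proof. by move=> Xa; apply/ideal_genP => I _; apply. Qed.

Section HypersurfaceRing.
Local Open Scope quotient_scope.
Variables (n : nat) (K : fieldType) (F : mfps n K) (F0 : mfps_const F = 0).
Local Notation P := (mfps n K).
Local Notation A := (hypersurface F0).

Definition cls (f : P) : A := \pi_({ideal_quot (hypersurface_ideal F0)}) f.

Lemma cls_additive : additive cls. Proof. exact: raddfB. Qed.
Lemma cls_multiplicative : multiplicative cls.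
Proof. by split; [exact: rmorphM | exact: rmorph1]. Qed.
HB.instance Definition _ := GRing.isAdditive.Build P A cls cls_additive.
HB.instance Definition _ := GRing.isMultiplicative.Build P A cls cls_multiplicative.

Lemma cls_surj (a : A) : exists f, a = cls f.
Proof. by exists (repr a); rewrite /cls reprK. Qed.

Lemma hypersurface_idealP f : f \in hypersurface_ideal F0 <-> exists h, f = F * h.
Proof.
rewrite /hypersurface_ideal; split=> [/ideal_genP fI|[h ->]].
  apply: (fI [set f : P^o | exists h, f = F * h]); last by move=> _ ->; exists 1; rewrite mulr1.
  apply/submoduleP; split=> [|a u v [h ->] [h' ->]]; first by exists 0; rewrite mulr0.
  by exists (a * h + h'); rewrite mulrDr mulrCA.
apply/ideal_genP => I /submoduleP[I0 Icl] FI.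
by rewrite mulrC -[h * F]addr0; apply: Icl => //; apply: FI.
Qed.

Lemma cls_eq f g : cls f = cls g <-> exists h, f - g = F * h.
Proof.
rewrite -hypersurface_idealP; split=> [fg|fg].
  by rewrite Quotient.idealrBE; apply/eqP.
by apply/eqP; rewrite -Quotient.idealrBE.
Qed.

Lemma cls_eq0 f : cls f = 0 <-> exists h, f = F * h.
Proof. by rewrite -(rmorph0 cls) cls_eq subr0. Qed.

Definition max_ideal : set A := [set a | exists2 f, a = cls f & mfps_const f = 0].

Lemma max_ideal_cls f : max_ideal (cls f) <-> mfps_const f = 0.
Proof.
split=> [[g /cls_eq[h fgh] g0]|f0]; last by exists f.
by rewrite -(subrK g f) mfps_constD fgh mfps_constM F0 g0 mul0r addr0.
Qed.

Lemma max_ideal_closed : idealr_closed (mem max_ideal).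
Proof.
split; first by apply/mem_set; rewrite -(rmorph0 cls); apply/max_ideal_cls.
  apply/negP => /set_mem; rewrite -(rmorph1 cls) => /max_ideal_cls/eqP.
  by rewrite -[mfps_const 1]/((_ == _)%:R) eqxx oner_eq0.
move=> a u v /set_mem mu /set_mem mv; apply/mem_set; move: a u v mu mv => a u v.
have [f ->] := cls_surj a; have [g ->] := cls_surj u; have [h ->] := cls_surj v.
move=> /max_ideal_cls g0 /max_ideal_cls h0; rewrite -rmorphM -rmorphD.
by apply/max_ideal_cls; rewrite mfps_constD mfps_constM g0 h0 mulr0 addr0.
Qed.

(** A series with non-zero constant term is invertible. *)
Lemma proper_sub_max (I : set A) : idealr_closed (mem I) -> I `<=` max_ideal.
Proof.
move=> [I0 I1 Icl] a; have [f ->] := cls_surj a => If.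
apply/max_ideal_cls/eqP/negPn/negP => /mfps_unit[g fg].
move/negP: I1; apply; have := Icl (cls g) (cls f) 0 (mem_set If) I0.
by rewrite addr0 -rmorphM mulrC fg rmorph1.
Qed.

Lemma max_ideal_maximal : maximal_ideal A max_ideal.
Proof.
split; first exact: max_ideal_closed.
by move=> J Jid mJ; apply/seteqP; split=> //; apply: proper_sub_max.
Qed.

Lemma the_maximal_idealE : the_maximal_ideal A = max_ideal.
Proof.
have loc : local_ring max_ideal.
  split; first exact: max_ideal_maximal.
  by move=> M [Mid Mmax]; apply/esym/Mmax; [exact: max_ideal_closed|exact: proper_sub_max].
rewrite /the_maximal_ideal; case: xgetP => [M -> [Mm _]|/(_ max_ideal)//].
exact: loc.2.
Qed.
End HypersurfaceRing.

Section QuotMod.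
Local Open Scope quotient_scope.
Variables (A : nzRingType) (V : lmodType A) (N : submodClosed V).

Definition mcls (v : V) : quotmod N := \pi_(Quotient.quot (submod_zmod N)) v.

Lemma mcls_additive : additive mcls. Proof. exact: raddfB. Qed.
HB.instance Definition _ := GRing.isAdditive.Build V (quotmod N) mcls mcls_additive.

Lemma mclsZ a v : mcls (a *: v) = a *: mcls v.
Proof. by rewrite -[RHS]/(quotmod_scale _ _) /mcls quotmod_scale_pi. Qed.

Lemma mcls_surj (x : quotmod N) : exists v, x = mcls v.
Proof.
exists (repr (x : Quotient.quot (submod_zmod N))).
by rewrite /mcls -[x in LHS](@reprK _ (Quotient.quot (submod_zmod N))).
Qed.

Lemma mcls_eq0 v : mcls v = 0 <-> v \in N.
Proof.
rewrite -[v \in N]/(v \in submod_zmod N) -(raddf0 mcls) -[v in X in _ <-> X]subr0.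
by rewrite Quotient.idealrBE; split=> [?|/eqP]; first exact/eqP.
Qed.
End QuotMod.

(** * Reduction of power series modulo powers of the variables *)

Section Coefficients.
Variables (K : fieldType) (q : nat).

Fixpoint box_coef n : box K q n -> (nat -> nat) -> K :=
  if n is n'.+1 return box K q n -> (nat -> nat) -> K
  then fun v e => box_coef (bcoef (e n') v) e else fun v _ => v.

Fixpoint box_of n (g : (nat -> nat) -> K) : box K q n :=
  if n is n'.+1 return box K q n then
    of_coef q (fun m => box_of n' (fun e => g (fun l => if l == n' then m else e l)))
  else g (fun=> 0%N).

Definition below_q n (e : nat -> nat) := all (fun k => e k < q)%N (iota 0 n).

Lemma below_qS n e : below_q n.+1 e = below_q n e && (e n < q)%N.
Proof. by rewrite /below_q -addn1 iotaD all_cat /= andbT add0n. Qed.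

Lemma box_coef_ext n (v : box K q n) e e' : (forall k, (k < n)%N -> e k = e' k) ->
  box_coef v e = box_coef v e'.
Proof.
elim: n v => [//|n IH] v ee /=; rewrite ee //; apply: IH => k kn.
by apply: ee; rewrite ltnW.
Qed.

Lemma box_coef_lin n e : linear (fun v : box K q n => box_coef v e : K^o).
Proof. by elim: n => [//|n IH] a u v /=; rewrite bcoef_lin IH. Qed.

Lemma box_coef0 n e : box_coef (0 : box K q n) e = 0.
Proof. by elim: n => [//|n IH] /=; rewrite bcoef0 IH. Qed.

Lemma box_coef_out n (v : box K q n) e : ~~ below_q n e -> box_coef v e = 0.
Proof.
elim: n v => [//|n IH] v; rewrite below_qS negb_and => /orP[en|en] /=; first exact: IH.
by rewrite bcoef_out ?box_coef0 // leqNgt.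
Qed.

Lemma box_coef_inj n (u v : box K q n) :
  (forall e, box_coef u e = box_coef v e) -> u = v.
Proof.
elim: n u v => [u v /(_ id)//|n IH] u v uv.
apply: bcoefP => m mq; apply: IH => e.
have := uv (fun l => if l == n then m else e l); rewrite /= eqxx.
have ext (w : box K q n) : box_coef w (fun l => if l == n then m else e l) = box_coef w e :> K.
  by apply: box_coef_ext => k kn; rewrite ltn_eqF.
by rewrite !ext.
Qed.

Lemma box_coef_of n g e :
  (forall e1 e2, (forall k, (k < n)%N -> e1 k = e2 k) -> g e1 = g e2) ->
  box_coef (box_of n g) e = if below_q n e then g e else 0.
Proof.
elim: n g => [|n IH] g gext /=; first exact: gext.
rewrite /bcoef coef_of_coef below_qS; case: (ltnP (e n) q) => en.
  rewrite andbT IH => [|e1 e2 e12]; last first.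
    by apply: gext => k kn; case: eqP => // /eqP kn'; apply: e12; lia.
  by case: ifP => // _; apply: gext => k _; case: eqP => // ->.
by rewrite andbF box_coef0.
Qed.

Lemma box_coef_var_op n k (v : box K q n) e : (k < n)%N ->
  box_coef (var_op K q n k v) e =
    if (0 < e k < q)%N then box_coef v (fun l => if l == k then (e k).-1 else e l)
    else 0.
Proof.
elim: n v => [//|n IH] v; rewrite ltnS leq_eqVlt => /predU1P[->|kn].
  rewrite [LHS]/= -[X in bcoef _ X]/(var_op K q n.+1 n v) bcoef_var_op_top.
  case: ifP => _; last by rewrite box_coef0.
  rewrite /= eqxx; apply: box_coef_ext => l ln; by rewrite ltn_eqF.
rewrite [LHS]/= -[X in bcoef _ X]/(var_op K q n.+1 k v) bcoef_var_op_lift // IH //=.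
by rewrite gtn_eqF.
Qed.
End Coefficients.

Section Reduction.
Variables (K : fieldType) (q n : nat).
Hypothesis q0 : (0 < q)%N.
Local Notation P := (mfps n K).
Local Notation B := (box K q n).

(** The reduction of power series modulo the [q]-th powers of the variables. *)
Definition to_box (f : P) : B := box_of q n (fun e => f [multinom e i | i < n]).
Definition bcf (v : B) (m : 'X_{1..n}) : K := box_coef v (nth 0%N m).
Definition in_box (m : 'X_{1..n}) := [forall i, (m i < q)%N].

Lemma in_boxE (m : 'X_{1..n}) : in_box m = below_q q n (nth 0%N m).
Proof.
apply/forallP/allP => [h k|h i]; last first.
  by rewrite (mnm_nth 0%N); apply: h; rewrite mem_iota /=.
by rewrite mem_iota => /= kn; have := h (Ordinal kn); rewrite (mnm_nth 0%N).
Qed.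

Lemma multinom_nth (m : 'X_{1..n}) : [multinom nth 0%N m i | i < n] = m.
Proof. by apply/mnmP => i; rewrite mnmE -mnm_nth. Qed.

Lemma bcf_to_box f m : bcf (to_box f) m = if in_box m then f m else 0.
Proof.
rewrite /bcf box_coef_of => [|e1 e2 e12]; first by rewrite -in_boxE multinom_nth.
by congr (f _); apply/mnmP => i; rewrite !mnmE e12.
Qed.

Lemma bcf_inj u v : (forall m, bcf u m = bcf v m) -> u = v.
Proof.
move=> uv; apply: box_coef_inj => e; have := uv [multinom e i | i < n].
have E w : bcf w [multinom e i | i < n] = box_coef w e.
  apply: box_coef_ext => k kn.
  by rewrite -[k]/(val (Ordinal kn)) -mnm_nth mnmE.
by rewrite !E.
Qed.

Lemma bcfD u v m : bcf (u + v) m = bcf u m + bcf v m.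
Proof. by rewrite /bcf -[u]scale1r box_coef_lin !scale1r. Qed.

Lemma bcfZ c v m : bcf (c *: v) m = c * bcf v m.
Proof. by rewrite /bcf -[c *: v]addr0 box_coef_lin box_coef0 addr0. Qed.

Lemma to_box_surj v : exists f, v = to_box f.
Proof.
exists (bcf v); apply: bcf_inj => m; rewrite bcf_to_box; case: ifP => // mq.
by rewrite /bcf box_coef_out // -in_boxE mq.
Qed.

Lemma to_boxD f g : to_box (f + g) = to_box f + to_box g.
Proof.
apply: bcf_inj => m; rewrite bcfD !bcf_to_box; case: ifP => // _.
by rewrite addr0.
Qed.

Lemma to_boxZ c f : to_box (cst c * f) = c *: to_box f.
Proof.
apply: bcf_inj => m; rewrite bcfZ !bcf_to_box cst_mulE.
by case: ifP => // _; rewrite mulr0.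
Qed.

Lemma to_boxB f g : to_box (f - g) = to_box f - to_box g.
Proof.
rewrite to_boxD; congr (_ + _); rewrite -scaleN1r -to_boxZ rmorphN rmorph1.
by rewrite mulN1r.
Qed.

Lemma to_box0 : to_box 0 = 0.
Proof. by rewrite -(subrr 0) to_boxB subrr. Qed.

Lemma to_box_sum (I : Type) (r : seq I) (Q : pred I) (G : I -> P) :
  to_box (\sum_(i <- r | Q i) G i) = \sum_(i <- r | Q i) to_box (G i).
Proof. exact: (big_morph to_box to_boxD to_box0). Qed.

Lemma to_boxX i f : to_box (mfpsX K i * f) = var_op K q n i (to_box f).
Proof.
apply: bcf_inj => m; rewrite bcf_to_box mfpsX_mulE /bcf box_coef_var_op //.
rewrite -mnm_nth; case: posnP => mi /=; first by rewrite if_same.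
pose m' := (m - U_(i))%MM.
have -> : box_coef (to_box f) (fun l => if l == i then (m i).-1 else nth 0%N m l) =
    bcf (to_box f) m'.
  apply: box_coef_ext => k kn; rewrite -[k]/(val (Ordinal kn)) -!mnm_nth mnmBE mnm1E.
  rewrite (inj_eq val_inj) eq_sym; case: eqP => [<-|]; rewrite ?subn1 ?subn0 //.
rewrite bcf_to_box; case: ifP => /forallP mq.
  rewrite mq ifT //; apply/forallP => j; rewrite mnmBE.
  by apply: leq_ltn_trans (mq j); apply: leq_subr.
case: ltnP => // miq; case: ifP => // /forallP mq'; case: mq => j.
by have := mq' j; rewrite mnmBE mnm1E; case: eqP => [<-|_]; rewrite ?subn0.
Qed.

Lemma to_box_eq0 f : to_box f = 0 <-> forall m, in_box m -> f m = 0.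
Proof.
split=> [f0 m mq|f0]; first by have := bcf_to_box f m; rewrite f0 mq /bcf box_coef0.
apply: bcf_inj => m; rewrite bcf_to_box /bcf box_coef0; case: ifP => // /f0.
by [].
Qed.

Lemma to_box_ideal : is_ideal (fun f => to_box f = 0).
Proof.
split=> [|a u v /to_box_eq0 u0 v0]; first exact: to_box0.
rewrite to_boxD v0 addr0; apply/to_box_eq0 => m mq.
rewrite mfps_mulE big1 // => -[k1 k2] /= /eqP mE; rewrite u0 ?mulr0 //.
apply/forallP => i; have /forallP/(_ i) := mq; apply: leq_ltn_trans.
by have := congr1 (fun x : 'X_{1..n} => x i) mE; rewrite /= mnmDE; lia.
Qed.

Lemma to_box_low f : low (n * q) f -> (0 < n)%N -> to_box f = 0.
Proof.
move=> fl n0; apply/to_box_eq0 => m /forallP mq; apply: fl.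
rewrite mdegE; apply: (@leq_ltn_trans (\sum_(i < n) q.-1)).
  by apply: leq_sum => i _; have := mq i; lia.
by rewrite sum_nat_const card_ord ltn_pmul2l //; lia.
Qed.

(** The kernel of the reduction is generated by the [q]-th powers of the variables. *)
Lemma ideal_box (I : P -> Prop) f : (0 < n)%N -> is_ideal I ->
  (forall i, I (mfpsX K i ^+ q)) -> to_box f = 0 -> I f.
Proof.
move=> n0 Iid IX /to_box_eq0 f0.
have Imono k : ~~ in_box k -> I (mono K k).
  rewrite negb_forall => /fintype.existsP[i]; rewrite -leqNgt => ki.
  rewrite -(@submK _ (U_(i) *+ q)%MM k) ?monoD; last first.
    apply/mnm_lepP => j; rewrite mulmnE mnm1E.
    by case: eqP => [<-|]; rewrite ?mul1n ?mul0n.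
  apply: ideal_mul => //; suff -> : mono K (U_(i) *+ q)%MM = mfpsX K i ^+ q by [].
  by rewrite -monoU /mono -rmorphXn mpolyXn.
apply: (ideal_supp (b := n * q) (S := fun k => ~~ in_box k)) => // k.
  move=> kb; apply: Imono; apply/negP => /forallP kq.
  suff: (mdeg k < n * q)%N by rewrite kb ltnn.
  rewrite mdegE; apply: (@leq_ltn_trans (\sum_(i < n) q.-1)).
    by apply: leq_sum => i _; have := kq i; lia.
  by rewrite sum_nat_const card_ord ltn_pmul2l //; lia.
by rewrite negbK; apply: f0.
Qed.

Definition stable (U : {vspace B}) :=
  forall i : 'I_n, forall v, v \in U -> var_op K q n i v \in U.

(** The reduction kills the series of order [n q], so stability under the variables
    passes to multiplication by arbitrary series. *)
Lemma stable_ideal U : (0 < n)%N -> stable U -> is_ideal (fun f => to_box f \in U).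
Proof.
move=> n0 Us; split=> [|a u v uU vU]; first by rewrite to_box0 mem0v.
rewrite to_boxD memvD // -(subrK (poly_fps (trunc (n * q) a)) a) mulrDl to_boxD.
rewrite [to_box (_ * _)]to_box_low ?add0r //; last first.
  by rewrite mulrC; apply: low_mull; apply: low_sub_trunc.
rewrite trunc_fpsE mulr_suml to_box_sum; apply: rpred_sum => k _.
rewrite -mulrA to_boxZ memvZ // mono_prod.
have: forall w, to_box w \in U -> to_box ((\prod_i mfpsX K i ^+ k i) * w) \in U.
  elim/big_ind: _ => [w|x y IHx IHy w wU|i _ w wU]; first by rewrite mul1r.
    by rewrite -mulrA; apply/IHx/IHy.
  elim: (k i : nat) => [|j IH]; first by rewrite mul1r.
  by rewrite exprS -mulrA to_boxX; apply: Us.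
exact.
Qed.

(** In characteristic 3 the [q]-th power of a series is a series in the [q]-th powers of
    the variables. *)
Lemma to_box_frobenius e f : q = (3 ^ e)%N -> 3%:R = 0 :> K -> (0 < n)%N ->
  mfps_const f = 0 -> to_box (f ^+ q) = 0.
Proof.
move=> qE K3 n0 f0; have P3 : (3 \in [pchar P])%N.
  by rewrite inE /=; apply/eqP; rewrite -(rmorph_nat (@cst n K)) K3 rmorph0.
have q3 : [pchar P].-nat q.
  by rewrite qE pnatX pnatE ?P3.
have Xid := to_box_ideal.
pose b := (n * q)%N.
rewrite -(subrK (poly_fps (trunc b f)) f) exprDn_pchar //.
apply: (ideal_add Xid).
  apply: to_box_low n0 => //; have := low_exp (j := q) (@low_sub_trunc _ _ b f).
  by apply: lowW; rewrite leq_pmull.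
rewrite trunc_fpsE.
have -> : (\sum_(k : 'X_{1..n < b}) cst (f k) * mono K k) ^+ q =
    \sum_(k : 'X_{1..n < b}) (cst (f k) * mono K k) ^+ q.
  apply: (big_morph (fun x : P => x ^+ q)); last by rewrite expr0n gtn_eqF.
  by move=> x y; rewrite exprDn_pchar.
rewrite to_box_sum big1 // => k _.
have [k0|k0] := eqVneq (k : 'X_{1..n}) 0%MM.
  by rewrite -to_box0 k0 [f _]f0 rmorph0 mul0r expr0n gtn_eqF.
rewrite exprMn; apply: (@ideal_mul _ _ (fun f => to_box f = 0)) => //.
apply/to_box_eq0 => m /forallP mq; rewrite /mono -rmorphXn mpolyXn.
rewrite -[LHS]/(mono K _ m) monoE; case: eqP => // mE; exfalso.
move: k0; apply/negP; rewrite negbK; apply/eqP/mnmP => i.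
by have := mq i; rewrite -mE mulmnE mnm0E; case: (k i) => // j; rewrite mulSn; lia.
Qed.
End Reduction.

(** * The Hilbert-Kunz function as a nullity *)

Lemma chain_length_eq (T : Type) (Q : set (set T)) l :
  has_chain Q l -> (forall k, has_chain Q k -> (k <= l)%N) -> chain_length Q = l.
Proof.
move=> hl hmax; apply: xget_unique; first by split.
by move=> k [hk kmax]; apply/eqP; rewrite eqn_leq hmax //= kmax.
Qed.

Lemma dim_add_line (K : fieldType) (V : vectType K) (U : {vspace V}) v :
  v \notin U -> \dim (U + <[v]>) = (\dim U).+1.
Proof.
move=> vU; rewrite dimv_disjoint_sum; last first.
  apply/eqP; rewrite -subv0; apply/subvP => u /memv_capP[uU /vlineP[c uc]].
  rewrite memv0 uc; have [->|c0] := eqVneq c 0; first by rewrite scale0r.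
  by move/negP: vU; case; rewrite -[v]scale1r -(mulVf c0) -scalerA -uc memvZ.
by rewrite dim_vline (_ : v != 0) ?addn1 //; apply: contraNneq vU => ->; apply: mem0v.
Qed.

Section LengthOfQuotient.
Variables (n' : nat) (K : fieldType) (s : seq (seq nat)).
Let n := n'.+1.
Local Notation P := (mfps n K).

Definition fps_of_words : P := \sum_(w <- s) \prod_(k <- w) mfpsX K (inord k).

Hypotheses (s_below : words_below n s) (F0 : mfps_const fps_of_words = 0).
Variables (q e : nat).
Hypotheses (K3 : 3%:R = 0 :> K) (qE : q = (3 ^ e)%N).
Let q0 : (0 < q)%N. Proof. by rewrite qE expn_gt0. Qed.

Local Notation A := (hypersurface F0).
Local Notation B := (box K q n).
Let T : 'End(B) := poly_op K q n s.
Let J := frobenius_power (the_maximal_ideal A) q.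
Let M := quotmod J.
Let Phi (f : P) : M := mcls J (cls F0 f : A^o).

Lemma to_box_vars f : to_box q (fps_of_words * f) = T (to_box q f).
Proof.
rewrite /fps_of_words /T mulr_suml to_box_sum //; move: s s_below.
elim=> [|w s' IH]; first by rewrite /poly_op !big_nil zero_lfunE.
move=> /andP[wn sn]; rewrite big_cons poly_op_cons IH //; congr (_ + _).
elim: w wn => [|k w IHw]; first by rewrite /word_op /= big_nil mul1r id_lfunE.
move=> /andP[kn wn]; rewrite big_cons -mulrA to_boxX // IHw //.
by rewrite /word_op /= comp_lfunE -!/(word_op _ _ _ _) inordK.
Qed.

Let PhiB f g : Phi (f - g) = Phi f - Phi g.
Proof. by rewrite /Phi !raddfB. Qed.

Let PhiD f g : Phi (f + g) = Phi f + Phi g.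
Proof. by rewrite /Phi !raddfD. Qed.

Let PhiM g f : Phi (g * f) = cls F0 g *: Phi f.
Proof. by rewrite /Phi rmorphM -mclsZ. Qed.

Let Phi_surj x : exists f, x = Phi f.
Proof. by have [a ->] := mcls_surj x; have [f ->] := cls_surj a; exists f. Qed.

Let stable_limg : stable (limg T).
Proof.
move=> i _ /memv_imgP[v _ ->].
have -> : var_op K q n i (T v) = T (var_op K q n i v); last exact/memv_img/memvf.
have := poly_op_comm [:: [:: (i : nat)]] s v.
by rewrite poly_op1 /word_op /= comp_lfun1r.
Qed.

(** The Frobenius power of the maximal ideal pulls back to the ideal generated by the
    equation and the [q]-th powers of the variables, which the reduction maps onto the
    image of the equation. *)
Let Phi_eq0 f : Phi f = 0 <-> to_box q f \in limg T.
Proof.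
have limg_ideal := @stable_ideal _ _ _ q0 _ (isT : 0 < n)%N stable_limg.
rewrite /Phi mcls_eq0; split=> [/ideal_genP h|/memv_imgP[v _ fv]].
  pose I := [set a : A^o | exists2 g, a = cls F0 g & to_box q g \in limg T].
  have [||g fg gI] := h I.
  - apply/submoduleP; split; first by exists 0; [rewrite raddf0 | exact: limg_ideal.1].
    move=> a u w [g ->] gI [g' -> g'I]; have [c ->] := cls_surj a.
    by exists (c * g + g'); [rewrite rmorphD rmorphM | exact: limg_ideal.2].
  - move=> _ [a + <-]; rewrite the_maximal_idealE => -[g -> g0].
    exists (g ^+ q); first by rewrite rmorphXn.
    by rewrite (to_box_frobenius q0 qE K3) ?mem0v.
  have /cls_eq[h' fgh] := fg.
  have -> : f = (f - g) + g by rewrite subrK.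
  by rewrite to_boxD memvD // fgh to_box_vars memv_img ?memvf.
have [h vh] := to_box_surj v.
have Jid : is_ideal (fun f => cls F0 f \in J).
  split=> [|a u w uJ wJ]; first by rewrite rmorph0; exact: rpred0.
  by rewrite rmorphD rmorphM; apply: rpredD => //; apply: (@rpredZ _ A^o).
have : cls F0 (f - fps_of_words * h) \in J.
  apply: (@ideal_box _ q n q0 _ _ _ Jid) => //; last first.
    by rewrite to_boxB to_box_vars -vh fv subrr.
  move=> i; rewrite rmorphXn; apply: ideal_gen_sub.
  exists (cls F0 (mfpsX K i)) => //; rewrite the_maximal_idealE.
  by exists (mfpsX K i) => //; apply: mfps_constX.
rewrite rmorphB /= (_ : cls F0 (fps_of_words * h) = 0) ?subr0 //.
by apply/cls_eq0; exists h.
Qed.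

Let limg_dim : (\dim (limg T) + nullity T = dim B)%N.
Proof. by rewrite addnC /nullity -[lker T]capfv limg_ker_dim dimvf. Qed.

(** A strict chain of submodules yields a chain of subspaces whose dimension grows by one
    at least at each step, by adding one vector for each step. *)
Let chain_upper k : has_chain (@submodule A M) k -> (k <= nullity T)%N.
Proof.
move=> [C [Csub Cprop]].
have: forall i, (i <= k)%N -> exists U : {vspace B},
    (\dim (limg T) + i <= \dim U)%N /\ forall f, to_box q f \in U -> C i (Phi f).
  elim=> [_|i IH ik].
    exists (limg T); rewrite addn0; split=> // f /Phi_eq0 ->.
    by have /submoduleP[] := Csub 0%N isT.
  have [U [dU UC]] := IH (ltnW ik).
  have [Cle Cne] := Cprop i ik.
  have /submoduleP[C0 Ccl] := Csub i.+1 ik.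
  have [x [Cx Cnx]] : exists x, C i.+1 x /\ ~ C i x.
    by apply: contrapT => h; apply: Cne => x Cx; apply: contrapT => nCx; apply: h; exists x.
  have [g xg] := Phi_surj x; exists (U + <[to_box q g]>)%VS; split.
    have gU : to_box q g \notin U by apply/negP => /UC; rewrite -xg.
    by rewrite dim_add_line // addnS.
  move=> f /memv_addP[u uU [_ /vlineP[c ->] fE]].
  have [u' uu'] := to_box_surj u.
  have : Phi (f - (cst c * g + u')) = 0.
    by apply/Phi_eq0; rewrite to_boxB to_boxD to_boxZ fE uu' [X in _ - X]addrC subrr mem0v.
  rewrite PhiB => /eqP; rewrite subr_eq0 => /eqP ->.
  rewrite PhiD PhiM; apply: Ccl; first by rewrite -xg.
  by apply/Cle/UC; rewrite -uu'.
move=> /(_ k (leqnn k))[U [dU _]].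
rewrite -(leq_add2l (\dim (limg T))) limg_dim; apply: leq_trans dU _.
by rewrite -dimvf dimvS ?subvf.
Qed.

(** Multiplying by variables raises the order, so it ends in [U]: the last vector outside
    [U] is sent into [U] by all the variables. *)
Let socle (U : {vspace B}) : stable U -> (\dim U < dim B)%N ->
  exists2 v, v \notin U & forall i : 'I_n, var_op K q n i v \in U.
Proof.
move=> Us dU; have [w wU] : exists w, w \notin U.
  apply: contrapT => h; suff: U = fullv by move=> Uf; move: dU; rewrite Uf dimvf ltnn.
  apply/vspaceP => v; rewrite memvf; apply/negPn/negP => vU; apply: h.
  by exists v.
have [f wf] := to_box_surj w.
suff H : forall b j f, (n * q <= j + b)%N -> low j f -> to_box q f \notin U ->
    exists2 v, v \notin U & forall i : 'I_n, var_op K q n i v \in U.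
  by apply: (H (n * q)%N 0%N f) => //; rewrite -wf.
elim=> [|b IH] j g jb gj gU.
  by move: gU; rewrite to_box_low ?mem0v //; apply: lowW gj; rewrite -(addn0 j).
have [h|/existsNP[i /negP gi]] := pselect (forall i : 'I_n, var_op K q n i (to_box q g) \in U).
  by exists (to_box q g).
apply: (IH j.+1 (mfpsX K i * g)); first by rewrite addSnnS.
  by rewrite -add1n; apply: low_mul => //; apply/low1P/mfps_constX.
by rewrite to_boxX.
Qed.

(** Adding to a stable subspace a vector provided by [socle] keeps it stable and raises its
    dimension by one. *)
Let chain_lower : has_chain (@submodule A M) (nullity T).
Proof.
pose good (U : {vspace B}) := stable U /\ (limg T <= U)%VS.
have /boolp.choice[step stepP] : forall U, exists U', good U ->
    (\dim U < dim B)%N ->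
    [/\ good U', (U <= U')%VS & \dim U' = (\dim U).+1].
  move=> U; have [gU|gU] := pselect (good U /\ (\dim U < dim B)%N);
    last by exists U => g d; case: gU.
  case: gU => -[Us TU] dU; have [v vU vX] := socle Us dU.
  exists (U + <[v]>)%VS => _ _; split; last first.
  - exact: dim_add_line.
  - exact: addvSl.
  split; last exact: subv_trans TU (addvSl _ _).
  move=> i _ /memv_addP[u uU [_ /vlineP[c ->] ->]].
  apply: (subvP (addvSl U <[v]>)); rewrite linearD linearZ /=.
  by apply: memvD; [apply: Us | apply/memvZ/vX].
pose W i := iter i step (limg T).
have WP i : (i <= nullity T)%N -> good (W i) /\ \dim (W i) = (\dim (limg T) + i)%N.
  elim: i => [|i IH] ik; first by rewrite addn0; split=> //; split=> //; exact: stable_limg.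
  have [gW dW] := IH (ltnW ik).
  have [||] := stepP (W i) => //; first by rewrite dW -limg_dim ltn_add2l.
  by rewrite -/(W i.+1) => gW' _ ->; rewrite dW addnS.
have WS i : (i < nullity T)%N -> (W i <= W i.+1)%VS.
  move=> ik; have [gW dW] := WP i (ltnW ik).
  by have [||] := stepP (W i) => //; rewrite dW -limg_dim ltn_add2l.
exists (fun i => [set x | exists2 f, x = Phi f & to_box q f \in W i]); split=> i ik.
  have [[Ws TW] _] := WP i ik.
  have Wid := @stable_ideal _ _ _ q0 _ (isT : 0 < n)%N Ws.
  apply/submoduleP; split; first by exists 0; [rewrite /Phi !raddf0 | exact: Wid.1].
  move=> a _ _ [f -> fW] [g -> gW]; have [c ->] := cls_surj a.
  by exists (c * f + g); [rewrite PhiD PhiM | exact: Wid.2].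
have WSi := WS i ik; split=> [_ [f -> fW]|h].
  by exists f => //; apply: (subvP WSi).
have [[Ws TW] dWi] := WP i (ltnW ik); have [_ dWi1] := WP i.+1 ik.
suff: (W i.+1 <= W i)%VS by move/dimvS; rewrite dWi dWi1 addnS ltnn.
apply/subvP => v vW; have [f vf] := to_box_surj v.
have [|g fg gW] := h (Phi f); first by exists f; rewrite -?vf.
have : Phi (f - g) = 0 by rewrite PhiB fg subrr.
move/Phi_eq0/(subvP TW); rewrite to_boxB -vf => fgW.
by rewrite -(subrK (to_box q g) v) memvD.
Qed.

Theorem module_length_frobenius : module_length M = nullity T.
Proof. exact: chain_length_eq chain_lower chain_upper. Qed.
End LengthOfQuotient.

(** * Chains of primes and integral extensions *)

Lemma prime_idealP (A : comNzRingType) (Q : set A) : prime_ideal A Q <->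
  [/\ Q 0, ~ Q 1, forall a u v, Q u -> Q v -> Q (a * u + v)
    & forall u v, Q (u * v) -> Q u \/ Q v].
Proof.
split=> [[[Q0 Q1 Qcl] Qp]|[Q0 Q1 Qcl Qp]].
  split=> [||a u v Qu Qv|u v Quv]; first exact/set_mem.
  - by move=> Q1'; move/negP: Q1; apply; apply/mem_set.
  - by apply/set_mem/Qcl; apply/mem_set.
  by case/orP: (Qp u v (mem_set Quv)) => /set_mem; [left|right].
split; first split.
- exact/mem_set.
- by apply/negP => /set_mem.
- by move=> a u v /set_mem Qu /set_mem Qv; apply/mem_set/Qcl.
by move=> u v /set_mem /Qp[] Q'; apply/orP; [left|right]; apply/mem_set.
Qed.

Lemma prime_ideal_contraction (A B : comNzRingType) (phi : {rmorphism A -> B}) Q :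
  prime_ideal B Q -> prime_ideal A [set a | Q (phi a)].
Proof.
move=> /prime_idealP[Q0 Q1 Qcl Qp]; apply/prime_idealP; split=> /=.
- by rewrite rmorph0.
- by rewrite rmorph1.
- by move=> a u v Qu Qv; rewrite rmorphD rmorphM; apply: Qcl.
- by move=> u v; rewrite rmorphM; apply: Qp.
Qed.

Section Integrality.
Variables (A B : comNzRingType) (phi : {rmorphism A -> B}).

(** Incomparability: the constant term of an equation of least degree satisfied by
    [g] modulo [Q] separates the contractions of [Q] and [Q']. *)
Lemma integral_incomparable (Q Q' : set B) g (p : {poly A}) :
  prime_ideal B Q -> prime_ideal B Q' -> Q `<=` Q' -> Q' g -> ~ Q g ->
  p \is monic -> Q (map_poly phi p).[g] ->
  exists2 a, Q' (phi a) & ~ Q (phi a).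
Proof.
move=> /prime_idealP[Q0 Q1 Qcl Qp] /prime_idealP[Q'0 Q'1 Q'cl _] QQ' Q'g nQg.
rewrite monicE lead_coefE nth_last => /eqP; rewrite map_polyE horner_Poly.
elim: (p : seq A) => [/= /eqP|c s IH].
  by rewrite eq_sym oner_eq0.
case: s IH => [_ /= ->|c' s IH lst].
  by rewrite mul0r add0r rmorph1 => /Q1.
set v := horner_rec (map phi (c' :: s)) g.
rewrite [map _ _]/= [horner_rec _ _]/= -/v => Qv.
have [Qc|Qc] := pselect (Q (phi c)); last first.
  exists c => //; have := Q'cl (- v) g _ Q'g (QQ' _ Qv).
  by rewrite mulNr addKr.
have : Q (v * g).
  by have := Qcl (-1) _ _ Qc Qv; rewrite mulN1r addrC addrK.
by case/Qp => // Qv'; apply: IH.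
Qed.

(** The equation is the characteristic polynomial of a matrix of the multiplication by [g]
    on the generators: the adjugate shows that its value at [g] times each generator
    lies in [Q], and [1] is one of the generators. *)
Lemma finite_integral (Q : set B) N (e : 'I_N -> B) j0 :
  Q 0 -> (forall a u v, Q u -> Q v -> Q (a * u + v)) -> e j0 = 1 ->
  (forall g, exists c : 'I_N -> A, Q (g - \sum_j phi (c j) * e j)) ->
  forall g, exists2 p : {poly A}, p \is monic & Q (map_poly phi p).[g].
Proof.
move=> Q0 Qcl ej0 gen g.
have /boolp.choice[c cP] := fun i => gen (g * e i).
pose M : 'M[A]_N := \matrix_(i, j) c i j.
exists (char_poly M); first exact: char_poly_monic.
rewrite map_char_poly; set M' := map_mx _ _.
pose X := g%:M - M'; have -> : (char_poly M').[g] = \det X.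
  rewrite /char_poly -[LHS]/(horner_eval g _) -det_map_mx; congr (\det _).
  apply/matrixP => i j; rewrite !mxE /= horner_evalE hornerD hornerN hornerC.
  by rewrite hornerMn hornerX.
pose E : 'cV[B]_N := \col_i e i.
have XE i : Q ((X *m E) i 0).
  have -> : (X *m E) i 0 = g * e i - \sum_j phi (c i j) * e j; last exact: cP.
  rewrite mulmxBl mul_scalar_mx !mxE; congr (_ - _).
  by apply: eq_bigr => j _; rewrite !mxE.
have detE : \sum_i \adj X j0 i * (X *m E) i 0 = \det X.
  have := congr1 (fun Y : 'cV[B]_N => Y j0 0) (mulmxA (\adj X) X E).
  by rewrite mul_adj_mx mul_scalar_mx mxE => ->; rewrite mxE mxE ej0 mulr1.
rewrite -detE; elim/big_ind: _ => // [x y Qx Qy|i _].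
  by rewrite -[x]mul1r; apply: Qcl.
by rewrite -[X in Q X]addr0; apply: Qcl.
Qed.
End Integrality.

(** * Finite generation over power series in parameters *)

Section FiniteGeneration.
Variables (n N : nat) (K : comNzRingType) (y : 'I_n -> mfps N K).
Hypothesis y0 : forall i, mfps_const (y i) = 0.
Local Notation P := (mfps N K).
Variables (J : finType) (e : J -> P) (f : P).
Hypothesis gen : forall g, exists (c : J -> K) (h : P) (r : 'I_n -> P),
  g = \sum_j cst (c j) * e j + f * h + \sum_i y i * r i.

Fixpoint all_words b : seq (seq 'I_n) :=
  if b is b'.+1 then [seq i :: w | w <- all_words b', i <- enum 'I_n] else [:: [::]].

Definition content (w : seq 'I_n) : 'X_{1..n} := (\sum_(i <- w) U_(i))%MM.

Lemma mdeg_content b w : w \in all_words b -> mdeg (content w) = b.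
Proof.
elim: b w => [|b IH] w; first by rewrite inE => /eqP ->; rewrite /content big_nil mdeg0.
case/allpairsP => -[w' i] /= [w'b _ ->].
by rewrite /content big_cons mdegD mdeg1 -/(content w') IH.
Qed.

(** Nakayama's lemma for a complete ring: generation modulo [f] and the [y i] lifts
    to generation modulo [f] over the power series in the [y i]. The expansion is
    obtained by feeding the coefficients of the [y i] back into the hypothesis, and
    its terms are indexed by all_words in the [y i]. *)
Lemma finite_generation g : exists (C : J -> mfps n K) (h : P),
  g = \sum_j subst y (C j) * e j + f * h.
Proof.
have /boolp.choice[c /boolp.choice[h /boolp.choice[r gE]]] := gen.
(* The coefficient of [Y w] in the remainder after [size w] steps. *)
pose fix G (w : seq 'I_n) : P := if w is i :: w' then r (G w') i else g.
pose Y w := ymono y (content w).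
pose t w := \sum_j cst (c (G w) j) * e j + f * h (G w).
have expand b : g = \sum_(a < b) \sum_(w <- all_words a) Y w * t w +
    \sum_(w <- all_words b) Y w * G w.
  elim: b => [|b IH].
    by rewrite big_ord0 add0r big_seq1 /Y /content big_nil ymono0 mul1r.
  rewrite big_ord_recr /= -addrA big_allpairs_dep -big_split /= [LHS]IH.
  congr (_ + _); apply: eq_bigr => w _.
  rewrite [in LHS](gE (G w)) mulrDr; congr (_ + _); rewrite mulr_sumr big_enum /=.
  apply: eq_bigr => i _; rewrite mulrA; congr (_ * _).
  by rewrite /Y /content big_cons ymonoD ymonoU mulrC.
pose C j : mfps n K := fun k =>
  \sum_(w <- all_words (mdeg k) | content w == k) c (G w) j.
pose H : P := fun m => (\sum_(a < (mdeg m).+1) \sum_(w <- all_words a) Y w * h (G w)) m.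
have lowY a w : w \in all_words a -> low a (Y w).
  by move=> wa; rewrite -(mdeg_content wa); apply: low_ymono.
have C_agree b j : agree b (subst y (C j))
    (\sum_(a < b) \sum_(w <- all_words a) cst (c (G w) j) * Y w).
  move=> m mb; rewrite (substE y0 _ mb); congr ((_ : P) m).
  transitivity (\sum_(k : 'X_{1..n < b}) \sum_(a < b)
      \sum_(w <- all_words a | content w == k) cst (c (G w) j) * Y w : P).
    apply: eq_bigr => k _; rewrite (bigD1 (Ordinal (bmdeg k))) //= [X in _ = _ + X]big1 ?addr0.
      rewrite /= rmorph_sum mulr_suml; apply: eq_bigr => w /eqP wk.
      by rewrite /Y wk.
    move=> a ak; rewrite big_seq_cond big1 // => w /andP[wa /eqP wk].
    by case/eqP: ak; apply: val_inj; rewrite /= -wk (mdeg_content wa).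
  rewrite exchange_big; apply: eq_bigr => a _ /=.
  rewrite [LHS](exchange_big_dep xpredT) //= big_seq [in RHS]big_seq.
  apply: eq_bigr => w wa.
  have wb : (mdeg (content w) < b)%N by rewrite (mdeg_content wa).
  by rewrite (big_pred1 (BMultinom wb)).
have H_agree b : agree b H (\sum_(a < b) \sum_(w <- all_words a) Y w * h (G w)).
  move=> m mb; rewrite /H -(subnKC mb) (@big_split_ord _ _ _ (mdeg m).+1 (b - (mdeg m).+1)) /= mfpsDE.
  rewrite [X in _ + X](_ : _ = 0) ?addr0 // mfps_sumE big1 // => a _.
  rewrite mfps_sumE big_seq big1 // => w wa.
  have lw := lowY ((mdeg m).+1 + a)%N w wa; rewrite mulrC; apply: (low_mull (b := (mdeg m).+1)) => //.
  by apply: lowW lw; rewrite leq_addr.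
exists C, H; apply: mfpsP => m; pose b := (mdeg m).+1.
rewrite [LHS](congr1 (fun x : P => x m) (expand b)) mfpsDE.
rewrite [X in _ + X](_ : _ = 0); last first.
  rewrite mfps_sumE big_seq big1 // => w wb.
  by rewrite mulrC; apply: (low_mull (b := b)) => //; apply: lowY.
have -> : (\sum_j subst y (C j) * e j + f * H) m =
    (\sum_j (\sum_(a < b) \sum_(w <- all_words a) cst (c (G w) j) * Y w) * e j
     + f * (\sum_(a < b) \sum_(w <- all_words a) Y w * h (G w))) m.
  rewrite !mfpsDE; congr (_ + _); last exact: (agreeM (b := b) _ (H_agree b)).
  rewrite !mfps_sumE; apply: eq_bigr => j _.
  by apply: (agreeM (b := b) (C_agree b j)).
rewrite addr0; congr ((_ : P) m).
rewrite (eq_bigr (fun a : 'I_b => \sum_(w <- all_words a) (\sum_j cst (c (G w) j) * Y w * e j)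
   + f * \sum_(w <- all_words a) Y w * h (G w))) => [|a _]; last first.
  rewrite mulr_sumr -big_split /=; apply: eq_bigr => w _.
  rewrite /t mulrDr [Y w * (f * _)]mulrCA; congr (_ + _).
  by rewrite mulr_sumr; apply: eq_bigr => j _; rewrite mulrA [Y w * _]mulrC.
rewrite big_split /= -mulr_sumr; congr (_ + _).
rewrite [RHS](eq_bigr (fun j => \sum_(a < b) \sum_(w <- all_words a) cst (c (G w) j) * Y w * e j)).
  by rewrite [RHS]exchange_big; apply: eq_bigr => a _; rewrite [LHS]exchange_big.
by move=> j _; rewrite mulr_suml; apply: eq_bigr => a _; rewrite mulr_suml.
Qed.
End FiniteGeneration.

(** * Weights and systems of parameters *)

(** The exponents are minimized one after the other, from the first variable on. *)
Lemma ex_lexmin N (S : 'X_{1..N} -> Prop) : (exists k, S k) ->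
  exists2 k0, S k0 & forall k, S k -> k != k0 ->
    exists i : 'I_N, (forall j : 'I_N, (j < i)%N -> k j = k0 j) /\ (k0 i < k i)%N.
Proof.
move=> S0.
have H t : (t <= N)%N -> exists2 k0, S k0 & forall k, S k ->
    (forall j : 'I_N, (j < t)%N -> k j = k0 j) \/
    exists i : 'I_N, (forall j : 'I_N, (j < i)%N -> k j = k0 j) /\ (k0 i < k i)%N.
  elim: t => [_|t IH tN]; first by have [k Sk] := S0; exists k => // k' _; left.
  have [k0 Sk0 k0min] := IH (ltnW tN); pose i := Ordinal tN.
  pose Q v := `[< exists k, [/\ S k, forall j : 'I_N, (j < t)%N -> k j = k0 j & k i = v] >].
  have exQ : exists v, Q v by exists (k0 i); apply/asboolP; exists k0.
  case: (ex_minnP exQ) => v /asboolP[k1 [Sk1 k1k0 k1v]] vmin; exists k1 => // k Sk.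
  have [kk0|[i' [kk0 lt]]] := k0min k Sk; last first.
    have [it|it] := ltnP i' t.
      right; exists i'; rewrite k1k0 //; split=> // j ji.
      by rewrite kk0 // k1k0 // (ltn_trans ji).
    have kE (j : 'I_N) : (j < t)%N -> k j = k0 j by move=> jt; apply: kk0; apply: leq_trans it.
    have : (v <= k i)%N by apply: vmin; apply/asboolP; exists k.
    rewrite leq_eqVlt => /predU1P[vk|vk]; [left|right; exists i].
      move=> j; rewrite ltnS leq_eqVlt => /predU1P[jt|jt]; last by rewrite kE ?k1k0.
      by have -> : j = i; [apply: val_inj | rewrite k1v].
    by rewrite k1v; split=> // j jt; rewrite kE ?k1k0.
  have : (v <= k i)%N by apply: vmin; apply/asboolP; exists k.
  rewrite leq_eqVlt => /predU1P[vk|vk]; [left|right; exists i].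
    move=> j; rewrite ltnS leq_eqVlt => /predU1P[jt|jt]; last by rewrite kk0 ?k1k0.
    by have -> : j = i; [apply: val_inj | rewrite k1v].
  by rewrite k1v; split=> // j jt; rewrite kk0 ?k1k0.
have [k0 Sk0 k0min] := H N (leqnn N); exists k0 => // k /k0min[kk0|//] /eqP[].
by apply/mnmP => j; apply: kk0.
Qed.

Definition wdeg N (w : 'I_N -> nat) (k : 'X_{1..N}) := (\sum_i k i * w i)%N.

(** Weights in geometric progression turn the lexicographically least exponent into
    the one of least weight. *)
Lemma ex_weights n (S : 'X_{1..n.+1} -> Prop) : (exists k, S k) ->
  exists w : 'I_n.+1 -> nat, [/\ w ord_max = 1%N, forall i, (0 < w i)%N &
    exists2 k0, S k0 & forall k, S k -> k != k0 -> (wdeg w k0 < wdeg w k)%N].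
Proof.
move=> /ex_lexmin[k0 Sk0 k0min]; pose b := (mdeg k0).+1.
pose w (i : 'I_n.+1) := (b ^ (n - i))%N; exists w; split.
- by rewrite /w subnn.
- by move=> i; rewrite expn_gt0.
exists k0 => // k Sk kk0; have [i [ki lti]] := k0min k Sk kk0.
pose lo := (\sum_(j < n.+1 | (j < i)%N) k0 j * w j)%N.
have kge : (lo + (k0 i).+1 * w i <= wdeg w k)%N.
  rewrite /wdeg (bigID (fun j : 'I_n.+1 => (j < i)%N)) /=.
  rewrite (eq_bigr (fun j => k0 j * w j)%N) => [|j /ki -> //].
  rewrite leq_add2l (bigD1 i) /= ?ltnn //.
  by apply: leq_trans (leq_addr _ _); rewrite leq_mul2r lti orbT.
apply: leq_trans kge; rewrite /wdeg (bigID (fun j : 'I_n.+1 => (j < i)%N)) /=.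
rewrite -addnS leq_add2l (bigD1 i) /= ?ltnn // mulSn addnC ltn_add2r.
have [im|im] := ltnP i n; last first.
  rewrite big1 ?expn_gt0 // => j /andP[ji nij].
  by case/eqP: nij; apply: val_inj; have := ltn_ord j; rewrite /=; lia.
apply: (@leq_ltn_trans (\sum_(j < n.+1) k0 j * b ^ (n - i).-1)).
  rewrite big_mkcond; apply: leq_sum => j _; case: ifP => // /andP[ji nij].
  rewrite leq_mul2l; apply/orP; right; rewrite leq_pexp2l //.
  suff: (i < j)%N by lia.
  by rewrite ltn_neqAle leqNgt ji andbT; apply: contra nij => /eqP ij; apply/eqP/val_inj.
rewrite -big_distrl -mdegE /= /w -[X in (_ < b ^ X)%N](@prednK (n - i)) ?subn_gt0 //.
by rewrite expnS ltn_mul2r expn_gt0 ltnSn.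
Qed.

Section ParameterSystem.
Variables (n : nat) (K : fieldType) (f : mfps n.+1 K) (f_neq0 : f != 0).
Local Notation P := (mfps n.+1 K).
Let z : P := mfpsX K ord_max.
Let wid : 'I_n -> 'I_n.+1 := widen_ord (leqnSn n).

(** Modulo [f] and the [x_i - z^(w_i)], with [z] the last variable, the monomials
    become powers of [z], and [f] itself a power of [z] times a unit: nothing is
    left but finitely many monomials. *)
Lemma ex_parameters : exists y : 'I_n -> P, (forall i, mfps_const (y i) = 0) /\
  exists s, forall g : P, exists (c : 'X_{1..n.+1 < s.+1} -> K) (h : P) (r : 'I_n -> P),
    g = \sum_k cst (c k) * mono K k + f * h + \sum_i y i * r i.
Proof.
have [|w [wmax w0 [k0 fk0 k0min]]] := @ex_weights n (fun k => f k != 0).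
  apply: contrapT => h; move/eqP: f_neq0; apply; apply: mfpsP => m.
  by apply/eqP/negPn/negP => fm; apply: h; exists m.
pose y i : P := mfpsX K (wid i) - z ^+ w (wid i); exists y; split.
  move=> i; rewrite /y mfps_constD -(prednK (w0 _)) mfps_constX.
  by rewrite -[mfps_const (- _)]/(- mfps_const _) mfps_constXn subr0.
pose s := wdeg w k0; exists s.
pose I (g : P) := exists h r, g = f * h + \sum_i y i * r i.
have Iid : is_ideal I.
  split=> [|a _ _ [h [r ->]] [h' [r' ->]]].
    by exists 0, (fun=> 0); rewrite mulr0 big1 ?addr0 // => i _; rewrite mulr0.
  exists (a * h + h'), (fun i => a * r i + r' i).
  have -> : \sum_i y i * (a * r i + r' i) = a * (\sum_i y i * r i) + \sum_i y i * r' i.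
    rewrite mulr_sumr -big_split /=.
    by apply: eq_bigr => i _; rewrite mulrDr mulrCA.
  by rewrite !mulrDr [f * (a * h)]mulrCA addrACA.
have If : I f.
  by exists 1, (fun=> 0); rewrite mulr1 big1 ?addr0 // => i _; rewrite mulr0.
pose R u v := I (u - v).
have RM u v u' v' : R u v -> R u' v' -> R (u * u') (v * v').
  move=> uv uv'; rewrite /R; have -> : u * u' - v * v' = u * (u' - v') + v' * (u - v).
    by rewrite !mulrBr addrA [v' * u]mulrC subrK [v' * v]mulrC.
  by apply: (ideal_add Iid); apply: ideal_mul.
have Rxx u : R u u by rewrite /R subrr; exact: Iid.1.
have RX i : R (mfpsX K i) (z ^+ w i).
  have [iM|iM] := ltnP i n; last first.
    have -> : i = ord_max by apply: val_inj; have := ltn_ord i; rewrite /=; lia.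
    by rewrite wmax expr1.
  have -> : i = wid (Ordinal iM) by apply: val_inj.
  exists 0, (fun j => if j == Ordinal iM then 1 else 0).
  rewrite mulr0 add0r (bigD1 (Ordinal iM)) //= eqxx mulr1 big1 ?addr0 // => j /negPf ->.
  by rewrite mulr0.
have Rmono k : R (mono K k) (z ^+ wdeg w k).
  rewrite mono_prod /wdeg; elim/big_rec2: _ => [|i W u _ Ru]; first exact: Rxx.
  rewrite exprD; apply: (RM) => //; rewrite mulnC exprM.
  elim: (k i : nat) => [|j IH]; first by rewrite !expr0.
  by rewrite !exprS; apply: (RM _ _ _ _ (RX i) IH).
have wdeg_ge k : (mdeg k <= wdeg w k)%N.
  by rewrite mdegE; apply: leq_sum => i _; rewrite leq_pmulr.
have Ilow b : I (z ^+ b) -> forall g, low b g -> I g.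
  move=> Izb g; apply: ideal_low => // k kb.
  rewrite -(subrK (z ^+ wdeg w k) (mono K k)); apply: (ideal_add Iid); first exact: Rmono.
  by rewrite -(subnK (wdeg_ge k)) kb exprD; apply: ideal_mul.
have Izs : I (z ^+ s).
  pose I1 g := exists u, I (g - z ^+ s.+1 * u).
  have I1id : is_ideal I1.
    split=> [|a u v [u' uu] [v' vv]]; first by exists 0; rewrite mulr0 subrr; exact: Iid.1.
    exists (a * u' + v').
    have -> : a * u + v - z ^+ s.+1 * (a * u' + v') =
        a * (u - z ^+ s.+1 * u') + (v - z ^+ s.+1 * v').
      by rewrite mulrDr opprD mulrBr addrACA mulrCA.
    exact: Iid.2.
  have I1mono k : (s < wdeg w k)%N -> I1 (mono K k).
    by move=> sk; exists (z ^+ (wdeg w k - s.+1)); rewrite -exprD subnKC //; apply: Rmono.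
  have [u Iu] : I1 (f - cst (f k0) * mono K k0).
    have -> : f - cst (f k0) * mono K k0 = (f - poly_fps (trunc s.+1 f)) +
       (poly_fps (trunc s.+1 f) - cst (f k0) * mono K k0) by rewrite addrA subrK.
    apply: (ideal_add I1id).
      apply: (ideal_low I1id) (@low_sub_trunc _ _ s.+1 f) => k ks; apply: I1mono.
      by rewrite -ks.
    have k0s : (mdeg k0 < s.+1)%N by rewrite ltnS.
    rewrite trunc_fpsE (bigD1 (BMultinom k0s)) //= addrAC subrr add0r.
    apply: (@ideal_sum _ _ I1) => // k kk0.
    have [fk|fk] := eqVneq (f k) 0; first by rewrite fk rmorph0 mul0r; exact: I1id.1.
    by apply: (ideal_mul _ I1id); apply/I1mono/k0min.
  have [v uv] : exists v, (cst (f k0) + z * u) * v = 1.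
    apply: mfps_unit; rewrite mfps_constD mfps_constM mfps_constX mul0r addr0.
    by rewrite -[cst _]mulr1 /mfps_const cst_mulE -[(1 : P) _]/((_ == _)%:R) eqxx mulr1.
  rewrite -[z ^+ s]mulr1 -uv mulrA mulrC; apply: (ideal_mul _ Iid).
  have -> : z ^+ s * (cst (f k0) + z * u) =
      (-1) * (cst (f k0) * (mono K k0 - z ^+ s)) +
      (f + (-1) * (f - cst (f k0) * mono K k0 - z ^+ s.+1 * u)).
    have zmodE (X Y A2 : P) : X + Y = - (A2 - X) + (f - (f - A2 - Y)).
      by rewrite !opprB [f + _]addrC -[Y + _ + f]addrA subrK [Y + A2]addrC addrA subrK.
    rewrite !mulN1r mulrDr [cst _ * (_ - _)]mulrBr [z ^+ s * cst _]mulrC mulrA -exprSr.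
    exact: zmodE.
  apply: (ideal_add Iid); first by do 2!apply: (ideal_mul _ Iid); apply: Rmono.
  by apply: (ideal_add Iid) => //; apply: (ideal_mul _ Iid).
move=> g; have [h [r gE]] : I (g - poly_fps (trunc s.+1 g)).
  by apply: (Ilow s.+1) (@low_sub_trunc _ _ s.+1 g); rewrite exprS; apply: (ideal_mul _ Iid).
exists (fun k => g k), h, r.
by rewrite -addrA -gE -trunc_fpsE addrC subrK.
Qed.
End ParameterSystem.

(** * Upper bound for the dimension *)

Lemma ex_subst_morphism n n' (K : comNzRingType) (y : 'I_n -> mfps n' K) :
  (forall i, mfps_const (y i) = 0) ->
  exists phi : {rmorphism mfps n K -> mfps n' K}, forall f, phi f = subst y f.
Proof.
move=> y0; pose Ma := GRing.isAdditive.Build _ _ _ (subst_is_additive y).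
pose Mm := GRing.isMultiplicative.Build _ _ _ (subst_is_multiplicative y0).
pose phi : {rmorphism mfps n K -> mfps n' K} := HB.pack (subst y) Ma Mm.
by exists phi.
Qed.

Section UpperBound.
Variable K : fieldType.

Lemma zero_ideal_prime n : prime_ideal (mfps n K) [set 0].
Proof.
apply/prime_idealP; split=> //=.
- by move/eqP; rewrite oner_eq0.
- by move=> a u v -> ->; rewrite mulr0 addr0.
exact: mfps_mulf_eq0.
Qed.

Lemma prime_const0 n (Q : set (mfps n K)) f : prime_ideal _ Q -> Q f -> mfps_const f = 0.
Proof.
move=> /prime_idealP[Q0 Q1 Qcl _] Qf; apply/eqP/negPn/negP => fu; apply: Q1.
exact: (@ideal_unit _ _ Q f).
Qed.

Lemma chain_proper_ex (T : Type) (Q Q' : set T) : Q `<` Q' -> exists x, Q' x /\ ~ Q x.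
Proof.
move=> [_ nQ]; apply: contrapT => h; apply: nQ => x Q'x.
by apply: contrapT => nQx; apply: h; exists x.
Qed.

(** A chain of primes loses one step when its first prime is dropped, and none when
    the rest is contracted to a power series ring in one variable less over which
    the quotient is finite. *)
Lemma mfps_prime_chain n l : has_chain (prime_ideal (mfps n K)) l -> (l <= n)%N.
Proof.
elim: n l => [|n IH] [//|l] [C [Cprime Cprop]]; have [f [Cf nCf]] := chain_proper_ex (Cprop 0%N isT).
  have /prime_idealP[C00 _ _ _] := Cprime 0%N isT.
  exfalso; apply: nCf; suff -> : f = 0 by [].
  apply: mfpsP => m; rewrite (_ : m = 0%MM); last by apply/mnmP => -[].
  exact: (prime_const0 (Cprime 1%N isT) Cf).
have f_neq0 : f != 0.
  apply/eqP => f00; apply: nCf; rewrite f00.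
  by have /prime_idealP[] := Cprime 0%N isT.
have [y [y0 [s gen]]] := ex_parameters f_neq0.
have [phi phiE] := ex_subst_morphism y0.
have Cmem i : (i <= l)%N -> C i.+1 f.
  elim: i => [//|i IHi] il; have [Cle _] := Cprop i.+1 il.
  by apply/Cle/IHi/ltnW.
rewrite ltnS; apply: IH; exists (fun i => [set a | C i.+1 (phi a)]); split=> i il.
  exact/prime_ideal_contraction/Cprime.
have [Cle Cne] := Cprop i.+1 il; split=> [a|]; first exact: Cle.
have [g [Cg nCg]] := chain_proper_ex (Cprop i.+1 il).
have CiP : prime_ideal _ (C i.+1) by apply: Cprime; apply: ltnW.
have /prime_idealP[Q0 Q1 Qcl Qp] := CiP.
have Cif : C i.+1 f by apply/Cmem/ltnW.
have [p pmon pQ] : exists2 p : {poly mfps n K}, p \is monic & C i.+1 (map_poly phi p).[g].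
  have b0 : (mdeg (0%MM : 'X_{1..n.+1}) < s.+1)%N by rewrite mdeg0.
  pose J : finType := 'X_{1..n.+1 < s.+1}.
  have FI := @finite_integral _ _ phi (C i.+1) #|{: J}| (fun j => mono K (enum_val j : J))
    (enum_rank (BMultinom b0 : J)) Q0 Qcl.
  apply: (FI); first by rewrite enum_rankK mono0.
  move=> g'; have [c [h gE]] := finite_generation y0 (e := fun k : J => mono K k) gen g'.
  exists (fun j => c (enum_val j)).
  rewrite [X in _ - X](_ : _ = \sum_j subst y (c j) * mono K j); last first.
    rewrite [RHS](reindex (fun j : 'I_#|{: J}| => enum_val j)) /=; last by apply: onW_bij; exact: enum_val_bij.
    by apply: eq_bigr => j _; rewrite phiE.
  rewrite {1}gE addrC addKr mulrC -[_ * f]addr0; exact: Qcl.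
have [a Ca nCa] := integral_incomparable CiP (Cprime i.+2 il) Cle Cg nCg pmon pQ.
by move=> /(_ a Ca).
Qed.

(** The pulled back chain can be extended by the zero ideal, which does not contain [F]. *)
Lemma hypersurface_prime_chain n (F : mfps n K) (F0 : mfps_const F = 0) l :
  F != 0 -> has_chain (prime_ideal (hypersurface F0)) l -> (l < n)%N.
Proof.
move=> Fn0 [C [Cprime Cprop]]; apply: mfps_prime_chain.
exists (fun i => if i is i'.+1 then [set f | C i' (cls F0 f)] else [set 0]).
split=> [[|i] il|[|i] il] //; first exact: zero_ideal_prime.
- exact/prime_ideal_contraction/Cprime.
- have /prime_idealP[Q0 _ _ _] := Cprime 0%N isT; split=> [_ ->|h].
    by rewrite /= rmorph0.
  have /h/eqP : C 0%N (cls F0 F) by rewrite (_ : cls F0 F = 0) //; apply/cls_eq0; exists 1; rewrite mulr1.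
  by apply/negP.
have [Cle Cne] := Cprop i il; split=> [f|h]; first exact: Cle.
apply: Cne => a; have [f ->] := cls_surj a; exact: h.
Qed.
End UpperBound.

(** * Lower bound for the dimension *)

Section LowerBound.
Variables (K : fieldType) (d' : nat).
Let d := d'.+1.
Local Notation P := (mfps d.+1 K).
Local Notation P' := (mfps d K).

Let X' k : P' := mfpsX K (inord k).

Lemma mfpsX_neq0 n (i : 'I_n) : mfpsX K i != 0.
Proof.
by apply/eqP => /(congr1 (fun f : mfps n K => f U_(i)%MM)) /eqP; rewrite /mfpsX eqxx oner_eq0.
Qed.

(** Restriction to the hyperplanes [X_t = ... = X_(d-1) = 0]. *)
Definition restr (t : nat) (i : 'I_d) : P' := if (i < t)%N then mfpsX K i else 0.

Lemma restr_const0 t i : mfps_const (restr t i) = 0.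
Proof. by rewrite /restr; case: ifP => _ //; rewrite mfps_constX. Qed.

Lemma subst_restrE t g m :
  subst (restr t) g m = if [forall i : 'I_d, (t <= i)%N ==> (m i == 0)%N] then g m else 0.
Proof.
pose supp (k : 'X_{1..d}) := [forall i : 'I_d, (t <= i)%N ==> (k i == 0)%N].
have yE k : ymono (restr t) k = if supp k then mono K k else 0.
  case: ifP => [/forallP ks|/negbT].
    rewrite mono_prod /ymono /mmap1; apply: eq_bigr => i _; rewrite /restr.
    case: ltnP => // it; have := ks i; rewrite it => /eqP ->.
    by rewrite !expr0.
  rewrite negb_forall => /fintype.existsP[i]; rewrite negb_imply => /andP[it ki].
  rewrite /ymono /mmap1 (bigD1 i) //= /restr ltnNge it /= expr0n.
  by rewrite (negPf ki) mul0r.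
rewrite (substE (@restr_const0 t) _ (ltnSn _)) mfps_sumE.
rewrite (bigD1 (BMultinom (ltnSn (mdeg m)))) //= big1 ?addr0 => [|k km].
  rewrite cst_mulE yE /supp; case: ifP => _; last by rewrite mulr0.
  by rewrite monoE eqxx mulr1.
rewrite cst_mulE yE; case: ifP => _; last by rewrite mulr0.
rewrite monoE; case: eqP => [kE|_]; last by rewrite mulr0.
by case/eqP: km; apply: val_inj.
Qed.

Lemma subst_restr_ker t g : subst (restr t.+1) g = 0 -> subst (restr t) g = 0.
Proof.
move=> g0; apply: mfpsP => m; rewrite subst_restrE; case: ifP => // /forallP mt.
have := congr1 (fun f : P' => f m) g0; rewrite /= subst_restrE ifT //.
by apply/forallP => i; apply/implyP => ti; have := mt i; rewrite (ltnW ti).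
Qed.

Variable s' : seq (seq nat).
Hypothesis s'_vars :
  all (fun w => (w != [::]) && all (fun k => 2 <= k <= d)%N w) s'.
Let s : seq (seq nat) := [:: 0%N; 1%N] :: s'.
Let F : P := fps_of_words K s.
Hypothesis F0 : mfps_const F = 0.

(* The blow-up chart [x_1 = X_0], [x_k = X_0 X_(k-1)], in which the equation
   determines [x_0]. *)
Let chart1 (k : nat) : P' := if k == 1%N then X' 0 else X' 0 * X' k.-1.
Let chart (k : nat) : P' :=
  if k == 0%N then - \sum_(w <- s') X' (head 0%N w).-1 * \prod_(l <- behead w) chart1 l
  else chart1 k.

Let chart1_const0 k : mfps_const (chart1 k) = 0.
Proof. by rewrite /chart1; case: ifP => _; rewrite ?mfps_constM mfps_constX ?mul0r. Qed.

Let chart_const0 (i : 'I_d.+1) : mfps_const (chart i) = 0.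
Proof.
rewrite /chart; case: ifP => _; last exact: chart1_const0.
rewrite -[LHS]/(- mfps_const _); elim: (s') => [|w r IH]; first by rewrite big_nil oppr0.
by rewrite big_cons mfps_constD mfps_constM mfps_constX mul0r add0r.
Qed.

(** The equation [x_0 x_1 + G] is sent to zero because [x_0] is sent to [- G / x_1], where
    the division by [x_1 = X_0] is exact in the chart. *)
Let ex_chart : exists phi : {rmorphism P -> P'},
  phi F = 0 /\ forall k, (0 < k <= d)%N -> phi (mfpsX K (inord k)) = chart1 k.
Proof.
have [phi phiE] := ex_subst_morphism (y := fun i : 'I_d.+1 => chart i) chart_const0.
have phiX k : (k <= d)%N -> phi (mfpsX K (inord k)) = chart k.
  by move=> kd; rewrite phiE substX ?inordK.
exists phi; split=> [|k /andP[k0 kd]]; last by rewrite phiX // /chart gtn_eqF.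
rewrite /F /fps_of_words /s big_cons rmorphD /= !big_cons big_nil mulr1 rmorphM.
rewrite !phiX // rmorph_sum /chart /= /chart1 /= mulNr.
apply/eqP; rewrite addrC subr_eq0; apply/eqP; rewrite mulr_suml big_seq [RHS]big_seq.
apply: eq_bigr => w /(allP s'_vars) /andP[]; case: w => //= k w _ /andP[/andP[k2 kd] wd].
rewrite big_cons rmorphM phiX // /chart /= gtn_eqF ?(ltnW k2) //.
have -> : phi (\prod_(j <- w) mfpsX K (inord j)) = \prod_(j <- w) chart1 j.
  rewrite rmorph_prod big_seq [RHS]big_seq; apply: eq_bigr => l /(allP wd)/andP[l2 ld].
  by rewrite phiX // /chart gtn_eqF // ltnW.
by rewrite {1}/chart1 gtn_eqF // -mulrA mulrC.
Qed.

(** The substitution [x_2 = ... = x_d = 0] sends the equation to [x_0 x_1]. *)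
Lemma fps_of_words_neq0 : F != 0.
Proof.
have y0 (i : 'I_d.+1) : mfps_const (if (i < 2)%N then mfpsX K i else 0 : P) = 0.
  by case: ifP => _ //; rewrite mfps_constX.
have [phi phiE] := ex_subst_morphism y0; apply/eqP => F00.
have : phi F = mfpsX K (inord 0) * mfpsX K (inord 1).
  rewrite /F /fps_of_words /s big_cons rmorphD /= !big_cons big_nil mulr1 rmorphM.
  have phiX k : (k <= d)%N ->
      phi (mfpsX K (inord k)) = if (k < 2)%N then mfpsX K (inord k) else 0.
    by move=> kd; rewrite phiE substX // inordK.
  rewrite !phiX //= [X in _ + X](_ : _ = 0) ?addr0 //.
  rewrite rmorph_sum big_seq big1 // => w /(allP s'_vars) /andP[].
  case: w => //= k w _ /andP[/andP[k2 kd] _].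
  by rewrite big_cons rmorphM phiX // ltnNge k2 /= mul0r.
rewrite F00 rmorph0 => /esym/mfps_mulf_eq0[] /eqP; apply/negP; exact: mfpsX_neq0.
Qed.

(** The linear sections of the chart pull back to a chain of [d + 1] primes. *)
Lemma hypersurface_has_chain : has_chain (prime_ideal (hypersurface F0)) d.
Proof.
have [phi [phiF phiX]] := ex_chart.
have R0 t := ex_subst_morphism (@restr_const0 t).
pose Q i : set (hypersurface F0) :=
  [set a | exists2 f, a = cls F0 f & subst (restr (d - i)) (phi f) = 0].
have QE i f : Q i (cls F0 f) <-> subst (restr (d - i)) (phi f) = 0.
  split=> [[g /cls_eq[h fgh] g0]|f0]; last by exists f.
  have [psi psiE] := R0 (d - i)%N.
  by rewrite -(subrK g f) fgh -psiE !rmorphD !rmorphM phiF rmorph0 mul0r add0r psiE.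
exists Q; split=> i il.
  have [psi psiE] := R0 (d - i)%N.
  have := prime_ideal_contraction (psi \o phi) (@zero_ideal_prime K d).
  move=> /prime_idealP[Z0 Z1 Zcl Zp]; apply/prime_idealP; split.
  - by rewrite -(rmorph0 (cls F0)); apply/QE; rewrite -psiE; apply: Z0.
  - by rewrite -(rmorph1 (cls F0)) => /QE; rewrite -psiE; apply: Z1.
  - move=> a u v; have [f ->] := cls_surj a; have [g ->] := cls_surj u.
    have [h ->] := cls_surj v; rewrite -rmorphM -rmorphD => /QE + /QE + .
    by rewrite -!psiE => g0 h0; apply/QE; rewrite -psiE; apply: Zcl.
  move=> u v; have [g ->] := cls_surj u; have [h ->] := cls_surj v.
  rewrite -rmorphM => /QE; rewrite -psiE => /Zp[] h0; [left|right]; apply/QE;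
    by rewrite -psiE.
split=> [a|h].
  have [f ->] := cls_surj a; move=> /QE f0; apply/QE; apply: subst_restr_ker.
  by rewrite subnSK.
pose t := (d - i.+1)%N; have tE : (d - i)%N = t.+1 by rewrite /t subnSK.
have td : (t < d)%N by rewrite /t; lia.
have [psi psiE] := R0 t.+1; have [psi' psi'E] := R0 t.
pose x : P := mfpsX K (inord t.+1).
have phix : phi x = if t == 0%N then X' 0 else X' 0 * X' t.
  by rewrite /x phiX // /chart1 eqSS; case: eqP.
have rX m k : (k < d)%N -> subst (restr m) (X' k) = if (k < m)%N then X' k else 0.
  by move=> kd; rewrite (substX (@restr_const0 m)) /restr inordK.
have : Q i (cls F0 x).
  apply: h; apply/QE; rewrite -/t phix -psi'E; case: eqP => [t0|_].
    by rewrite psi'E rX // t0.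
  by rewrite rmorphM !psi'E (rX t t) // ltnn mulr0.
move/QE; rewrite tE phix -psiE; case: eqP => [t0|_].
  by rewrite psiE rX // ltnS leq0n; apply/eqP/mfpsX_neq0.
rewrite rmorphM !psiE !rX // !ltnS leqnn leq0n.
by move/mfps_mulf_eq0 => [] /eqP; apply/negP/mfpsX_neq0.
Qed.

Theorem krull_dim_hypersurface : krull_dim (hypersurface F0) = d.
Proof.
apply: chain_length_eq; first exact: hypersurface_has_chain.
by move=> k /(hypersurface_prime_chain fps_of_words_neq0).
Qed.
End LowerBound.

(** * The Hilbert-Kunz multiplicities *)

Lemma fps_of_hyperbolic n (K : fieldType) a :
  fps_of_words K (hyperbolic a) =
  \sum_(i < a) mfpsX K (inord i.*2) * mfpsX K (inord i.*2.+1) :> mfps n.+1 K.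
Proof.
rewrite /fps_of_words /hyperbolic big_map.
rewrite -(big_mkord xpredT (fun i => mfpsX K (inord i.*2) * mfpsX K (inord i.*2.+1))).
rewrite /index_iota subn0; apply: eq_bigr => i _.
by rewrite !big_cons big_nil mulr1.
Qed.

Lemma fps_of_words_cat n (K : fieldType) s1 s2 :
  fps_of_words K (s1 ++ s2) = fps_of_words K s1 + fps_of_words K s2 :> mfps n.+1 K.
Proof. by rewrite /fps_of_words big_cat. Qed.

Lemma Q_E d : @Q_ d = fps_of_words 'F_3 (R_words d).
Proof.
rewrite /Q_ /R_words; case: odd; first by rewrite fps_of_hyperbolic.
rewrite fps_of_words_cat fps_of_hyperbolic; congr (_ + _).
by rewrite /fps_of_words big_seq1 !big_cons big_nil mulr1.
Qed.

Lemma P_E d : @P_ d = fps_of_words 'F_3 (S_words d).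
Proof.
rewrite /P_ /S_words; case: odd; rewrite fps_of_words_cat fps_of_hyperbolic.
  by rewrite -addrA; congr (_ + _);
    rewrite /fps_of_words !big_cons !big_nil !mulr1 addr0.
by congr (_ + _); rewrite /fps_of_words big_seq1 !big_cons big_nil mulr1.
Qed.

(** The equation is [x_0 x_1] plus monomials in the other variables. *)
Definition chartable d (s : seq (seq nat)) := exists s',
  s = [:: 0%N; 1%N] :: s' /\
  all (fun w => (w != [::]) && all (fun k => 2 <= k <= d)%N w) s'.

Lemma hyperbolic_chartable a s d : (0 < a)%N -> (a.*2 <= d.+1)%N ->
  all (fun w => (w != [::]) && all (fun k => 2 <= k <= d)%N w) s ->
  chartable d (hyperbolic a ++ s).
Proof.
case: a => // a _ ad sd; exists ([seq [:: i.*2; i.*2.+1] | i <- iota 1 a] ++ s).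
split=> //; rewrite all_cat sd andbT all_map; apply/allP => i; rewrite mem_iota /=.
by lia.
Qed.

Lemma R_words_chartable d : (2 <= d)%N -> chartable d (R_words d).
Proof.
move=> d2; rewrite /R_words; case od: (odd d).
  by rewrite -[hyperbolic _]cats0; apply: hyperbolic_chartable => //; lia.
by apply: hyperbolic_chartable; rewrite /= ?d2 ?leqnn //; lia.
Qed.

Lemma S_words_chartable d : (2 <= d)%N -> chartable d (S_words d).
Proof.
move=> d2; rewrite /S_words; case od: (odd d); apply: hyperbolic_chartable;
  rewrite /= ?d2 ?leqnn ?leq_pred //=; lia.
Qed.

Section HilbertKunz.
Variables (R : realType) (d : nat) (s : seq (seq nat)).
Hypotheses (d2 : (2 <= d)%N) (s_below : words_below d.+1 s) (s_chart : chartable d s).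

Let K3 : 3%:R = 0 :> 'F_3. Proof. exact/val_inj. Qed.

Definition hk_ratio (e : nat) : R :=
  (nullity (poly_op 'F_3 (3 ^ e) d.+1 s))%:R / (3 ^ (e * d))%:R.

Lemma eHK_hypersurface (F : mfps d.+1 'F_3) (F0 : mfps_const F = 0) :
  F = fps_of_words 'F_3 s -> eHK R 3 (hypersurface F0) = limn hk_ratio.
Proof.
move=> FE; move: F0; rewrite FE => F0; rewrite /eHK; congr (limn _).
apply/funext => e; rewrite /hk_ratio /HK (module_length_frobenius s_below F0 K3 erefl).
congr (_ / (3 ^ (e * _))%:R); move: F0; have [s' [-> s'd]] := s_chart => F0.
case: d s'd F0 d2 => // d' s'd F0 _.
exact: (krull_dim_hypersurface s'd).
Qed.

Lemma hk_ratio_nondecreasing : nondecreasing_seq hk_ratio.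
Proof.
apply/nondecreasing_seqP => e; rewrite /hk_ratio ler_pdivrMr ?ltr0n ?expn_gt0 //.
rewrite mulrAC ler_pdivlMr ?ltr0n ?expn_gt0 // -!natrM ler_nat.
have := nullity_frobenius K3 (3 ^ e) s_below; rewrite -expnS expnS -mulnA leq_pmul2l //.
move=> h; rewrite mulSn expnD mulnA mulnC mulnA [(_ * (3 ^ (e * d)))%N]mulnC.
by rewrite -mulnA leq_mul2l [(_ * 3 ^ d)%N]mulnC h orbT.
Qed.

Lemma hk_ratio_cvg c : (forall e, (nullity (poly_op 'F_3 (3 ^ e.+1) d.+1 s) <= c * (3 ^ e.+1) ^ d)%N) ->
  cvgn hk_ratio.
Proof.
move=> hc; apply: nondecreasing_is_cvgn; first exact: hk_ratio_nondecreasing.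
exists c%:R => _ [e _ <-]; apply: (le_trans (hk_ratio_nondecreasing (leqnSn e))).
rewrite /hk_ratio ler_pdivrMr ?ltr0n ?expn_gt0 // -natrM ler_nat expnM.
exact: hc.
Qed.
End HilbertKunz.

Theorem theorem3p13 (R : realType) (d : nat) (hd : (2 <= d)%N) :
  eHK R 3 (S3 d) > eHK R 3 (R3 d).
Proof.
have K3 : 3%:R = 0 :> 'F_3 by exact/val_inj.
rewrite (eHK_hypersurface R hd (Rwords_below d) (R_words_chartable hd) _ (Q_E d)).
rewrite (eHK_hypersurface R hd (Swords_below d) (S_words_chartable hd) _ (P_E d)).
set u := hk_ratio _ _ _; set v := hk_ratio _ _ _.
have S_cvg : cvgn v.
  by apply: (hk_ratio_cvg (c := 3) (Swords_below d)) => e; apply: nullity_S_words_le => //; exact: ltnW.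
have R_cvg : cvgn u.
  apply: (hk_ratio_cvg (c := 3) (Rwords_below d)) => e.
  have := nullity_gap K3 e hd; have := @nullity_S_words_le _ K3 d e (ltnW hd).
  move=> h1 h2; apply: leq_trans h1; rewrite -(@leq_pmul2l (2 * 36 ^ d)) ?muln_gt0 ?expn_gt0 //.
  by apply: leq_trans h2; rewrite leq_addl.
(* The gap of [nullity_gap], divided by [q^d]. *)
pose eps : R := ((2 * 36 ^ d)%:R)^-1.
have eps0 : 0 < eps by rewrite invr_gt0 ltr0n muln_gt0 expn_gt0.
suff : limn u <= limn v - eps by move/le_lt_trans; apply; rewrite ltrBlDr ltrDl.
apply: limr_le => //; near=> e.
have e0 : (0 < e)%N by near: e; exists 1%N.
rewrite lerBrDr; apply: le_trans (nondecreasing_cvgn_le _ S_cvg e); last first.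
  exact: (hk_ratio_nondecreasing _ (Swords_below d)).
rewrite -(prednK e0) /u /v /hk_ratio; move: (e.-1) => k {e0}.
have := nullity_gap K3 k hd; rewrite -expnM.
set a := nullity _; set b := nullity _; set q := (3 ^ (k.+1 * d))%N; set c := (2 * 36 ^ d)%N => gap.
have c0 : 0 < c%:R :> R by rewrite ltr0n muln_gt0 expn_gt0.
have q0 : 0 < q%:R :> R by rewrite ltr0n expn_gt0.
rewrite ler_pdivlMr // mulrDl mulfVK ?gt_eqF // /eps -/c.
rewrite -(ler_pM2l c0) mulrDr mulrA divff ?gt_eqF // mul1r -!natrM -natrD ler_nat.
by rewrite addnC.
Unshelve. all: by end_near.
Qed.
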